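(* Let $R>1$. For every scalar or vector-valued $w\in H^1_0(\Omega_R)$, $$\|w\|_{L^4(\Omega_R)}^2\le\frac1{\mu_0}\sqrt{\frac{2}{3\pi}(R^2-1)}\;\|\nabla w\|_{L^2(\Omega_R)}^2 .$$ Moreover, $$\mu_0\sqrt{\frac{3\pi}{2(R^2-1)}}\le\mathcal S_4\le 24\sqrt{5\pi}\,\frac{\big[(R^2+1)\log R+1-R^2\big](R^2-1)\log R}{\sqrt{\kappa_1}},$$ where (writing $L=\log R$) $\kappa_1=-1080+5400R^2-10800R^4+10800R^6-5400R^8+1080R^{10}-2025L+6075R^2L-4050R^4L-4050R^6L+6075R^8L-2025R^{10}L-1700L^2+3400R^2L^2-1700R^4L^2+1700R^6L^2-3400R^8L^2+1700R^{10}L^2-750(1-R^2)L^3+750R^8L^3-750R^{10}L^3-144L^4+144R^{10}L^4 .$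
   Context: $\Omega_R=\{\xi\in\mathbb{R}^2:1<|\xi|<R\}$. $\mathcal S_4=\min_{v\in H^1_0(\Omega_R)\setminus\{0\}}\|\nabla v\|_{L^2(\Omega_R)}^2/\|v\|_{L^4(\Omega_R)}^2$. $\mu_0\approx2.40483$ is the first positive zero of the Bessel function $J_0$. For vector fields $w=(w_1,w_2)$, $\|w\|_{L^p}$ is the $L^p$ norm of $|w|$ and $\|\nabla w\|_{L^2}^2=\|\nabla w_1\|_{L^2}^2+\|\nabla w_2\|_{L^2}^2$. *)

(* Defs.v *)
From mathcomp Require Import all_boot all_order all_algebra.
From mathcomp Require Import all_classical all_reals all_analysis.
Set Implicit Arguments. Unset Strict Implicit. Unset Printing Implicit Defensive.
Import Order.TTheory GRing.Theory Num.Theory.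
Import numFieldNormedType.Exports.
Local Open Scope classical_set_scope.
Local Open Scope ring_scope.

Section Defs.
Variable R : realType.

Definition lam2 := ((@lebesgue_measure R) \x (@lebesgue_measure R))%E.

Definition annulus (Rad : R) : set (R * R) :=
  [set p | 1 < Num.sqrt (p.1 ^+ 2 + p.2 ^+ 2) < Rad].

Definition pd (b : bool) (f : R * R -> R) : R * R -> R :=
  fun p => if b then derive1 (fun t => f (p.1, t)) p.2
           else derive1 (fun t => f (t, p.2)) p.1.

Definition iter_pd (s : seq bool) (f : R * R -> R) : R * R -> R :=
  foldr pd f s.

Definition smooth2 (f : R * R -> R) : Prop :=
  forall s : seq bool,
    continuous (iter_pd s f) /\
    (forall p : R * R,
        derivable (fun t => iter_pd s f (t, p.2)) p.1 1 /\
        derivable (fun t => iter_pd s f (p.1, t)) p.2 1).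

Definition test_fun (D : set (R * R)) (f : R * R -> R) : Prop :=
  smooth2 f /\
  exists K : set (R * R), [/\ compact K, K `<=` D & forall p, ~ K p -> f p = 0].

Definition L2dist2 (D : set (R * R)) (f g : R * R -> R) : \bar R :=
  (\int[lam2]_(x in D) ((f x - g x) ^+ 2)%:E)%E.

(** [H10 D u g1 g2]: u belongs to H^1_0(D) (the closure of C_c^infty(D) in
    the H^1(D) norm) and (g1, g2) is its (weak) gradient: there is a sequence
    of test functions phi_n with phi_n -> u and grad phi_n -> (g1, g2) in
    L^2(D). *)
Definition H10 (D : set (R * R)) (u g1 g2 : R * R -> R) : Prop :=
  [/\ measurable_fun D u, measurable_fun D g1, measurable_fun D g2 &
  exists phi : nat -> R * R -> R,
    [/\ forall n, test_fun D (phi n),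
        (L2dist2 D (phi n) u @[n --> \oo] --> 0%E),
        (L2dist2 D (pd false (phi n)) g1 @[n --> \oo] --> 0%E) &
        (L2dist2 D (pd true (phi n)) g2 @[n --> \oo] --> 0%E)]].

Definition L4norm_sq (D : set (R * R)) (w : R * R -> R) : \bar R :=
  poweR (\int[lam2]_(x in D) (`|w x| ^+ 4)%:E)%E (2^-1).

Definition L4norm_sq_vec (D : set (R * R)) (w1 w2 : R * R -> R) : \bar R :=
  poweR (\int[lam2]_(x in D) ((Num.sqrt (w1 x ^+ 2 + w2 x ^+ 2)) ^+ 4)%:E)%E (2^-1).

Definition grad_norm_sq (D : set (R * R)) (g1 g2 : R * R -> R) : \bar R :=
  (\int[lam2]_(x in D) (g1 x ^+ 2 + g2 x ^+ 2)%:E)%E.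

(** S_4 = inf over nonzero v in H^1_0(Omega) of ||grad v||_2^2 / ||v||_4^2.
    (Both norms are finite for v in H^1_0; [fine] just moves them to R.) *)
Definition S4 (D : set (R * R)) : \bar R :=
  ereal_inf [set r : \bar R | exists v g1 g2 : R * R -> R,
    [/\ H10 D v g1 g2,
        ~ {ae lam2, forall x, D x -> v x = 0} &
        r = (fine (grad_norm_sq D g1 g2) / fine (L4norm_sq D v))%:E]].

Definition besselJ0 (x : R) : R :=
  limn (series (fun k : nat => (-1) ^+ k * (x / 2) ^+ (2 * k) / (k`!%:R) ^+ 2)).

Definition kappa1 (Rad : R) : R :=
  let L := ln Rad in
  -1080 + 5400 * Rad ^+ 2 - 10800 * Rad ^+ 4 + 10800 * Rad ^+ 6
  - 5400 * Rad ^+ 8 + 1080 * Rad ^+ 10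
  - 2025 * L + 6075 * Rad ^+ 2 * L - 4050 * Rad ^+ 4 * L - 4050 * Rad ^+ 6 * L
  + 6075 * Rad ^+ 8 * L - 2025 * Rad ^+ 10 * L
  - 1700 * L ^+ 2 + 3400 * Rad ^+ 2 * L ^+ 2 - 1700 * Rad ^+ 4 * L ^+ 2
  + 1700 * Rad ^+ 6 * L ^+ 2 - 3400 * Rad ^+ 8 * L ^+ 2 + 1700 * Rad ^+ 10 * L ^+ 2
  - 750 * (1 - Rad ^+ 2) * L ^+ 3 + 750 * Rad ^+ 8 * L ^+ 3 - 750 * Rad ^+ 10 * L ^+ 3
  - 144 * L ^+ 4 + 144 * Rad ^+ 10 * L ^+ 4.

End Defs.

(* Main.v *)
Require Import Defs.
From mathcomp Require Import all_boot all_order all_algebra.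
From mathcomp Require Import all_classical all_reals all_analysis.
From mathcomp Require Import measurable_realfun ring lra.
Import Order.TTheory GRing.Theory Num.Theory.
Import numFieldNormedType.Exports.
Local Open Scope classical_set_scope.
Local Open Scope ring_scope.
Set Implicit Arguments. Unset Strict Implicit. Unset Printing Implicit Defensive.

(** For test maps phi, the vector inequality is the product of two estimates.
    First, |phi|_4^4 <= 2/(3 pi) |phi|_2^2 |grad phi|_2^2: a Knothe map
    transports |phi|^4 to the density proportional to (1 + |x|^2)^-4, and
    an integration by parts against it bounds the integral of |phi|^4.
    Secondly, mu0^2/(R^2-1) |phi|_2^2 <= |grad phi|_2^2 by Barta's argument,
    applied to J_0 transplanted by s^2 = r^2 - 1 from a disk of the same area.
    Both pass to H^1_0, and give the lower bound for S_4. The upper bound is the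
    Rayleigh quotient of the torsion function (1 - r^2)/4 + c log(r^2), which is
    approximated by test functions and whose norms are elementary integrals in
    q = r^2. *)

(** The density (1 + |x|^2)^-4 is the fourth power of (1 + |x|^2)^-1, the extremal of the sharp
    planar inequality between the L^4 norm, the L^3 norm and the gradient. The transport argument
    produces |phi|_3^3, which Cauchy-Schwarz replaces by |phi|_4^2 |phi|_2; the constant 2/(3 pi)
    then results from the integrals pi/3 and pi/2 of (1 + |x|^2)^-4 and (1 + |x|^2)^-3. A triangular
    map is used because it only involves one-dimensional distribution functions and its Jacobian is
    the product of two diagonal entries, so no regularity theory of optimal maps enters. All
    estimates are written in the squared modulus, which stays differentiable where the modulus is
    not; scalar and vector maps are thereby treated alike. In the Poincare step the transplanted
    eigenfunction does not satisfy the eigenvalue equation on the annulus, but its logarithmic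
    derivative gives a vector field whose defect has a favourable sign, because s < r. In the
    passage to the limit, L^2 convergence gives no a priori control of the L^4 norm, and the sharp
    constant must survive the approximation. *)

Ltac dsolve := apply: is_derive_eq; rewrite /GRing.scale /=; by [ring|field].

(** * Compactly supported continuous functions *)

Section CompactSupport.
Variable R : realType.
Notation mu := (@lebesgue_measure R).
Notation lam2 := (@lam2 R).

(** The window is explicit instead of an existentially quantified compact set: sums, products and
    slices then share it without bookkeeping. For negative [a] the function is zero. *)
Definition Cc (a : R) (f : R -> R) : Prop :=
  continuous f /\ forall x, a < `|x| -> f x = 0.

Definition Cc2 (a : R) (f : R * R -> R) : Prop :=
  continuous f /\ forall p, a < `|p.1| \/ a < `|p.2| -> f p = 0.

(** Measurability in the plane refers to the product sigma-algebra, so open sets have to be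
    recovered from boxes: squares with rational centre and radius are countable, and every point of
    an open set has one around it inside the set. *)
Lemma open_measurable2 (U : set (R * R)) : open U -> measurable U.
Proof.
move=> oU.
pose B (q : (rat * rat) * rat) : set (R * R) :=
  ball (ratr q.1.1 : R) (ratr q.2) `*` ball (ratr q.1.2 : R) (ratr q.2).
have -> : U = \bigcup_(q in setT) (if `[< B q `<=` U >] then B q else set0).
  apply/seteqP; split=> [p Up|p [q _]]; last by case: asboolP => // BU /BU.
  have /nbhs_ballP[e /= e0 eU] : nbhs p U by exact: open_nbhs_nbhs.
  have e20 : 0 < e / 2 by lra.
  have [r] := rat_in_itvoo e20.
  rewrite in_itv/= => /andP[r0 re].
  have near_rat (x : R) : exists c : rat, `|ratr c - x| < ratr r.
    have xr : x - ratr r < x + ratr r by lra.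
    have [c] := rat_in_itvoo xr.
    by rewrite in_itv/= -ltr_distl => /= ?; exists c.
  have [c1 h1] := near_rat p.1; have [c2 h2] := near_rat p.2.
  exists ((c1, c2), r) => //; rewrite asboolT; first by split.
  move=> z [/= z1 z2]; apply: eU; split.
  - have rr : (ratr r + ratr r <= e :> R) by lra.
    apply: (le_ball rr).
    by apply: ball_triangle z1; rewrite /ball/= distrC.
  - have rr : (ratr r + ratr r <= e :> R) by lra.
    apply: (le_ball rr).
    by apply: ball_triangle z2; rewrite /ball/= distrC.
apply: countable_bigcupT_measurable; first exact: countableP.
by move=> q; case: asboolP => // _; apply: measurableX; rewrite ball_itv; exact: measurable_itv.
Qed.

Lemma continuous_measurable2 (f : R * R -> R) :
  continuous f -> measurable_fun setT f.
Proof.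
move=> /continuousP cf; apply: (measurability _ (measurable_realfun.RGenOpens.measurableE R)).
move=> _ [_ [a [b ->] <-]]; rewrite setTI; apply: open_measurable2.
exact/cf/interval_open.
Qed.

Lemma Cc2_bound a f : Cc2 a f -> exists2 M, 0 <= M & forall x, `|f x| <= M.
Proof.
move=> [cf f0].
pose K := `[- `|a|, `|a|]%classic `*` `[- `|a|, `|a|]%classic : set (R * R).
have cK : compact K by apply: compact_setX; exact: segment_compact.
have cN : {within K, continuous (fun x => `|f x|)}.
  apply: continuous_subspaceT => x; apply: continuous_comp; first exact: cf.
  exact: norm_continuous.
have [|c _ hc] := compact_EVT_max _ cK cN.
  by exists (0, 0); split; rewrite /= in_itv/= lerNl oppr0 normr_ge0.
exists `|f c| => // x.
have [ax|xa] := ltP a `|x.1|; first by rewrite f0 ?normr0//; left.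
have [ax|xb] := ltP a `|x.2|; first by rewrite f0 ?normr0//; right.
by apply: hc; rewrite inE; split; rewrite /= in_itv/= -ler_norml;
  rewrite (le_trans _ (ler_norm a)).
Qed.

Lemma Cc_integrable a f : Cc a f -> mu.-integrable setT (EFin \o f).
Proof.
move=> [cf f0].
have -> : EFin \o f = (EFin \o f) \_ `[- a, a]%classic.
  apply/funext => x; rewrite patchE; case: ifPn => //.
  rewrite notin_setE /= in_itv/= -ler_norml => /negP; rewrite -ltNge => ax.
  by rewrite f0.
apply: (iffLR (integrable_mkcond _ _)) => //.
apply: continuous_compact_integrable; first exact: segment_compact.
exact: continuous_subspaceT.
Qed.

Lemma Cc2_integrable a f : Cc2 a f -> lam2.-integrable setT (EFin \o f).
Proof.
move=> fa; have [M M0 fM] := Cc2_bound fa; have [cf f0] := fa.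
pose K := `[- a, a]%classic `*` `[- a, a]%classic : set (R * R).
have mK : measurable K by apply: measurableX; exact: measurable_itv.
have -> : EFin \o f = (EFin \o f) \_ K.
  apply/funext => x; rewrite patchE; case: ifPn => //.
  rewrite notin_setE /K /= !in_itv/= -!ler_norml => /not_andP[] /negP;
  by rewrite -ltNge => ax; rewrite f0; [|auto|auto..].
apply: (iffLR (integrable_mkcond _ _)) => //.
apply: measurable_bounded_integrable => //.
- have E := @product_measure1E _ _ _ _ _ mu mu _ _ (measurable_itv `[- a, a]) (measurable_itv `[- a, a]).
  rewrite [ltLHS]E.
  have fi : mu `[- a, a]%classic \is a fin_num.
    by have := @lebesgue_measure_itv R `[- a, a] => /= ->; case: ifP => //= _; rewrite -EFinB.
  by rewrite -ge0_fin_numE ?mule_ge0// fin_numM.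
- by apply: measurable_funTS; exact: continuous_measurable2.
- exists M; split; first exact: num_real.
  move=> y My x _ /=; by rewrite (le_trans (fM _))// (ltW My).
Qed.


Lemma cvg_pair_at (T : Type) (F : set_system T) (FF : Filter F) (f g : T -> R) (x y : R) :
  f @ F --> x -> g @ F --> y -> (fun t => (f t, g t)) @ F --> (x, y).
Proof. by move=> fx gy; exact: cvg_pair fx gy. Qed.

Lemma cvgXn (T : Type) (F : set_system T) (FF : Filter F) (f : T -> R) (x : R) n :
  f @ F --> x -> (fun t => f t ^+ n) @ F --> x ^+ n.
Proof. by move=> fx; apply: (continuous_cvg _ (@exprn_continuous _ n x)). Qed.

Lemma Cc_row a f x : Cc2 a f -> Cc a (fun y => f (x, y)).
Proof.
move=> [cf f0]; split => [y|y ay]; last by rewrite f0//; right.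
apply: (@continuous_comp _ _ _ (fun y => (x, y)) f); last exact: cf.
by apply: cvg_pair_at; [exact: cvg_cst|exact: cvg_id].
Qed.

Lemma Cc_col a f y : Cc2 a f -> Cc a (fun x => f (x, y)).
Proof.
move=> [cf f0]; split => [x|x ax]; last by rewrite f0//; left.
apply: (@continuous_comp _ _ _ (fun x => (x, y)) f); last exact: cf.
by apply: cvg_pair_at; [exact: cvg_id|exact: cvg_cst].
Qed.

Lemma Cc_swap a f : Cc2 a f -> Cc2 a (fun p => f (p.2, p.1)).
Proof.
move=> [cf f0]; split => [p|p [h|h]]; [|by rewrite f0//; right|by rewrite f0//; left].
apply: (@continuous_comp _ _ _ (fun p : R * R => (p.2, p.1)) f); last exact: cf.
by apply: cvg_pair_at; [exact: cvg_snd|exact: cvg_fst].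
Qed.

(** Domination by the bound of [f] on the window gives continuity. Marginals thus stay in the same
    class and can be transported in turn. *)
Lemma Cc_int a f : Cc2 a f -> Cc a (fun x => \int[mu]_y f (x, y)).
Proof.
move=> fa; have [M M0 fM] := Cc2_bound fa; have [cf f0] := fa; split; last first.
  move=> x ax; rewrite (_ : Rintegral _ _ _ = \int[mu]_(y in setT) 0); last first.
    by apply: eq_Rintegral => y _; rewrite f0//; left.
  by rewrite Rintegral_cst//= mul0r.
move=> x.
have g_int : mu.-integrable setT (EFin \o (fun y => M * \1_(`[- a, a]%classic) y)).
  rewrite (_ : _ \o _ = (EFin \o cst M) \_ `[- a, a]%classic); last first.
    apply/funext => y; rewrite patchE /= indicE; case: ifPn => _;
    by rewrite ?mulr1 ?mulr0.
  apply: (iffLR (integrable_mkcond _ _)) => //.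
  apply: continuous_compact_integrable; first exact: segment_compact.
  by apply: continuous_subspaceT => ?; exact: cvg_cst.
apply: (@continuity_under_integral R _ _ mu (fun x y => f (x, y)) setT measurableT
  (x - 1) (x + 1) _ _ _ g_int).
- by move=> z _; exact: Cc_integrable (Cc_row _ fa).
- apply: aeW => y _ z _; exact: (Cc_col y fa).1.
- move=> z _; apply: aeW => y _.
  rewrite indicE; case: (boolP (y \in _)) => [_|]; first by rewrite mulr1 fM.
  rewrite notin_setE /= in_itv/= -ler_norml => /negP; rewrite -ltNge => ay.
  by rewrite f0 ?normr0 ?mulr0//; right.
- by rewrite inE/= in_itv/=; apply/andP; split; lra.
Qed.

Lemma Cc_fubini a f : Cc2 a f ->
  \int[mu]_x \int[mu]_y f (x, y) = \int[mu]_y \int[mu]_x f (x, y).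
Proof.
move=> fa; have fi := Cc2_integrable fa; have := Fubini fi.
rewrite /Rintegral => FE; congr fine.
transitivity (\int[mu]_x \int[mu]_y (f (x, y))%:E)%E.
  apply: eq_integral => x _; rewrite fineK//.
  exact: integrable_fin_num (Cc_integrable (Cc_row x fa)).
rewrite FE; apply: eq_integral => x _; rewrite fineK//.
exact: integrable_fin_num (Cc_integrable (Cc_col x fa)).
Qed.

Lemma Cc_lam2 a f : Cc2 a f ->
  \int[lam2]_p f p = \int[mu]_x \int[mu]_y f (x, y).
Proof.
move=> fa; have fi := Cc2_integrable fa.
rewrite /Rintegral -integral12_prod_meas1//; congr fine.
apply: eq_integral => x _; rewrite fineK//.
exact: integrable_fin_num (Cc_integrable (Cc_row x fa)).
Qed.

Lemma Cc_D a f g : Cc a f -> Cc a g -> Cc a (fun x => f x + g x).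
Proof.
move=> [cf f0] [cg g0]; split=> [x|x ax]; last by rewrite f0// g0// addr0.
by apply: cvgD; [exact: cf|exact: cg].
Qed.

Lemma Cc_Ml a f g : Cc a f -> continuous g -> Cc a (fun x => f x * g x).
Proof.
move=> [cf f0] cg; split=> [x|x ax]; last by rewrite f0// mul0r.
by apply: cvgM; [exact: cf|exact: cg].
Qed.

Lemma Cc_Z a c f : Cc a f -> Cc a (fun x => c * f x).
Proof.
move=> [cf f0]; split=> [x|x ax]; last by rewrite f0// mulr0.
by apply: cvgM; [exact: cvg_cst|exact: cf].
Qed.

Lemma Cc2_Z a c f : Cc2 a f -> Cc2 a (fun x => c * f x).
Proof.
move=> [cf f0]; split=> [x|x ax]; last by rewrite f0// mulr0.
by apply: cvgM; [exact: cvg_cst|exact: cf].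
Qed.

Lemma Cc2_D a f g : Cc2 a f -> Cc2 a g -> Cc2 a (fun x => f x + g x).
Proof.
move=> [cf f0] [cg g0]; split=> [x|x ax]; last by rewrite f0// g0// addr0.
by apply: cvgD; [exact: cf|exact: cg].
Qed.

Lemma Cc2_Ml a f g : Cc2 a f -> continuous g -> Cc2 a (fun x => f x * g x).
Proof.
move=> [cf f0] cg; split=> [x|x ax]; last by rewrite f0// mul0r.
by apply: cvgM; [exact: cf|exact: cg].
Qed.

Lemma RintD_Cc a f g : Cc a f -> Cc a g ->
  \int[mu]_x (f x + g x) = \int[mu]_x f x + \int[mu]_x g x.
Proof. by move=> fa ga; rewrite RintegralD//; apply: Cc_integrable; eassumption. Qed.

Lemma RintZ_Cc a c f : Cc a f -> \int[mu]_x (c * f x) = c * \int[mu]_x f x.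
Proof. by move=> fa; rewrite RintegralZl//; apply: Cc_integrable; eassumption. Qed.

Lemma le_Rint_Cc a f g : Cc a f -> Cc a g -> (forall x, f x <= g x) ->
  \int[mu]_x f x <= \int[mu]_x g x.
Proof.
by move=> fa ga fg; apply: le_Rintegral => //; apply: Cc_integrable; eassumption.
Qed.

Lemma Rint_deriv_supp a b (F f : R -> R) : a < b -> continuous f ->
  (forall x : R, is_derive x (1 : R) F (f x)) -> (forall x, x < a \/ b < x -> f x = 0) ->
  \int[mu]_x f x = F b - F a.
Proof.
move=> ab cf dF f0.
have FE x : derive1 F x = f x by rewrite derive1E; apply: derive_val.
have Fc : continuous F.
  by move=> x; apply/differentiable_continuous/derivable1_diffP/(ex_derive (is_derive := dF x)).
have -> : \int[mu]_x f x = \int[mu]_(x in `[a, b]) f x.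
  rewrite [RHS]Rintegral_mkcond; apply: eq_Rintegral => x _; rewrite patchE.
  case: ifPn => //; rewrite notin_setE /= in_itv/= => /negP.
  by rewrite negb_and -!ltNge => /orP h; apply: f0.
rewrite /Rintegral (@continuous_FTC2 _ f F)//.
- exact: continuous_subspaceT.
- split; [by move=> x _; exact: ex_derive| |].
  + by apply: cvg_at_right_filter; exact: Fc.
  + by apply: cvg_at_left_filter; exact: Fc.
Qed.

(** Only the primitive is assumed to have compact support; its derivative vanishes outside the
    window because the primitive is locally zero there. In this form total derivatives drop out of
    integrals. *)
Lemma Rint_deriv_Cc a (F f : R -> R) : Cc a F -> continuous f ->
  (forall x : R, is_derive x (1 : R) F (f x)) -> \int[mu]_x f x = 0.
Proof.
move=> [_ F0] cf dF.
have a0 : - (`|a| + 1) < `|a| + 1 by have := normr_ge0 a; lra.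
have aa := ler_norm a.
have FE : forall x, `|a| < `|x| -> F x = 0 by move=> x ax; apply: F0; lra.
rewrite (Rint_deriv_supp a0 cf dF).
  by rewrite !FE ?subrr ?normrN// [X in _ < X]ger0_norm ?addr_ge0// ltrDl.
move=> x hx; have ax : `|a| < `|x|.
  by case: hx => hx; [have := ler_norm (- x); rewrite normrN; lra|have := ler_norm x; lra].
rewrite (_ : f x = 'D_1 F x); last by rewrite (@derive_val _ _ _ _ _ _ _ (dF x)).
rewrite (near_eq_derive (g := cst 0)) ?oner_neq0//; first exact: derive_cst.
near=> z; apply: FE; near: z.
have /(_ x) := @norm_continuous _ R; move/cvgr_gt; apply; exact: ax.
Unshelve. all: by end_near. Qed.

Definition cdf (p : R -> R) (x : R) : R := \int[mu]_(t in `]-oo, x]) p t.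

Lemma cdf_derive a p x : Cc a p -> is_derive x (1 : R) (cdf p) (p x).
Proof.
move=> pa; have [cp _] := pa.
have xx : x < x + 1 by lra.
have ip : mu.-integrable [set` Interval -oo%O (BRight (x + 1))] (EFin \o p).
  by apply: integrableS (Cc_integrable pa).
have H := continuous_FTC1 xx ip.
have lx : (-oo < BRight x)%O by [].
have [|d e] := H _ (cp x).
  first [exact: lx|by rewrite bnd_simp|by rewrite ltNyr|by rewrite /Order.lt/=].
by rewrite -e derive1E; exact/derivableP.
Qed.

Lemma cdf_low a p x : Cc a p -> x <= - a -> cdf p x = 0.
Proof.
move=> pa xa.
have [cp p0] := pa.
rewrite /cdf (_ : \int[mu]_(t in _) p t = \int[mu]_(t in `]-oo, x]) 0).
  by rewrite /Rintegral integral0.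
(* The endpoint is discarded: for [x = - a] the support condition, being strict, says nothing
   there. *)
rewrite -[LHS]Rintegral_itv_bndo_bndc//; last by apply: integrableS (Cc_integrable pa).
rewrite -[RHS]Rintegral_itv_bndo_bndc//; last first.
  by exact: (@integrable0 _ _ _ mu `]-oo, x[%classic).
apply: eq_Rintegral => t; rewrite inE /= in_itv/= => tx; apply: p0.
by have := ler_norm (- t); rewrite normrN; lra.
Qed.

Lemma cdf_high a p x : Cc a p -> a <= x -> cdf p x = \int[mu]_t p t.
Proof.
move=> pa ax; have [cp p0] := pa.
rewrite /cdf Rintegral_mkcond; apply: eq_Rintegral => t _; rewrite patchE.
case: ifPn => //; rewrite notin_setE /= in_itv/= => /negP; rewrite -ltNge => xt.
by rewrite p0//; have := ler_norm t; lra.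
Qed.

Lemma cdf_ge0 p x : (forall x, 0 <= p x) -> 0 <= cdf p x.
Proof. by move=> p0; exact: Rintegral_ge0. Qed.

Lemma cdf_le a p x : Cc a p -> (forall x, 0 <= p x) -> cdf p x <= \int[mu]_t p t.
Proof.
move=> pa p0; rewrite /cdf Rintegral_mkcond; apply: le_Rintegral => //.
- rewrite -restrict_EFin; apply: (iffLR (integrable_mkcond _ _)) => //.
  exact: integrableS (Cc_integrable pa).
- exact: Cc_integrable pa.
- by move=> t _; rewrite patchE; case: ifP.
Qed.

End CompactSupport.

(** * Knothe transport and the Gagliardo-Nirenberg inequality *)

Section Transport.
Variable R : realType.
Notation mu := (@lebesgue_measure R).
Implicit Types (a x y t : R).


Lemma is_derive_continuous (f df : R -> R) :
  (forall x : R, is_derive x (1 : R) f (df x)) -> continuous f.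
Proof.
move=> H x; apply/differentiable_continuous/derivable1_diffP.
by have h := H x; apply: ex_derive.
Qed.

Lemma is_deriveE (f : R -> R) (x d d' : R) :
  is_derive x (1 : R) f d -> d = d' -> is_derive x (1 : R) f d'.
Proof. by move=> h <-. Qed.

Lemma is_derive_pos_lt (G g : R -> R) s t :
  (forall x : R, is_derive x (1 : R) G (g x)) -> (forall x, 0 < g x) ->
  s < t -> G s < G t.
Proof.
move=> dG g0 st; have [|c _ e] := @MVT _ G g s t st (fun x _ => dG x).
  by apply: continuous_subspaceT; exact: is_derive_continuous dG.
by rewrite -subr_gt0 e mulr_gt0// subr_gt0.
Qed.

(** [Q] is only a left inverse, since the primitives [G4] and [G7] used later are bounded and not
    onto; its derivative is therefore asserted at points [G t] alone. *)
Lemma is_derive_pos_inv (G g : R -> R) :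
  (forall x : R, is_derive x (1 : R) G (g x)) -> (forall x, 0 < g x) ->
  exists Q : R -> R, (forall t : R, is_derive (G t) (1 : R) Q (g t)^-1) /\ cancel G Q.
Proof.
move=> dG g0; exists (fun u => xget 0 [set t | G t = u]).
have GK : cancel G (fun u => xget 0 [set t | G t = u]).
  move=> t; case: xgetP => [s _ /= Gs|/(_ t) /(_ erefl)//].
  case: (ltgtP s t) => // st; have := is_derive_pos_lt dG g0 st;
  by rewrite Gs ltxx.
split=> // t; apply: is_derive_inverse; [by exists 1 => //= y _; exact: GK| |by rewrite gt_eqF].
by exists 1 => //= y _; apply: is_derive_continuous dG _.
Qed.

(* The increasing map sending the density [p / m] to the density proportional to
   [g] on [-N, N]; truncating the target keeps the map bounded. *)
Lemma transport1 a (p G g : R -> R) (N : R) :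
  Cc a p -> (forall x, 0 <= p x) -> 0 < \int[mu]_x p x ->
  (forall x : R, is_derive x (1 : R) G (g x)) -> continuous g -> (forall x, 0 < g x) ->
  0 < N ->
  exists S : R -> R,
   (forall x : R, is_derive x (1 : R) S
      ((G N - G (- N)) * p x / (\int[mu]_x p x) / g (S x))) /\
   (forall H h : R -> R, (forall t : R, is_derive t (1 : R) H (h t * g t)) ->
     continuous h ->
     \int[mu]_x (p x * h (S x)) =
       \int[mu]_x p x * ((H N - H (- N)) / (G N - G (- N)))).
Proof.
move=> pa p0 m0 dG cg g0 N0; set m := \int[mu]_x p x in m0 *.
set b := G N - G (- N).
have b0 : 0 < b by rewrite subr_gt0; apply: (is_derive_pos_lt dG g0); lra.
have [Q [dQ GK]] := is_derive_pos_inv dG g0.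
(* The distribution function of [p / m], rescaled affinely onto [[G (- N), G N]]; each of its values
   is some [G t], so that [Q] inverts it. *)
pose u x := G (- N) + b / m * cdf p x.
have u_rng x : exists t, G t = u x.
  have NN : - N <= N by lra.
  have cG : {within `[- N, N], continuous G}.
    by apply: continuous_subspaceT; exact: is_derive_continuous dG.
  have c0 : 0 <= cdf p x / m <= 1.
    rewrite divr_ge0 ?cdf_ge0 ?(ltW m0)//= ler_pdivrMr// mul1r.
    exact: cdf_le pa p0.
  have [|t _ <-] := @IVT _ G (- N) N (u x) NN cG; last by exists t.
  have uE : u x = G (- N) + b * (cdf p x / m) by rewrite /u; ring.
  have GN : G N = G (- N) + b by rewrite /b; ring.
  rewrite ge_min le_max GN uE.
  by apply/andP; split; apply/orP; [left|right]; nra.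
pose S x := Q (u x).
have GS x : G (S x) = u x by rewrite /S; have [t <-] := u_rng x; rewrite GK.
have dS x : is_derive x (1 : R) S (b * p x / m / g (S x)).
  have du : is_derive x (1 : R) u (b / m * p x).
    rewrite /u; have := cdf_derive x pa => h.
    dsolve.
  have dQu : is_derive (u x) (1 : R) Q (g (S x))^-1 by rewrite -GS.
  apply: (is_deriveE (is_derive1_comp dQu du)).
  by rewrite mulrC; ring.
have cS : continuous S := is_derive_continuous dS.
exists S; split => // H h dH ch.
(* Change of variables through a primitive: [f] is the derivative of [H \o S], whose total increment
   is that of [H] between [- N] and [N]. *)
pose f x := b / m * (p x * h (S x)).
have dHS x : is_derive x (1 : R) (H \o S) (f x).
  apply: (is_deriveE (is_derive1_comp (dH (S x)) (dS x))).
  by rewrite /f; field; rewrite !gt_eqF.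
have [cp p00] := pa.
have chS : continuous (h \o S).
  by move=> x; apply: continuous_comp; [exact: cS|exact: ch].
have phC : Cc a (fun x => p x * h (S x)) by exact: (Cc_Ml pa chS).
have cf : continuous f.
  by move=> x; apply: cvgM; [exact: cvg_cst|exact: phC.1].
pose A := `|a| + 1.
have A0 : - A < A by rewrite /A; have := normr_ge0 a; lra.
have aA := ler_norm a.
have f0 x : x < - A \/ A < x -> f x = 0.
  rewrite /f /A => hx; rewrite p00 ?mul0r ?mulr0//.
  by have := ler_norm x; have := ler_norm (- x); rewrite normrN; case: hx; lra.
have SA : S A = N.
  rewrite /S /u (cdf_high pa); last by rewrite /A; lra.
  rewrite -/m divfK ?gt_eqF// (_ : G (- N) + b = G N) ?GK//.
  by rewrite /b; ring.
have SNA : S (- A) = - N.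
  rewrite /S /u (cdf_low pa); last by rewrite /A; lra.
  by rewrite mulr0 addr0 GK.
have := Rint_deriv_supp A0 cf dHS f0.
rewrite /f (RintZ_Cc _ phC) /= SA SNA => <-.
by field; rewrite !gt_eqF.
Qed.

(** The cube of the modulus, as a function of the squared modulus, is differentiable even at 0,
    where the square root is not: there the Caratheodory slope is the square root itself. *)
Lemma is_derive_xsqrt t : 0 <= t ->
  is_derive t (1 : R) (fun t => t * Num.sqrt t) (3 / 2 * Num.sqrt t).
Proof.
rewrite le_eqVlt => /predU1P[<-|t0].
  apply/is_derive1_caratheodory; exists Num.sqrt; split.
  - by move=> z; rewrite mul0r !subr0 mulrC.
  - exact: sqrt_continuous.
  - by rewrite sqrtr0 mulr0.
have h := is_derive1_sqrt t0; apply: is_derive_eq; rewrite /GRing.scale /=.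
rewrite -{1}(sqr_sqrtr (ltW t0)); field.
by rewrite sqrtr_eq0 -ltNge.
Qed.

(* Here and below [r] stands for the squared modulus of a test map and [e] for
   the energy density of its gradient, which satisfy |r'|^2 <= 4 r e. *)
Lemma parts_bound a (r r' e T T' : R -> R) (eta : R) :
  Cc a r -> (forall x, 0 <= r x) -> (forall x : R, is_derive x (1 : R) r (r' x)) ->
  continuous r' -> Cc a e -> (forall x, 0 <= e x) ->
  (forall x, r' x ^+ 2 <= 4 * r x * e x) ->
  (forall x : R, is_derive x (1 : R) T (T' x)) -> continuous T' -> 0 < eta ->
  \int[mu]_x (r x * Num.sqrt (r x) * T' x) <=
  3 / 2 * (eta * \int[mu]_x e x + (\int[mu]_x (r x ^+ 2 * T x ^+ 2)) / eta).
Proof.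
move=> ra r0 dr cr' ea e0 re dT cT' eta0.
have [cr r00] := ra.
have cT := is_derive_continuous dT.
have csr : continuous (fun x => Num.sqrt (r x)).
  by move=> x; apply: continuous_comp; [exact: cr|exact: sqrt_continuous].
have rsC : Cc a (fun x => r x * Num.sqrt (r x)) by exact: Cc_Ml.
have rsT : Cc a (fun x => r x * Num.sqrt (r x) * T x) by exact: Cc_Ml.
have rsT' : Cc a (fun x => r x * Num.sqrt (r x) * T' x) by exact: Cc_Ml.
have r2T2 : Cc a (fun x => r x ^+ 2 * T x ^+ 2).
  rewrite (_ : (fun x => _) = fun x => r x * (r x * (T x * T x))); last first.
    by apply/funext => x; rewrite !expr2; ring.
  by apply: Cc_Ml => // x; apply: cvgM; [exact: cr|apply: cvgM; exact: cT].
have r'0 x : a < `|x| -> r' x = 0.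
  move=> ax; have := re x; rewrite r00// mulr0 mul0r => h.
  by apply/eqP; rewrite -sqrf_eq0 eq_le h sqr_ge0.
have r'C : Cc a (fun x => r' x * (3 / 2 * Num.sqrt (r x) * T x)).
  apply: Cc_Ml; first by split.
  by move=> x; apply: cvgM; [apply: cvgM; [exact: cvg_cst|exact: csr]|exact: cT].
have ibp : \int[mu]_x (r x * Num.sqrt (r x) * T' x +
    r' x * (3 / 2 * Num.sqrt (r x) * T x)) = 0.
  apply: (Rint_deriv_Cc rsT).
    by move=> x; apply: cvgD; [exact: rsT'.1|exact: r'C.1].
  move=> x; have h1 := dr x; have h2 := dT x.
  have h3 := is_derive1_comp (is_derive_xsqrt (r0 x)) h1.
  have -> : (fun x => r x * Num.sqrt (r x) * T x) = ((fun t => t * Num.sqrt t) \o r) * T.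
    by apply/funext.
  dsolve.
move: ibp; rewrite (RintD_Cc rsT' r'C) => ibp.
have eC : Cc a (fun x => eta * e x) := Cc_Z eta ea.
have qC : Cc a (fun x => eta^-1 * (r x ^+ 2 * T x ^+ 2)) := Cc_Z _ r2T2.
have -> : 3 / 2 * (eta * \int[mu]_x e x + (\int[mu]_x (r x ^+ 2 * T x ^+ 2)) / eta) =
   \int[mu]_x (3 / 2 * (eta * e x + eta^-1 * (r x ^+ 2 * T x ^+ 2))).
  rewrite (RintZ_Cc _ (Cc_D eC qC)) (RintD_Cc eC qC).
  by rewrite (RintZ_Cc _ ea) (RintZ_Cc _ r2T2) [in LHS](mulrC _ eta^-1).
have -> : \int[mu]_x (r x * Num.sqrt (r x) * T' x) =
    \int[mu]_x ((-1) * (r' x * (3 / 2 * Num.sqrt (r x) * T x))).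
  rewrite (RintZ_Cc _ r'C); lra.
apply: le_Rint_Cc; [exact: Cc_Z r'C|exact: Cc_Z (Cc_D eC qC)|move=> x].
set s := Num.sqrt (r x); have s2 : s ^+ 2 = r x by rewrite sqr_sqrtr.
(* Young's inequality with weight [eta]: by the energy bound on [r'], the square of the left side is
   at most four times the product of the two terms on the right. *)
suff : - (s * r' x * T x) <= eta * e x + eta^-1 * (r x ^+ 2 * T x ^+ 2) by lra.
set X := eta * e x; set Y := eta^-1 * _.
have X0 : 0 <= X by rewrite mulr_ge0// ltW.
have Y0 : 0 <= Y.
  by apply: mulr_ge0; [rewrite invr_ge0 ltW|apply: mulr_ge0; exact: sqr_ge0].
have : (s * r' x * T x) ^+ 2 <= 4 * X * Y.
  have -> : 4 * X * Y = r x * (4 * r x * e x) * T x ^+ 2.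
    by rewrite /X /Y; field; rewrite gt_eqF.
  rewrite !exprMn s2; apply: ler_wpM2r; first exact: sqr_ge0.
  exact: ler_wpM2l.
move: (s * r' x * T x) => w hw.
have [|w0] := leP (- w) 0; first by move=> /le_trans; apply; exact: addr_ge0.
rewrite -(@ler_pXn2r _ 2)// ?nnegrE ?addr_ge0 ?(ltW w0)//.
rewrite sqrrN; apply: (le_trans hw).
have := sqr_ge0 (X - Y); nra.
Qed.


(* [g4] and [g7] are the target densities of the second and the first
   coordinate: (1 + |x|^2)^-4 factors, up to the scaling x2 = jap x1 * t, as
   g7(x1) * g4(t). [Gi] is an antiderivative of [gi] and [Hi] one of
   [t ^+ 2 * gi t]. *)
Definition g4 (t : R) : R := ((1 + t ^+ 2) ^+ 4)^-1.
Definition G4 (t : R) : R :=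
  5 / 16 * atan t + (15 * t ^+ 5 + 40 * t ^+ 3 + 33 * t) / (48 * (1 + t ^+ 2) ^+ 3).
Definition H4 (t : R) : R :=
  1 / 16 * atan t + (3 * t ^+ 5 + 8 * t ^+ 3 - 3 * t) / (48 * (1 + t ^+ 2) ^+ 3).

Definition jap (t : R) : R := Num.sqrt (1 + t ^+ 2).
Definition g7 (t : R) : R := (jap t ^+ 7)^-1.
Definition G7 (t : R) : R :=
  t / jap t - 2 / 3 * (t / jap t) ^+ 3 + 1 / 5 * (t / jap t) ^+ 5.
Definition H7 (t : R) : R := 1 / 3 * (t / jap t) ^+ 3 - 1 / 5 * (t / jap t) ^+ 5.

Lemma sq1_gt0 t : 0 < 1 + t ^+ 2.
Proof. by have := sqr_ge0 t; lra. Qed.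

Lemma jap_gt0 t : 0 < jap t.
Proof. by rewrite sqrtr_gt0 sq1_gt0. Qed.

Lemma jap2 t : jap t ^+ 2 = 1 + t ^+ 2.
Proof. by rewrite sqr_sqrtr// ltW// sq1_gt0. Qed.

Lemma is_derive_G4 t : is_derive t (1 : R) G4 (g4 t).
Proof.
have ha := is_derive1_atan t.
have n0 : 1 + t ^+ 2 != 0 by rewrite gt_eqF// sq1_gt0.
have hq : is_derive t (1 : R) (fun t => (48 * (1 + t ^+ 2) ^+ 3)^-1)
    (- (48 * (1 + t ^+ 2) ^+ 3) ^- 2 *: (288 * t * (1 + t ^+ 2) ^+ 2)).
  apply: is_deriveV; first by rewrite mulf_neq0// expf_neq0.
  dsolve.
rewrite /G4 /g4; apply: is_derive_eq; rewrite /GRing.scale /=; field.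
by rewrite n0.
Qed.

Lemma is_derive_H4 t : is_derive t (1 : R) H4 (t ^+ 2 * g4 t).
Proof.
have ha := is_derive1_atan t.
have n0 : 1 + t ^+ 2 != 0 by rewrite gt_eqF// sq1_gt0.
have hq : is_derive t (1 : R) (fun t => (48 * (1 + t ^+ 2) ^+ 3)^-1)
    (- (48 * (1 + t ^+ 2) ^+ 3) ^- 2 *: (288 * t * (1 + t ^+ 2) ^+ 2)).
  apply: is_deriveV; first by rewrite mulf_neq0// expf_neq0.
  dsolve.
rewrite /H4 /g4; apply: is_derive_eq; rewrite /GRing.scale /=; field.
by rewrite n0.
Qed.

Lemma is_derive_jap t : is_derive t (1 : R) jap (t / jap t).
Proof.
have h := is_derive1_sqrt (sq1_gt0 t).
have h2 : is_derive t (1 : R) (fun t => 1 + t ^+ 2) (2 * t) by dsolve.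
have h3 := is_derive1_comp (g := fun t => 1 + t ^+ 2) h h2.
apply: (is_deriveE (f := jap) h3); rewrite -/(jap t).
by field; rewrite gt_eqF// jap_gt0.
Qed.

Lemma is_derive_tjap t : is_derive t (1 : R) (fun t => t / jap t) (jap t ^+ 3)^-1.
Proof.
have n0 : jap t != 0 by rewrite gt_eqF// jap_gt0.
have h := is_derive_jap t; have hV := is_deriveV n0 h.
apply: is_derive_eq; rewrite /GRing.scale /=.
have e : t ^+ 2 = jap t ^+ 2 - 1 by rewrite jap2; ring.
transitivity ((jap t ^+ 2 - t ^+ 2) / jap t ^+ 3); first by field.
by rewrite e; field.
Qed.

Lemma tjap2 t : (t / jap t) ^+ 2 = 1 - (jap t ^+ 2)^-1.
Proof.
have n0 : jap t != 0 by rewrite gt_eqF// jap_gt0.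
rewrite expr_div_n (_ : t ^+ 2 = jap t ^+ 2 - 1); last by rewrite jap2; ring.
by field.
Qed.

Lemma is_derive_G7 t : is_derive t (1 : R) G7 (g7 t).
Proof.
have n0 : jap t != 0 by rewrite gt_eqF// jap_gt0.
have h := is_derive_tjap t; rewrite /G7 /g7; apply: is_derive_eq.
rewrite /GRing.scale /=.
transitivity ((jap t ^+ 3)^-1 * (1 - 2 * (t / jap t) ^+ 2 + ((t / jap t) ^+ 2) ^+ 2)).
  by field.
by rewrite tjap2; field.
Qed.

Lemma is_derive_H7 t : is_derive t (1 : R) H7 (t ^+ 2 * g7 t).
Proof.
have n0 : jap t != 0 by rewrite gt_eqF// jap_gt0.
have h := is_derive_tjap t; rewrite /H7 /g7; apply: is_derive_eq.
rewrite /GRing.scale /=.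
transitivity ((jap t ^+ 3)^-1 * ((t / jap t) ^+ 2 - ((t / jap t) ^+ 2) ^+ 2)).
  by field.
rewrite (_ : t ^+ 2 = jap t ^+ 2 - 1); last by rewrite jap2; ring.
by rewrite tjap2; field.
Qed.

Lemma continuous_jap : continuous jap.
Proof. exact: is_derive_continuous is_derive_jap. Qed.

Lemma continuous_g4 : continuous g4.
Proof.
move=> t; apply: cvgV; first by rewrite expf_neq0// gt_eqF// sq1_gt0.
apply: cvgXn; apply: cvgD; [exact: cvg_cst|exact: exprn_continuous].
Qed.

Lemma continuous_g7 : continuous g7.
Proof.
move=> t; apply: cvgV; first by rewrite expf_neq0// gt_eqF// jap_gt0.
apply: cvgXn; exact: continuous_jap.
Qed.

(** Masses and normalised second moments of the truncated targets. As [N] grows, [k7 * k4] tends to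
    pi/3 and [k7 * k4 * (1 + t7) * (1 + s4)] to pi/2, the integrals of (1 + |x|^2)^-4 and (1 +
    |x|^2)^-3 over the plane. *)
Definition k4 N : R := G4 N - G4 (- N).
Definition s4 N : R := (H4 N - H4 (- N)) / k4 N.
Definition k7 N : R := G7 N - G7 (- N).
Definition t7 N : R := (H7 N - H7 (- N)) / k7 N.

(** One slice of the two-dimensional estimate: [c] is [jap] of the first transported coordinate, [d]
    is the derivative of that coordinate, and the second coordinate is [c * S], so that
    [c ^+ 2 * (1 + S ^+ 2)] is 1 + |T|^2. The equation on [d] is the Monge-Ampere equation: it makes
    theta^4 (1 + |T|^2)^4 r^2 equal to the Jacobian [d * T']. *)
Lemma gn_slice a (r r' e : R -> R) (c d theta lam eta N : R) :
  Cc a r -> (forall x, 0 <= r x) -> (forall x : R, is_derive x (1 : R) r (r' x)) ->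
  continuous r' -> Cc a e -> (forall x, 0 <= e x) ->
  (forall x, r' x ^+ 2 <= 4 * r x * e x) ->
  0 < c -> 0 <= d -> 0 <= theta -> 0 < lam -> 0 < eta -> 0 < N ->
  let F := \int[mu]_x (r x ^+ 2) in
  d * c * k4 N = theta ^+ 4 * c ^+ 8 * F ->
  theta * c ^+ 2 * F * (1 + s4 N) <=
  (lam / 2 + d / (4 * lam)) * \int[mu]_x (r x * Num.sqrt (r x)) +
  3 / (8 * lam) * (eta * \int[mu]_x e x + F * c ^+ 2 * s4 N / eta).
Proof.
move=> ra r0 dr cr' ea e0 re c0 d0 th0 lam0 eta0 N0 F hF.
have [cr r00] := ra.
have csr : continuous (fun x => Num.sqrt (r x)).
  by move=> x; apply: continuous_comp; [exact: cr|exact: sqrt_continuous].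
have rsC : Cc a (fun x => r x * Num.sqrt (r x)) by exact: Cc_Ml.
have r2C : Cc a (fun x => r x ^+ 2).
  by rewrite (_ : (fun _ => _) = fun x => r x * r x)//; exact: Cc_Ml.
have k0 : 0 < k4 N.
  rewrite subr_gt0; apply: (is_derive_pos_lt is_derive_G4); last by lra.
  by move=> t; rewrite invr_gt0 exprn_gt0// sq1_gt0.
have F0 : 0 <= F by apply: Rintegral_ge0 => x _; exact: sqr_ge0.
have : 0 <= F := F0; rewrite le_eqVlt => /predU1P[F00|Fp].
  rewrite -F00 !mulr0 !mul0r addr0.
  apply: addr_ge0; apply: mulr_ge0.
  - by apply: addr_ge0; apply: divr_ge0 => //; rewrite ?mulr_ge0 ?ltW.
  - by apply: Rintegral_ge0 => x _; rewrite mulr_ge0.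
  - by rewrite divr_ge0// mulr_ge0// ltW.
  - by apply: mulr_ge0; [exact: ltW|exact: Rintegral_ge0].
have g40 t : 0 < g4 t by rewrite invr_gt0 exprn_gt0// sq1_gt0.
have [S [dS mom]] := transport1 r2C (fun x => sqr_ge0 (r x)) Fp is_derive_G4
  continuous_g4 g40 N0.
have cS := is_derive_continuous dS.
pose T x := c * S x.
pose T' x := c * (k4 N * r x ^+ 2 / F * (1 + S x ^+ 2) ^+ 4).
have dT x : is_derive x (1 : R) T (T' x).
  by have h := dS x; rewrite /T; apply: is_derive_eq; rewrite /GRing.scale/= /g4 invrK.
have cT' : continuous T'.
  have cr2 := r2C.1.
  move=> x; apply: cvgM; first exact: cvg_cst.
  apply: cvgM.
    by apply: cvgM; [apply: cvgM; [exact: cvg_cst|exact: cr2]|exact: cvg_cst].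
  apply: cvgXn; apply: cvgD; [exact: cvg_cst|].
  by apply: cvgXn; exact: cS.
have pb := parts_bound ra r0 dr cr' ea e0 re dT cT' eta0.
have m2 : \int[mu]_x (r x ^+ 2 * S x ^+ 2) = F * s4 N.
  by apply: (mom H4 (fun t => t ^+ 2)); [exact: is_derive_H4|exact: exprn_continuous].
have r2S : Cc a (fun x => r x ^+ 2 * S x ^+ 2).
  by apply: (Cc_Ml r2C) => x; apply: cvgXn; exact: cS.
have e1 : \int[mu]_x (r x ^+ 2 * T x ^+ 2) = c ^+ 2 * (F * s4 N).
  rewrite -m2 -(RintZ_Cc _ r2S); apply: eq_Rintegral => x _.
  by rewrite /T exprMn; ring.
have rT' : Cc a (fun x => r x * Num.sqrt (r x) * T' x) by exact: Cc_Ml.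
have -> : theta * c ^+ 2 * F * (1 + s4 N) =
    \int[mu]_x (theta * c ^+ 2 * (r x ^+ 2 + r x ^+ 2 * S x ^+ 2)).
  by rewrite (RintZ_Cc _ (Cc_D r2C r2S)) (RintD_Cc r2C r2S) m2 -/F; ring.
apply: (@le_trans _ _ (\int[mu]_x ((lam / 2 + d / (4 * lam)) * (r x * Num.sqrt (r x)) +
   (4 * lam)^-1 * (r x * Num.sqrt (r x) * T' x)))).
  apply: le_Rint_Cc.
  - exact: Cc_Z (Cc_D r2C r2S).
  - exact: Cc_D (Cc_Z _ rsC) (Cc_Z _ rT').
  move=> x; set s := Num.sqrt (r x).
  have s0 : 0 <= s by exact: sqrtr_ge0.
  have s2 : s ^+ 2 = r x by rewrite sqr_sqrtr.
  pose z := theta * c ^+ 2 * (1 + S x ^+ 2) * s.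
  have z0 : 0 <= z.
    by rewrite /z !mulr_ge0// ?sqr_ge0// ltW// sq1_gt0.
  have z4 : z ^+ 4 = d * T' x.
    rewrite /T' (_ : d * _ = (d * c * k4 N) * (r x ^+ 2 / F * (1 + S x ^+ 2) ^+ 4)); last by ring.
    by rewrite hF -s2 /z; field; rewrite gt_eqF.
  have T'0 : 0 <= T' x.
    rewrite /T'; apply: mulr_ge0; first exact: ltW.
    apply: mulr_ge0; last by rewrite exprn_ge0// ltW// sq1_gt0.
    by rewrite divr_ge0 ?mulr_ge0 ?sqr_ge0// ltW.
  (* Arithmetic-geometric mean: the square root of the Jacobian is at most half the sum of its
     diagonal entries. The free parameter [lam] then makes the bound linear in [z]. *)
  have zz : z ^+ 2 <= (d + T' x) / 2.
    rewrite -(@ler_pXn2r _ 2)// ?nnegrE ?sqr_ge0// ?divr_ge0 ?addr_ge0//.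
    by rewrite -exprM z4; have := sqr_ge0 (d - T' x); lra.
  have zl : z <= lam / 2 + (d + T' x) / (4 * lam).
    have -> : (d + T' x) / (4 * lam) = (d + T' x) / 2 / (2 * lam).
      by field; rewrite gt_eqF.
    apply: (@le_trans _ _ (lam / 2 + z ^+ 2 / (2 * lam))); last first.
      by rewrite lerD2l ler_pM2r// invr_gt0 mulr_gt0.
    rewrite -subr_ge0 (_ : _ - _ = (lam - z) ^+ 2 / (2 * lam)).
      by rewrite divr_ge0 ?sqr_ge0// mulr_ge0// ltW.
    by field; rewrite gt_eqF.
  have := ler_wpM2r (exprn_ge0 3 s0) zl.
  rewrite /z -s2; move: (T' x) (S x) => u v.
  rewrite [X in X <= _ -> _](_ : _ = theta * c ^+ 2 * ((s ^+ 2) ^+ 2 + (s ^+ 2) ^+ 2 * v ^+ 2)); last by ring.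
  by move=> /le_trans; apply; rewrite le_eqVlt; apply/orP; left; apply/eqP; field; rewrite gt_eqF.
rewrite (RintD_Cc (Cc_Z _ rsC) (Cc_Z _ rT')) (RintZ_Cc _ rsC) (RintZ_Cc _ rT').
rewrite lerD2l.
have l40 : 0 <= (4 * lam)^-1 by rewrite invr_ge0 mulr_ge0// ltW.
apply: le_trans (ler_wpM2l l40 pb) _; rewrite e1.
rewrite le_eqVlt; apply/orP; left; apply/eqP; field.
by rewrite !gt_eqF.
Qed.


Definition Int2 (f : R * R -> R) : R := \int[mu]_x \int[mu]_y f (x, y).

Lemma Int2_ge0 f : (forall p, 0 <= f p) -> 0 <= Int2 f.
Proof. by move=> f0; apply: Rintegral_ge0 => x _; exact: Rintegral_ge0. Qed.

Lemma k4_gt0 N : 0 < N -> 0 < k4 N.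
Proof.
move=> N0; rewrite subr_gt0; apply: (is_derive_pos_lt is_derive_G4); last by lra.
by move=> t; rewrite invr_gt0 exprn_gt0// sq1_gt0.
Qed.

Lemma g7_gt0 t : 0 < g7 t.
Proof. by rewrite invr_gt0 exprn_gt0// jap_gt0. Qed.

Lemma k7_gt0 N : 0 < N -> 0 < k7 N.
Proof.
move=> N0; rewrite subr_gt0; apply: (is_derive_pos_lt is_derive_G7 g7_gt0); lra.
Qed.

(** The first coordinate is transported from the marginal [F] to the density [g7], and the slices
    are integrated over it. The horizontal derivative is left in the integral of [A * d]; exchanging
    the order of integration allows it to be integrated by parts in the first variable. *)
Lemma gn_core a (r rx ry e1 e2 : R * R -> R) (theta lam eta N : R) :
  Cc2 a r -> (forall p, 0 <= r p) ->
  (forall x y : R, is_derive x (1 : R) (fun t => r (t, y)) (rx (x, y))) ->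
  (forall x y : R, is_derive y (1 : R) (fun t => r (x, t)) (ry (x, y))) ->
  continuous rx -> continuous ry -> Cc2 a e1 -> Cc2 a e2 ->
  (forall p, 0 <= e1 p) -> (forall p, 0 <= e2 p) ->
  (forall p, rx p ^+ 2 <= 4 * r p * e1 p) ->
  (forall p, ry p ^+ 2 <= 4 * r p * e2 p) ->
  0 <= theta -> 0 < lam -> 0 < eta -> 0 < N ->
  let M := Int2 (fun p => r p ^+ 2) in
  0 < M ->
  theta ^+ 4 * M = k7 N * k4 N ->
  theta * M * (1 + t7 N) * (1 + s4 N) <=
  lam / 2 * Int2 (fun p => r p * Num.sqrt (r p)) +
  3 / (8 * lam) * (eta * (Int2 e1 + Int2 e2) +
     M * (t7 N + (1 + t7 N) * s4 N) / eta).
Proof.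
move=> ra r0 drx dry crx cry e1a e2a e10 e20 re1 re2 th0 lam0 eta0 N0 M M0 thE.
have [cr r00] := ra.
have csr : continuous (fun p => Num.sqrt (r p)).
  by move=> x; apply: continuous_comp; [exact: cr|exact: sqrt_continuous].
have r2C : Cc2 a (fun p => r p ^+ 2).
  by rewrite (_ : (fun _ => _) = fun p => r p * r p)//; exact: Cc2_Ml.
have rsC : Cc2 a (fun p => r p * Num.sqrt (r p)) by exact: Cc2_Ml.
pose F x := \int[mu]_y (r (x, y) ^+ 2).
have FC : Cc a F := Cc_int r2C.
have F0 x : 0 <= F x by apply: Rintegral_ge0 => y _; exact: sqr_ge0.
have [T [dT mom]] := transport1 FC F0 M0 is_derive_G7 continuous_g7 g7_gt0 N0.
rewrite -/M -/(k7 N) in dT mom.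
have cT := is_derive_continuous dT.
have k7p := k7_gt0 N0; have k4p := k4_gt0 N0.
pose d x := k7 N * F x / M / g7 (T x).
have d0 x : 0 <= d x.
  by apply: divr_ge0; [apply: divr_ge0; [apply: mulr_ge0 => //|]|]; apply: ltW => //; exact: g7_gt0.
have cd : continuous d.
  move=> x; apply: cvgM.
    by apply: cvgM; [apply: cvgM; [exact: cvg_cst|exact: FC.1]|exact: cvg_cst].
  apply: cvgV; first by rewrite gt_eqF// g7_gt0.
  by apply: (continuous_comp (g := g7)); [exact: cT|exact: continuous_g7].
pose A x := \int[mu]_y (r (x, y) * Num.sqrt (r (x, y))).
have AC : Cc a A := Cc_int rsC.
pose E2 x := \int[mu]_y e2 (x, y).
have E2C : Cc a E2 := Cc_int e2a.
have slice x : theta * (1 + T x ^+ 2) * F x * (1 + s4 N) <=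
    (lam / 2 + d x / (4 * lam)) * A x +
    3 / (8 * lam) * (eta * E2 x + F x * (1 + T x ^+ 2) * s4 N / eta).
  rewrite -jap2; apply: (gn_slice (r' := fun y => ry (x, y)) (Cc_row x ra) _ _ _ (Cc_row x e2a)) => //.
  - by move=> y; apply: (@continuous_comp _ _ _ (fun y => (x, y)) ry); [apply: cvg_pair_at; [exact: cvg_cst|exact: cvg_id]|exact: cry].
  - exact: jap_gt0.
  - rewrite -/(F x) /d /g7 invrK.
    transitivity (k7 N * k4 N / M * jap (T x) ^+ 8 * F x); first by ring.
    by rewrite -thE; field; rewrite gt_eqF.
have FT2C : Cc a (fun x => F x * T x ^+ 2).
  by apply: (Cc_Ml FC) => x; apply: cvgXn; exact: cT.
have mT : \int[mu]_x (F x * T x ^+ 2) = M * t7 N.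
  by apply: (mom H7 (fun t => t ^+ 2)); [exact: is_derive_H7|exact: exprn_continuous].
have AdC : Cc a (fun x => A x * d x) := Cc_Ml AC cd.
have cfst : continuous (fst : R * R -> R) by move=> p; exact: cvg_fst.
have key : \int[mu]_x (A x * d x) <= 3 / 2 * (eta * Int2 e1 + M * t7 N / eta).
  have rsd : Cc2 a (fun p => r p * Num.sqrt (r p) * d p.1).
    apply: (Cc2_Ml rsC) => p; apply: (continuous_comp (g := d)); [exact: cvg_fst|exact: cd].
  have r2T : Cc2 a (fun p => r p ^+ 2 * T p.1 ^+ 2).
    apply: (Cc2_Ml r2C) => p; apply: cvgXn.
    by apply: (continuous_comp (g := T)); [exact: cvg_fst|exact: cT].
  have -> : \int[mu]_x (A x * d x) = Int2 (fun p => r p * Num.sqrt (r p) * d p.1).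
    apply: eq_Rintegral => x _; rewrite [LHS]mulrC -(RintZ_Cc _ (Cc_row x rsC)).
    by apply: eq_Rintegral => y _ /=; rewrite mulrC.
  rewrite /Int2 (Cc_fubini rsd) -/(Int2 e1).
  have e1r : 3 / 2 * (eta * Int2 e1 + M * t7 N / eta) =
    \int[mu]_y (3 / 2 * (eta * (\int[mu]_x e1 (x, y)) +
       eta^-1 * (\int[mu]_x (r (x, y) ^+ 2 * T x ^+ 2)))).
    have e1C : Cc a (fun y => \int[mu]_x e1 (x, y)) := Cc_int (Cc_swap e1a).
    have r2TC : Cc a (fun y => \int[mu]_x (r (x, y) ^+ 2 * T x ^+ 2)) := Cc_int (Cc_swap r2T).
    rewrite (RintZ_Cc _ (Cc_D (Cc_Z _ e1C) (Cc_Z _ r2TC))) (RintD_Cc (Cc_Z _ e1C) (Cc_Z _ r2TC)).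
    rewrite (RintZ_Cc _ e1C) (RintZ_Cc _ r2TC) -(Cc_fubini e1a) -(Cc_fubini r2T) -mT.
    rewrite /Int2 [in LHS](mulrC _ eta^-1); do 4 congr (_ * _ + _ * _) || idtac.
    congr (_ * (_ + _ * _)); apply: eq_Rintegral => x _.
    rewrite [LHS]mulrC -(RintZ_Cc _ (Cc_row x r2C)).
    by apply: eq_Rintegral => y _ /=; rewrite mulrC.
  rewrite e1r; apply: le_Rint_Cc.
  - exact: Cc_int (Cc_swap rsd).
  - apply: Cc_Z; apply: Cc_D; apply: Cc_Z; [exact: Cc_int (Cc_swap e1a)|exact: Cc_int (Cc_swap r2T)].
  move=> y /=; rewrite [X in 3 / 2 * (_ + X)]mulrC.
  apply: (parts_bound (r' := fun x => rx (x, y)) (Cc_col y ra) _ _ _ (Cc_col y e1a)) => //.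
  by move=> x; apply: (@continuous_comp _ _ _ (fun x => (x, y)) rx); [apply: cvg_pair_at; [exact: cvg_id|exact: cvg_cst]|exact: crx].
have FTC : Cc a (fun x => F x + F x * T x ^+ 2) := Cc_D FC FT2C.
have := @le_Rint_Cc _ a
  (fun x => theta * (1 + s4 N) * (F x + F x * T x ^+ 2))
  (fun x => (lam / 2 * A x + (4 * lam)^-1 * (A x * d x)) +
    3 / (8 * lam) * (eta * E2 x + s4 N / eta * (F x + F x * T x ^+ 2)))
  (Cc_Z _ FTC)
  (Cc_D (Cc_D (Cc_Z _ AC) (Cc_Z _ AdC)) (Cc_Z _ (Cc_D (Cc_Z _ E2C) (Cc_Z _ FTC)))).
rewrite (RintD_Cc (Cc_D (Cc_Z _ AC) (Cc_Z _ AdC)) (Cc_Z _ (Cc_D (Cc_Z _ E2C) (Cc_Z _ FTC)))).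
rewrite (RintZ_Cc _ FTC) (RintD_Cc (Cc_Z _ AC) (Cc_Z _ AdC)) (RintZ_Cc _ AC) (RintZ_Cc _ AdC).
rewrite (RintZ_Cc _ (Cc_D (Cc_Z _ E2C) (Cc_Z _ FTC))) (RintD_Cc (Cc_Z _ E2C) (Cc_Z _ FTC)).
rewrite (RintZ_Cc _ E2C) (RintZ_Cc _ FTC) (RintD_Cc FC FT2C) mT.
rewrite -/M -/(Int2 e2) -/(Int2 (fun p => r p * Num.sqrt (r p))).
move=> H.
have {}H := H (fun x => _).
have l40 : 0 <= (4 * lam)^-1 by rewrite invr_ge0 mulr_ge0// ltW.
have key' := ler_wpM2l l40 key.
apply: (@le_trans _ _ (theta * (1 + s4 N) * (M + M * t7 N))).
  by rewrite le_eqVlt; apply/orP; left; apply/eqP; ring.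
apply: le_trans (H _) _.
  move=> x; have := slice x; rewrite !(mulrDr (F x)) => h.
  apply: (@le_trans _ _ (theta * (1 + T x ^+ 2) * F x * (1 + s4 N))).
    by rewrite le_eqVlt; apply/orP; left; apply/eqP; ring.
  apply: (le_trans h).
  rewrite le_eqVlt; apply/orP; left; apply/eqP; field.
  by rewrite !gt_eqF.
rewrite -/(Int2 e2).
have e3 : (4 * lam)^-1 * (3 / 2 * (eta * Int2 e1 + M * t7 N / eta)) =
   3 / (8 * lam) * (eta * Int2 e1 + M * t7 N / eta) by field; rewrite !gt_eqF.
move: key'; rewrite e3 => key'.
have -> : 3 / (8 * lam) * (eta * (Int2 e1 + Int2 e2) +
    M * (t7 N + (1 + t7 N) * s4 N) / eta) =
  3 / (8 * lam) * (eta * Int2 e1 + M * t7 N / eta) +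
  3 / (8 * lam) * (eta * Int2 e2 + s4 N / eta * (M + M * t7 N)).
  by field; rewrite !gt_eqF.
by rewrite addrA lerD2r lerD2l.
Qed.

End Transport.

(** * Optimising the parameters and removing the truncation of the target *)

Section GN.
Variable R : realType.
Notation mu := (@lebesgue_measure R).
Implicit Types (a x y t : R).

Lemma Int2Z a c f : Cc2 a f -> Int2 (fun p => c * f p) = c * Int2 f.
Proof.
move=> fa; rewrite /Int2 -(RintZ_Cc _ (Cc_int fa)); apply: eq_Rintegral => x _.
exact: RintZ_Cc (Cc_row x fa).
Qed.

Lemma Int2D a f g : Cc2 a f -> Cc2 a g -> Int2 (fun p => f p + g p) = Int2 f + Int2 g.
Proof.
move=> fa ga; rewrite /Int2 -(RintD_Cc (Cc_int fa) (Cc_int ga)).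
by apply: eq_Rintegral => x _; exact: RintD_Cc (Cc_row x fa) (Cc_row x ga).
Qed.

Lemma le_Int2 a f g : Cc2 a f -> Cc2 a g -> (forall p, f p <= g p) -> Int2 f <= Int2 g.
Proof.
move=> fa ga fg; apply: (le_Rint_Cc (Cc_int fa) (Cc_int ga)) => x.
exact: (le_Rint_Cc (Cc_row x fa) (Cc_row x ga)).
Qed.

(** Three scalar optimisations: [kap] turns the bound on the L^3 term [A] into Cauchy-Schwarz, [eta]
    balances the two terms created by the integration by parts, and [lam] balances the L^3 term
    against the gradient term. Taking fourth powers clears the roots. *)
Lemma gn_opt (M D E A p q : R) :
  0 < M -> 0 < D -> 0 < E -> 0 < p -> p < q ->
  (forall kap, 0 < kap -> A <= (kap * D + M / kap) / 2) ->
  (forall theta lam eta, 0 <= theta -> 0 < lam -> 0 < eta ->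
     theta ^+ 4 * M = p ->
     theta * M * (q / p) <= lam / 2 * A + 3 / (8 * lam) * (eta * E + M * ((q - p) / p) / eta)) ->
  q ^+ 4 * M <= 9 / 4 * (q - p) * p ^+ 2 * D * E.
Proof.
move=> M0 D0 E0 p0 pq hA H.
pose J := (q - p) / p.
have J0 : 0 < J by rewrite divr_gt0// subr_gt0.
pose kap := Num.sqrt (M / D).
have kap0 : 0 < kap by rewrite sqrtr_gt0 divr_gt0.
have kap2 : kap ^+ 2 = M / D by rewrite sqr_sqrtr// divr_ge0// ltW.
pose eta := Num.sqrt (M * J / E).
have eta0 : 0 < eta by rewrite sqrtr_gt0 divr_gt0// mulr_gt0.
have eta2 : eta ^+ 2 = M * J / E by rewrite sqr_sqrtr// ltW// divr_gt0// mulr_gt0.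
pose a' := kap * D.
have a'0 : 0 < a' by rewrite mulr_gt0.
have a'2 : a' ^+ 2 = M * D by rewrite exprMn kap2; field; rewrite gt_eqF.
have Aa : A <= a'.
  have := hA _ kap0; rewrite (_ : M / kap = kap * D); first by rewrite /a'; lra.
  have -> : M = kap ^+ 2 * D by rewrite kap2; field; rewrite gt_eqF.
  by field; rewrite gt_eqF.
pose w := 2 * (eta * E).
have w0 : 0 < w by rewrite !mulr_gt0.
have w2 : w ^+ 2 = 4 * M * J * E.
  by rewrite /w !exprMn eta2; field; rewrite gt_eqF.
have wE : eta * E + M * J / eta = w.
  have -> : M * J = eta ^+ 2 * E by rewrite eta2; field; rewrite gt_eqF.
  by rewrite /w; field; rewrite gt_eqF.
pose lam := Num.sqrt (3 * w / (4 * a')).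
have lam0 : 0 < lam by rewrite sqrtr_gt0 divr_gt0// mulr_gt0.
have lam2 : lam ^+ 2 = 3 * w / (4 * a') by rewrite sqr_sqrtr// ltW// divr_gt0// mulr_gt0.
pose theta := Num.sqrt (Num.sqrt (p / M)).
have th4 : theta ^+ 4 * M = p.
  have -> : theta ^+ 4 = (theta ^+ 2) ^+ 2 by ring.
  rewrite sqr_sqrtr ?sqrtr_ge0// sqr_sqrtr ?divr_ge0 ?ltW//.
  by field; rewrite gt_eqF.
have := H theta lam eta (sqrtr_ge0 _) lam0 eta0 th4.
rewrite -/J wE => {}H.
set X := theta * M * (q / p) in H.
have X0 : 0 <= X by rewrite !mulr_ge0 ?sqrtr_ge0 ?invr_ge0 ?ltW// (lt_trans p0).
have Xl : X <= lam * a'.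
  apply: (le_trans H).
  have -> : 3 / (8 * lam) * w = lam / 2 * a'.
    have -> : w = 4 / 3 * lam ^+ 2 * a' by rewrite lam2; field; rewrite gt_eqF.
    by field; rewrite gt_eqF.
  have h : lam / 2 * A <= lam / 2 * a' by rewrite ler_pM2l// divr_gt0.
  by apply: le_trans (lerD h (lexx _)) _; rewrite -mulrDl -splitr.
have X4 : X ^+ 4 <= 9 / 4 * M ^+ 2 * J * E * D.
  apply: (@le_trans _ _ ((lam * a') ^+ 4)).
    by rewrite ler_pXn2r// nnegrE ltW// mulr_gt0.
  rewrite le_eqVlt; apply/orP; left; apply/eqP.
  transitivity ((lam ^+ 2) ^+ 2 * (a' ^+ 2) ^+ 2); first by ring.
  rewrite lam2; transitivity (9 / 16 * w ^+ 2 * a' ^+ 2); first by field; rewrite gt_eqF.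
  by rewrite w2 a'2; field.
have XE : X ^+ 4 = q ^+ 4 * M * (M ^+ 2 / p ^+ 3).
  rewrite /X; transitivity (theta ^+ 4 * M * M ^+ 3 * (q / p) ^+ 4); first by ring.
  by rewrite th4; field; rewrite gt_eqF.
have c0 : 0 < M ^+ 2 / p ^+ 3 by rewrite divr_gt0 ?exprn_gt0.
rewrite -(ler_pM2r c0) -XE; apply: (le_trans X4).
rewrite le_eqVlt; apply/orP; left; apply/eqP; rewrite /J; field.
by rewrite gt_eqF.
Qed.

(** Masses and unnormalised second moments at [N = tan t]. The substitution makes [atan] and [jap]
    elementary in [t], and the limit of large [N] becomes the value at [pi / 2] of a continuous
    function. *)
Let c4 t : R := 2 * (5 / 16 * t + (15 * sin t ^+ 5 * cos t + 40 * sin t ^+ 3 * cos t ^+ 3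
   + 33 * sin t * cos t ^+ 5) / 48).
Let h4 t : R := 2 * (1 / 16 * t + (3 * sin t ^+ 5 * cos t + 8 * sin t ^+ 3 * cos t ^+ 3
   - 3 * sin t * cos t ^+ 5) / 48).
Let c7 t : R := 2 * (sin t - 2 / 3 * sin t ^+ 3 + 1 / 5 * sin t ^+ 5).
Let h7 t : R := 2 * (1 / 3 * sin t ^+ 3 - 1 / 5 * sin t ^+ 5).

Lemma jap_tan t : 0 < t < pi / 2 -> jap (tan t) = (cos t)^-1.
Proof.
move=> /andP[t0 t2].
have ct : 0 < cos t by apply: cos_gt0_pihalf; lra.
rewrite /jap (_ : 1 + tan t ^+ 2 = (cos t)^-1 ^+ 2).
  by rewrite sqrtr_sqr ger0_norm// invr_ge0 ltW.
rewrite /tan; have := cos2Dsin2 t => h.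
transitivity ((cos t ^+ 2 + sin t ^+ 2) / cos t ^+ 2); first by field; rewrite gt_eqF.
by rewrite h; field; rewrite gt_eqF.
Qed.

Lemma k4_tan t : 0 < t < pi / 2 -> k4 (tan t) = c4 t.
Proof.
move=> tp; have /andP[t0 t2] := tp.
have ct : 0 < cos t by apply: cos_gt0_pihalf; lra.
rewrite /k4 /G4 atanN tanK; last by rewrite in_itv/=; apply/andP; split; lra.
rewrite sqrrN -(jap2 (tan t)) jap_tan// /tan /c4.
by field; rewrite gt_eqF.
Qed.

Lemma s4_tan t : 0 < t < pi / 2 -> s4 (tan t) = h4 t / c4 t.
Proof.
move=> tp; have /andP[t0 t2] := tp.
have ct : 0 < cos t by apply: cos_gt0_pihalf; lra.
rewrite /s4 k4_tan//; congr (_ / _).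
rewrite /H4 atanN tanK; last by rewrite in_itv/=; apply/andP; split; lra.
rewrite sqrrN -(jap2 (tan t)) jap_tan// /tan /h4.
by field; rewrite gt_eqF.
Qed.

Lemma japN t : jap (- t) = jap t.
Proof. by rewrite /jap sqrrN. Qed.

Lemma k7_tan t : 0 < t < pi / 2 -> k7 (tan t) = c7 t.
Proof.
move=> tp; have /andP[t0 t2] := tp.
have ct : 0 < cos t by apply: cos_gt0_pihalf; lra.
rewrite /k7 /G7 japN jap_tan// /tan /c7.
by field; rewrite gt_eqF.
Qed.

Lemma t7_tan t : 0 < t < pi / 2 -> t7 (tan t) = h7 t / c7 t.
Proof.
move=> tp; have /andP[t0 t2] := tp.
have ct : 0 < cos t by apply: cos_gt0_pihalf; lra.
rewrite /t7 k7_tan//; congr (_ / _).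
rewrite /H7 japN jap_tan// /tan /h7.
by field; rewrite gt_eqF.
Qed.

(** At [t = pi / 2] one has [p = pi / 3] and [q = pi / 2], hence 9/4 (q - p) p^2 / q^4 = 2/(3
    pi). *)
Lemma gn_const (M D E : R) :
  (forall t, 0 < t < pi / 2 -> let p := c7 t * c4 t in
     let q := (c7 t + h7 t) * (c4 t + h4 t) in
     p < q -> q ^+ 4 * M <= 9 / 4 * (q - p) * p ^+ 2 * D * E) ->
  M <= 2 / (3 * pi) * D * E.
Proof.
move=> H.
have ctsin : continuous (@sin R) by exact: continuous_sin.
have ctcos : continuous (@cos R) by exact: continuous_cos.
pose P t := c7 t * c4 t; pose Q t := (c7 t + h7 t) * (c4 t + h4 t).
have cc4 : continuous c4.
  by move=> t; rewrite /c4; apply/differentiable_continuous/derivable1_diffP; apply: ex_derive.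
have ch4 : continuous h4.
  by move=> t; rewrite /h4; apply/differentiable_continuous/derivable1_diffP; apply: ex_derive.
have cc7 : continuous c7.
  by move=> t; rewrite /c7; apply/differentiable_continuous/derivable1_diffP; apply: ex_derive.
have ch7 : continuous h7.
  by move=> t; rewrite /h7; apply/differentiable_continuous/derivable1_diffP; apply: ex_derive.
have cP : continuous P by move=> t; apply: cvgM; [exact: cc7|exact: cc4].
have cQ : continuous Q.
  by move=> t; apply: cvgM; apply: cvgD; [exact: cc7|exact: ch7|exact: cc4|exact: ch4].
have P2 : P (pi / 2) = pi / 3.
  by rewrite /P /c7 /c4 sin_pihalf cos_pihalf; field.
have Q2 : Q (pi / 2) = pi / 2.
  by rewrite /Q /c7 /c4 /h7 /h4 sin_pihalf cos_pihalf; field.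
have pi0 := pi_gt0 R.
pose f t := Q t ^+ 4 * M - 9 / 4 * (Q t - P t) * P t ^+ 2 * D * E.
have cf : continuous f.
  move=> t; apply: cvgB.
    by apply: cvgM; [apply: cvgXn; exact: cQ|exact: cvg_cst].
  apply: cvgM; last exact: cvg_cst.
  apply: cvgM; last exact: cvg_cst.
  apply: cvgM; last by apply: cvgXn; exact: cP.
  apply: cvgM; first exact: cvg_cst.
  by apply: cvgB; [exact: cQ|exact: cP].
have f2 : f (pi / 2) <= 0.
  have fl : f x @[x --> (pi / 2)^'-] --> f (pi / 2) by apply: cvg_at_left_filter; exact: cf.
  apply: (cvgr_to_le fl).
  have hPQ : \forall t \near (pi / 2)^'-, P t < Q t.
    have QP : Q x - P x @[x --> (pi / 2)^'-] --> Q (pi / 2) - P (pi / 2).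
      by apply: cvg_at_left_filter; apply: cvgB; [exact: cQ|exact: cP].
    have PQ0 : 0 < Q (pi / 2) - P (pi / 2) by rewrite P2 Q2; lra.
    have PQ : \forall t \near (pi / 2)^'-, 0 < Q t - P t by exact: (cvgr_gt _ QP _ PQ0).
    by near=> t; rewrite -subr_gt0; near: t.
  near=> t; rewrite /f subr_le0; apply: H.
    by apply/andP; split; near: t; [apply: nbhs_left_gt; lra|exact: nbhs_left_lt].
  by near: t.
move: f2; rewrite /f P2 Q2 subr_le0 => f2.
have c0 : 0 < (pi / 2) ^+ 4 :> R by rewrite exprn_gt0// divr_gt0.
rewrite -(ler_pM2l c0); apply: (le_trans f2).
rewrite le_eqVlt; apply/orP; left; apply/eqP.
by move: pi0; move: (@pi R) => x x0; field; rewrite gt_eqF.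
Unshelve. all: by end_near. Qed.

Lemma gagliardo_nirenberg a (r rx ry e1 e2 : R * R -> R) :
  Cc2 a r -> (forall p, 0 <= r p) ->
  (forall x y : R, is_derive x (1 : R) (fun t => r (t, y)) (rx (x, y))) ->
  (forall x y : R, is_derive y (1 : R) (fun t => r (x, t)) (ry (x, y))) ->
  continuous rx -> continuous ry -> Cc2 a e1 -> Cc2 a e2 ->
  (forall p, 0 <= e1 p) -> (forall p, 0 <= e2 p) ->
  (forall p, rx p ^+ 2 <= 4 * r p * e1 p) ->
  (forall p, ry p ^+ 2 <= 4 * r p * e2 p) ->
  Int2 (fun p => r p ^+ 2) <= 2 / (3 * pi) * Int2 r * (Int2 e1 + Int2 e2).
Proof.
move=> ra r0 drx dry crx cry e1a e2a e10 e20 re1 re2.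
set M := Int2 _; set D := Int2 r; set E := _ + _.
have [cr r00] := ra.
have csr : continuous (fun p => Num.sqrt (r p)).
  by move=> x; apply: continuous_comp; [exact: cr|exact: sqrt_continuous].
have r2C : Cc2 a (fun p => r p ^+ 2).
  by rewrite (_ : (fun _ => _) = fun p => r p * r p)//; exact: Cc2_Ml.
have rsC : Cc2 a (fun p => r p * Num.sqrt (r p)) by exact: Cc2_Ml.
have M0 : 0 <= M by apply: Int2_ge0 => p; exact: sqr_ge0.
have D0 : 0 <= D by exact: Int2_ge0.
have E0 : 0 <= E by apply: addr_ge0; exact: Int2_ge0.
have pi0 := pi_gt0 R.
move: M0; rewrite le_eqVlt => /predU1P[<-|M0].
  by rewrite !mulr_ge0// invr_ge0 mulr_ge0// ltW.
(* Since [r] is bounded by [B], the fourth-power integral is at most [B * D], which contradicts [M0]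
   if [D] is zero. *)
have D1 : 0 < D.
  rewrite lt_neqAle D0 andbT; apply/eqP => D00.
  have [B B0 rB] := Cc2_bound ra.
  suff : M <= B * D by rewrite -D00 mulr0 leNgt M0.
  rewrite /M /D -(Int2Z _ ra); apply: (le_Int2 r2C (Cc2_Z _ ra)) => p.
  by rewrite expr2 ler_wpM2r// (le_trans (ler_norm _)).
(* The optimal [eta] divides by the energy, whose positivity is not known here; it is replaced by
   any larger number, which is let go to [E] afterwards. *)
suff H E' : E < E' -> M <= 2 / (3 * pi) * D * E'.
  have c0 : 0 < 2 / (3 * pi) * D by rewrite mulr_gt0// divr_gt0// mulr_gt0.
  rewrite -ler_pdivrMl//; apply/ler_addgt0Pr => e e1p.
  by rewrite ler_pdivrMl//; apply: H; rewrite ltrDl.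
move=> EE'; have E'0 : 0 < E' by exact: le_lt_trans EE'.
apply: gn_const => t tp p q pq.
have /andP[t0 t2] := tp.
have N0 : 0 < tan t.
  by rewrite /tan divr_gt0//; [apply: sin_gt0_pihalf|apply: cos_gt0_pihalf; lra].
have k4p := k4_gt0 N0; have k7p := k7_gt0 N0.
have c40 := k4p; rewrite k4_tan// in c40; have c70 := k7p; rewrite k7_tan// in c70.
apply: (@gn_opt M D E' (Int2 (fun p => r p * Num.sqrt (r p)))) => //.
- by rewrite mulr_gt0.
- move=> kap kap0.
  have -> : (kap * D + M / kap) / 2 = Int2 (fun p => 2^-1 * (kap * r p + kap^-1 * r p ^+ 2)).
    rewrite (Int2Z _ (Cc2_D (Cc2_Z _ ra) (Cc2_Z _ r2C))) (Int2D (Cc2_Z _ ra) (Cc2_Z _ r2C)).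
    by rewrite (Int2Z _ ra) (Int2Z _ r2C) -/M -/D; ring.
  apply: (le_Int2 rsC (Cc2_Z _ (Cc2_D (Cc2_Z _ ra) (Cc2_Z _ r2C)))).
  move=> z; set s := Num.sqrt (r z).
  have s2 : r z = s ^+ 2 by rewrite sqr_sqrtr.
  rewrite s2 -subr_ge0.
  have -> : 2^-1 * (kap * s ^+ 2 + kap^-1 * (s ^+ 2) ^+ 2) - s ^+ 2 * s =
     s ^+ 2 / (2 * kap) * (kap - s) ^+ 2 by field; rewrite gt_eqF.
  by rewrite mulr_ge0 ?sqr_ge0// divr_ge0 ?sqr_ge0// mulr_ge0// ltW.
move=> theta lam eta th0 lam0 eta0 thE.
have := gn_core ra r0 drx dry crx cry e1a e2a e10 e20 re1 re2 th0 lam0 eta0 N0 M0.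
rewrite -/M k7_tan// k4_tan// s4_tan// t7_tan// => /(_ thE).
rewrite -/E => h.
have qpE : q / p = (1 + h7 t / c7 t) * (1 + h4 t / c4 t).
  by rewrite /q /p; field; rewrite !gt_eqF.
have qpE' : (q - p) / p = h7 t / c7 t + (1 + h7 t / c7 t) * (h4 t / c4 t).
  by rewrite /q /p; field; rewrite !gt_eqF.
have -> : theta * M * (q / p) = theta * M * (1 + h7 t / c7 t) * (1 + h4 t / c4 t).
  by rewrite qpE mulrA.
rewrite qpE'; apply: (le_trans h).
rewrite lerD2l; apply: ler_wpM2l; first by rewrite divr_ge0// mulr_ge0// ltW.
by rewrite lerD2r ler_wpM2l// ltW.
Qed.

End GN.

(** * The Poincare inequality on the annulus *)

Section Bessel.
Variable R : realType.
Implicit Types (c : R^nat) (x t : R).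

(** Domination by an exponential series gives an infinite radius of convergence and is inherited by
    [pseries_diffs], so that termwise differentiation is valid everywhere and can be repeated. *)
Definition expbd c := exists B r : R, [/\ 0 <= B, 0 <= r &
  forall k, `|c k| <= B * (r ^+ k / k`!%:R)].

Lemma expbd_cvg c x : expbd c -> cvgn (pseries c x).
Proof.
move=> [B [r [B0 r0 cB]]]; apply: normed_cvg.
apply: (@series_le_cvg _ _ (fun k => B * ((r * `|x|) ^+ k / k`!%:R))).
- by move=> n; exact: normr_ge0.
- by move=> n; rewrite mulr_ge0// divr_ge0// exprn_ge0// mulr_ge0.
- move=> n /=; rewrite normrM normrX exprMn mulrAC mulrA.
  by rewrite ler_wpM2r// exprn_ge0.
rewrite (_ : (fun k => _) = B *: exp_coeff (r * `|x|))//.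
by apply: is_cvg_seriesZ; exact: is_cvg_series_exp_coeff.
Qed.

Lemma expbd_diffs c : expbd c -> expbd (pseries_diffs c).
Proof.
move=> [B [r [B0 r0 cB]]]; exists (B * r), r; split=> //; first exact: mulr_ge0.
move=> k; rewrite /pseries_diffs normrM ger0_norm//.
have k0 : 0 < k.+1%:R :> R by [].
apply: le_trans (ler_wpM2l (ltW k0) (cB k.+1)) _.
rewrite factS natrM exprS le_eqVlt; apply/orP; left; apply/eqP; field.
by rewrite pnatr_eq0 -lt0n fact_gt0 /=; rewrite addrC natr1 gt_eqF.
Qed.

Lemma expbd_derive c x : expbd c ->
  is_derive x (1 : R) (fun x => limn (pseries c x)) (limn (pseries (pseries_diffs c) x)).
Proof.
move=> cb; apply: (@pseries_snd_diffs _ _ (`|x| + 1)); try apply: expbd_cvg.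
- exact: cb.
- exact: expbd_diffs.
- by apply: expbd_diffs; exact: expbd_diffs.
- by rewrite [ltRHS]ger0_norm ?addr_ge0// ltrDl.
Qed.

(* [besselJ0 x] is [FJ (x ^+ 2)], and [PJ t] is [t * FJ' t]. *)
Definition cJ (k : nat) : R := (- 4^-1) ^+ k / (k`!%:R) ^+ 2.
Definition FJ t : R := limn (pseries cJ t).
Definition PJ t : R := limn (pseries (fun k => k%:R * cJ k) t).

Lemma cJ_bd k : `|cJ k| <= (4^-1) ^+ k / k`!%:R / k`!%:R.
Proof.
rewrite /cJ normrM normrX normrN [`|4^-1|]ger0_norm ?invr_ge0// [X in _ * X]ger0_norm; last first.
  by rewrite invr_ge0 sqr_ge0.
by rewrite expr2 invfM mulrA.
Qed.

Lemma expbd_cJ : expbd cJ.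
Proof.
exists 1, (4^-1); split=> // k; rewrite mul1r; apply: le_trans (cJ_bd k) _.
by rewrite ler_pdivrMr ?ltr0n ?fact_gt0// ler_peMr// ?ler1n ?fact_gt0// divr_ge0// exprn_ge0.
Qed.

Lemma expbd_kcJ : expbd (fun k => k%:R * cJ k).
Proof.
exists 1, (4^-1); split=> // k; rewrite mul1r normrM ger0_norm//.
apply: (@le_trans _ _ (k`!%:R * `|cJ k|)).
  by rewrite ler_wpM2r// ler_nat fact_geq.
apply: le_trans (ler_wpM2l (ler0n _ _) (cJ_bd k)) _.
by rewrite mulrC divfK// pnatr_eq0 -lt0n fact_gt0.
Qed.

Lemma is_derive_FJ t : is_derive t (1 : R) FJ (limn (pseries (pseries_diffs cJ) t)).
Proof. exact: expbd_derive expbd_cJ. Qed.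

Lemma PJE t : PJ t = t * limn (pseries (pseries_diffs cJ) t).
Proof.
have c1 := expbd_cvg (x := t) (expbd_diffs expbd_cJ).
have c2 := expbd_cvg (x := t) expbd_kcJ.
rewrite /PJ; apply/cvg_lim => //.
rewrite -(cvg_shiftS (pseries _ t)).
rewrite (_ : (fun n => _) = (fun n => t * pseries (pseries_diffs cJ) t n)).
  by apply: cvgM; [exact: cvg_cst|exact: c1].
apply/funext => n; rewrite /pseries /series /= big_nat_recl//= mul0r mul0r add0r mulr_sumr.
by apply: eq_bigr => i _; rewrite /pseries_diffs exprS; ring.
Qed.

(** Bessel's equation in the variable t = x^2, namely (t F')' = - F / 4; on coefficients it is the
    recursion (k + 1)^2 c_(k+1) = - c_k / 4. *)
Lemma is_derive_PJ t : is_derive t (1 : R) PJ (- 4^-1 * FJ t).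
Proof.
have h := expbd_derive t expbd_kcJ; apply: is_deriveE h _.
have c1 := expbd_cvg (x := t) expbd_cJ.
apply/cvg_lim => //.
rewrite (_ : pseries _ t = (fun n => - 4^-1 * pseries cJ t n)).
  by apply: cvgM; [exact: cvg_cst|exact: c1].
apply/funext => n; rewrite /pseries /series /= mulr_sumr.
apply: eq_bigr => i _; rewrite /pseries_diffs /cJ factS natrM exprS; field.
by rewrite pnatr_eq0 -lt0n fact_gt0 /=; rewrite addrC natr1 gt_eqF.
Qed.

Lemma besselJ0E x : besselJ0 x = FJ (x ^+ 2).
Proof.
rewrite /besselJ0 /FJ /pseries; congr (limn (series _)); apply/funext => k /=.
have -> : cJ k = (-1) ^+ k / (2 ^+ 2) ^+ k / k`!%:R ^+ 2.
  rewrite /cJ -[in RHS]exprVn -[in RHS]exprMn; congr (_ ^+ _ / _).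
  by field.
by rewrite exprM expr_div_n expr_div_n; ring.
Qed.

Lemma FJ0 : FJ 0 = 1.
Proof.
rewrite /FJ; apply/cvg_lim => //; apply/cvgrPdist_lt => e e0; near=> n.
have n0 : (0 < n)%N by near: n; exists 1%N.
rewrite -(prednK n0) /pseries /series /= big_nat_recl//= big1 => [|i _].
  by rewrite /cJ !expr0 fact0 expr1n divr1 mulr1 addr0 subrr normr0.
by rewrite exprS mul0r mulr0.
Unshelve. all: by end_near. Qed.

(** [FJ] starts at 1, so a nonpositive value would force a zero in between, whose square root is a
    zero of [besselJ0] below [mu0]. *)
Lemma FJ_gt0 mu0 : 0 < mu0 -> (forall x : R, 0 < x < mu0 -> besselJ0 x != 0) ->
  forall t, 0 <= t < mu0 ^+ 2 -> 0 < FJ t.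
Proof.
move=> m0 nz t /andP[t0 tm]; rewrite ltNge; apply/negP => F0.
have cF : {within `[0, t], continuous FJ}.
  by apply: continuous_subspaceT; exact: is_derive_continuous is_derive_FJ.
have [|s] := @IVT _ FJ 0 t 0 t0 cF.
  by rewrite FJ0 ge_min le_max F0 ler01 orbT.
rewrite in_itv /= => /andP[s0 st] Fs.
have s1 : 0 < s.
  by rewrite lt_neqAle s0 andbT; apply/eqP => s00; move: Fs; rewrite -s00 FJ0 => /eqP; rewrite oner_eq0.
have /nz/eqP[] : 0 < Num.sqrt s < mu0.
  rewrite sqrtr_gt0 s1/= -(@ltr_pXn2r _ 2)// ?nnegrE ?sqrtr_ge0 ?(ltW m0)//.
  by rewrite sqr_sqrtr// (le_lt_trans st).
by rewrite besselJ0E sqr_sqrtr.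
Qed.

End Bessel.


(** * Functions compactly supported in the annulus *)

Section Poincare.
Variable R : realType.
Notation mu := (@lebesgue_measure R).
Implicit Types (x y t Rad : R).

Lemma is_derive_near0 (f : R -> R) x : (\forall t \near x, f t = 0) ->
  is_derive x (1 : R) f 0.
Proof.
move=> f0; have h : is_derive x (1 : R) (cst 0 : R -> R) 0 by exact: is_derive_cst.
by apply: near_eq_is_derive h; near=> t; apply/esym; exact: (near f0 t).
Unshelve. all: by end_near. Qed.

(** The weights used later are controlled only inside the annulus; multiplied by a function
    supported in [K] they extend by zero. Since [K] is closed, the product is locally zero around
    each point outside it. *)
Lemma continuous_glue (K D : set (R * R)) (f : R * R -> R) :
  closed K -> K `<=` D -> (forall p, ~ K p -> f p = 0) ->
  (forall p, D p -> {for p, continuous f}) -> continuous f.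
Proof.
move=> cK KD f0 fD p; have [Kp|nKp] := pselect (K p); first exact: fD (KD _ Kp).
have oK : open (~` K) by exact: closed_openC.
have nK : \forall z \near p, (~` K) z by exact: open_nbhs_nbhs.
rewrite /continuous_at f0//; apply: cvg_near_cst.
by near=> z; apply: f0; exact: (near nK z).
Unshelve. all: by end_near. Qed.

Lemma near_row (A : set (R * R)) x y : (\forall p \near (x, y), A p) ->
  \forall t \near x, A (t, y).
Proof.
move=> h; have := @cvg_pair_at _ _ (nbhs x) _ id (cst y) x y (@cvg_id _ _) (cvg_cst _).
exact.
Qed.

Lemma near_col (A : set (R * R)) x y : (\forall p \near (x, y), A p) ->
  \forall t \near y, A (x, t).
Proof.
move=> h; have := @cvg_pair_at _ _ (nbhs y) _ (cst x) id x y (cvg_cst _) (@cvg_id _ _).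
exact.
Qed.

Definition qf (p : R * R) : R := p.1 ^+ 2 + p.2 ^+ 2.

Lemma annulusE Rad : 1 < Rad -> annulus Rad = [set p | 1 < qf p < Rad ^+ 2].
Proof.
move=> R1; apply/seteqP; split=> p; rewrite /annulus /= -/(qf p) => /andP[h1 h2].
  have q0 : 0 <= qf p by rewrite addr_ge0// sqr_ge0.
  have s0 := sqrtr_ge0 (qf p).
  rewrite -(sqr_sqrtr q0); apply/andP; split; last by rewrite ltr_pXn2r// nnegrE// ltW// (lt_trans _ R1).
  by rewrite -(expr1n R 2) ltr_pXn2r// nnegrE.
have q0 : 0 <= qf p by rewrite addr_ge0// sqr_ge0.
apply/andP; split; rewrite -(@ltr_pXn2r _ 2)// ?nnegrE ?sqrtr_ge0 ?sqr_sqrtr ?expr1n//.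
by rewrite ltW// (lt_trans _ R1).
Qed.

Lemma continuous_qf : continuous qf.
Proof.
by move=> p; apply: cvgD; apply: cvgXn; [exact: cvg_fst|exact: cvg_snd].
Qed.

Lemma open_annulus Rad : 1 < Rad -> open (annulus Rad).
Proof.
move=> R1; rewrite annulusE//.
have -> : [set p | 1 < qf p < Rad ^+ 2] = qf @^-1` `]1, Rad ^+ 2[%classic.
  by apply/seteqP; split => p /=; rewrite in_itv.
by apply: open_comp => [p _|]; [exact: continuous_qf|exact: interval_open].
Qed.

Lemma annulus_box Rad p : annulus Rad p -> `|p.1| <= Rad /\ `|p.2| <= Rad.
Proof.
move=> /andP[_ h]; have := h; move=> /ltW hR.
by split; apply: le_trans hR; rewrite -sqrtr_sqr ler_wsqrtr// ?lerDl ?lerDr sqr_ge0.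
Qed.

Lemma compact_closed2 (K : set (R * R)) : compact K -> closed K.
Proof. by apply: compact_closed; exact: norm_hausdorff. Qed.

(** The first-order information carried by a test function, with a single closed set inside the
    domain supporting the function and both of its partial derivatives. *)
Record tf_data (D : set (R * R)) (u ux uy : R * R -> R) : Prop := TfData {
  tf_c : continuous u;
  tf_cx : continuous ux;
  tf_cy : continuous uy;
  tf_dx : forall x y : R, is_derive x (1 : R) (fun t => u (t, y)) (ux (x, y));
  tf_dy : forall x y : R, is_derive y (1 : R) (fun t => u (x, t)) (uy (x, y));
  tf_K : exists K, [/\ closed K, K `<=` D, (forall p, ~ K p -> u p = 0),
     (forall p, ~ K p -> ux p = 0) & (forall p, ~ K p -> uy p = 0)] }.

Lemma is_derive_uniq (f : R -> R) x a b : is_derive x (1 : R) f a ->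
  is_derive x (1 : R) f b -> a = b.
Proof.
move=> h1 h2; transitivity ('D_1 f x); last by rewrite (@derive_val _ _ _ _ _ _ _ h2).
by rewrite (@derive_val _ _ _ _ _ _ _ h1).
Qed.

Lemma test_fun_data D u : test_fun D u -> tf_data D u (pd false u) (pd true u).
Proof.
move=> [sm [K [cK KD u0]]].
have [c0 d0] := sm [::].
have dx x y : is_derive x (1 : R) (fun t => u (t, y)) (pd false u (x, y)).
  have [h _] := d0 (x, y); rewrite /pd derive1E; exact/derivableP.
have dy x y : is_derive y (1 : R) (fun t => u (x, t)) (pd true u (x, y)).
  have [_ h] := d0 (x, y); rewrite /pd derive1E; exact/derivableP.
have clK := compact_closed2 cK.
have oK : open (~` K) by exact: closed_openC.
split=> //.
- exact: (sm [:: false]).1.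
- exact: (sm [:: true]).1.
exists K; split=> // -[x y] nK;
  have nz : \forall z \near (x, y), (~` K) z by exact: open_nbhs_nbhs.
- apply: (is_derive_uniq (dx x y)); apply: is_derive_near0.
  by have := near_row nz; apply: filterS => t; exact: u0.
- apply: (is_derive_uniq (dy x y)); apply: is_derive_near0.
  by have := near_col nz; apply: filterS => t; exact: u0.
Qed.

Lemma Cc2_annulus Rad (f : R * R -> R) (K : set (R * R)) : K `<=` annulus Rad ->
  (forall p, ~ K p -> f p = 0) -> continuous f -> Cc2 Rad f.
Proof.
move=> KD f0 cf; split=> // p hp; apply: f0 => /KD/annulus_box[].
by case: hp => h a b; [move: a|move: b]; rewrite leNgt h.
Qed.

(** * A radial vector field built from the Bessel function *)

Section weight.
Variables (mu0 Rad : R).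
Hypotheses (R1 : 1 < Rad) (m0 : 0 < mu0)
  (nz : forall x : R, 0 < x < mu0 -> besselJ0 x != 0).

Let k2 : R := mu0 ^+ 2 / (Rad ^+ 2 - 1).
Let tau (q : R) : R := k2 * (q - 1).
(** For h = [FJ (tau q)], which is J_0 (mu0 s / sqrt (Rad^2 - 1)) with s^2 = q - 1, this is s times
    the logarithmic derivative of h in s. Bessel's equation becomes the Riccati equation that
    defines [W'], and [psi] is the profile of the field W (|x|^2) x / |x|^2. *)
Let W (q : R) : R := 2 * PJ (tau q) / FJ (tau q).
Let W' (q : R) : R := - (k2 / 2) - W q ^+ 2 / (2 * (q - 1)).
Let psi (q : R) : R := W q / q.
Let psi' (q : R) : R := W' q / q - W q / q ^+ 2.

Let R21 : 0 < Rad ^+ 2 - 1.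
Proof. by rewrite subr_gt0 -(expr1n R 2) ltr_pXn2r// nnegrE// ltW// (lt_trans _ R1). Qed.

Let k20 : 0 < k2.
Proof. by rewrite divr_gt0// exprn_gt0. Qed.

(** Equality of the areas enters here: [tau] maps the interval from 1 to Rad^2 onto the interval
    from 0 to mu0^2, on which [FJ] is positive. *)
Let FJtau q : 1 < q < Rad ^+ 2 -> 0 < FJ (tau q).
Proof.
move=> /andP[q1 qR]; apply: (FJ_gt0 m0 nz); apply/andP; split.
  by rewrite mulr_ge0 ?ltW// subr_gt0.
rewrite /tau /k2 mulrAC ltr_pdivrMr// ltr_pM2l ?exprn_gt0//; lra.
Qed.

Let is_derive_W q : 1 < q < Rad ^+ 2 -> is_derive q (1 : R) W (W' q).
Proof.
move=> hq; have F0 := FJtau hq; have /andP[q1 qR] := hq.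
have F0' : FJ (tau q) != 0 by rewrite gt_eqF.
have dt : is_derive q (1 : R) tau k2 by dsolve.
have dF := is_derive1_comp (is_derive_FJ (tau q)) dt.
have dP := is_derive1_comp (is_derive_PJ (tau q)) dt.
have dV := is_deriveV (f := @FJ R \o tau) F0' dF.
have -> : W = (fun q => 2 * (@PJ R \o tau) q * ((@FJ R \o tau) q)^-1) by [].
apply: is_derive_eq; rewrite /GRing.scale /= /W' /W.
rewrite [PJ (tau q)]PJE; move: (limn _) => d.
have q10 : q - 1 != 0 by rewrite gt_eqF// subr_gt0.
rewrite [X in _ = _ - X](_ : _ = 2 * k2 * tau q * d ^+ 2 / FJ (tau q) ^+ 2); last first.
  move: (FJ (tau q)) F0' => f f0; rewrite /tau; field.
  by rewrite f0 q10.
by move: (FJ (tau q)) F0' => f f0; field.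
Qed.

Let is_derive_psi q : 1 < q < Rad ^+ 2 -> is_derive q (1 : R) psi (psi' q).
Proof.
move=> hq; have h := is_derive_W hq; have /andP[q1 qR] := hq.
have q0 : q != 0 by rewrite gt_eqF// (lt_trans _ q1).
have dV := is_deriveV q0 (is_derive_id q 1).
rewrite /psi; apply: is_derive_eq; rewrite /GRing.scale /= /psi'.
by field.
Qed.

Let cont_W q : 1 < q < Rad ^+ 2 -> {for q, continuous W}.
Proof.
move=> hq; have h := is_derive_W hq.
by apply/differentiable_continuous/derivable1_diffP; apply: ex_derive.
Qed.

Let cont_psi q : 1 < q < Rad ^+ 2 -> {for q, continuous psi}.
Proof.
move=> hq; have h := is_derive_psi hq.
by apply/differentiable_continuous/derivable1_diffP; apply: ex_derive.
Qed.

Let cont_psi' q : 1 < q < Rad ^+ 2 -> {for q, continuous psi'}.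
Proof.
move=> hq; have cW := cont_W hq; have /andP[q1 qR] := hq.
have q0 : q != 0 by rewrite gt_eqF// (lt_trans _ q1).
have q10 : 2 * (q - 1) != 0 by rewrite gt_eqF// mulr_gt0// subr_gt0.
apply: cvgB; apply: cvgM => //.
- apply: cvgB; first exact: cvg_cst.
  apply: cvgM; first exact: cvgXn.
  apply: cvgV => //; apply: cvgM; first exact: cvg_cst.
  by apply: cvgB; [exact: cvg_id|exact: cvg_cst].
- by apply: cvgV => //; exact: cvg_id.
- by apply: cvgV; [rewrite expf_neq0|apply: cvgXn; exact: cvg_id].
Qed.

(* Barta's argument: [W] is built from the radial eigenfunction [J0] of a disk of
   the same area as the annulus, transplanted through [s^2 = r^2 - 1]. *)
Lemma annulus_poincare (u ux uy : R * R -> R) : tf_data (annulus Rad) u ux uy ->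
  k2 * Int2 (fun p => u p ^+ 2) <= Int2 (fun p => ux p ^+ 2 + uy p ^+ 2).
Proof.
move=> [cu cux cuy dx dy [K [clK KD u0 ux0 uy0]]].
(* [v fst] and [v snd] are the components of u^2 X for the field X = psi (|x|^2) x; [w fst ux] and
   [w snd uy] are their partial derivatives in the first and second variable, each of integral
   zero. *)
pose v (i : R * R -> R) p := u p ^+ 2 * (i p * psi (qf p)).
pose w (i du : R * R -> R) p := 2 * u p * du p * (i p * psi (qf p)) +
   u p ^+ 2 * (psi (qf p) + 2 * i p ^+ 2 * psi' (qf p)).
have qD p : annulus Rad p -> 1 < qf p < Rad ^+ 2 by rewrite annulusE.
have cpsi p : annulus Rad p -> {for p, continuous (psi \o qf)}.
  by move=> /qD Dp; apply: continuous_comp; [exact: continuous_qf|exact: cont_psi].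
have cpsi' p : annulus Rad p -> {for p, continuous (psi' \o qf)}.
  by move=> /qD Dp; apply: continuous_comp; [exact: continuous_qf|exact: cont_psi'].
have cv i : continuous i -> continuous (v i).
  move=> ci; apply: (continuous_glue clK KD) => p hp; first by rewrite /v u0// expr0n mul0r.
  apply: cvgM; first by apply: cvgXn; exact: cu.
  by apply: cvgM; [exact: ci|exact: cpsi].
have cw i du : continuous i -> continuous du -> continuous (w i du).
  move=> ci cdu; apply: (continuous_glue clK KD) => p hp.
    by rewrite /w u0// expr0n mulr0 !mul0r addr0.
  apply: cvgD; apply: cvgM.
  - by apply: cvgM; [apply: cvgM; [exact: cvg_cst|exact: cu]|exact: cdu].
  - by apply: cvgM; [exact: ci|exact: cpsi].
  - by apply: cvgXn; exact: cu.
  - apply: cvgD; first exact: cpsi.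
    apply: cvgM; last exact: cpsi'.
    by apply: cvgM; [exact: cvg_cst|apply: cvgXn; exact: ci].
have c1 : continuous (fst : R * R -> R) by move=> p; exact: cvg_fst.
have c2 : continuous (snd : R * R -> R) by move=> p; exact: cvg_snd.
have v0 i p : ~ K p -> v i p = 0 by move=> Kp; rewrite /v u0// expr0n mul0r.
have w0 i du p : ~ K p -> w i du p = 0.
  by move=> Kp; rewrite /w u0// expr0n mulr0 !mul0r addr0.
have oK : open (~` K) by exact: closed_openC.
have nK p : ~ K p -> \forall z \near p, (~` K) z by move=> Kp; exact: open_nbhs_nbhs.
have dvx x y : is_derive x (1 : R) (fun t => v fst (t, y)) (w fst ux (x, y)).
  have [Kp|Kp] := pselect (K (x, y)); last first.
    rewrite w0//; apply: is_derive_near0.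
    by have := near_row (nK _ Kp); apply: filterS => t; exact: v0.
  have dp := is_derive_psi (qD _ (KD _ Kp)).
  have dq : is_derive x (1 : R) (fun t => t ^+ 2 + y ^+ 2) (2 * x) by dsolve.
  have dc := is_derive1_comp (g := fun t => t ^+ 2 + y ^+ 2) dp dq.
  have du := dx x y.
  have -> : (fun t => v fst (t, y)) =
    (fun t => u (t, y) ^+ 2 * (t * (psi \o (fun t => t ^+ 2 + y ^+ 2)) t)) by [].
  apply: is_derive_eq; rewrite /GRing.scale /= /w /= /qf /=; ring.
have dvy x y : is_derive y (1 : R) (fun t => v snd (x, t)) (w snd uy (x, y)).
  have [Kp|Kp] := pselect (K (x, y)); last first.
    rewrite w0//; apply: is_derive_near0.
    by have := near_col (nK _ Kp); apply: filterS => t; exact: v0.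
  have dp := is_derive_psi (qD _ (KD _ Kp)).
  have dq : is_derive y (1 : R) (fun t => x ^+ 2 + t ^+ 2) (2 * y) by dsolve.
  have dc := is_derive1_comp (g := fun t => x ^+ 2 + t ^+ 2) dp dq.
  have du := dy x y.
  have -> : (fun t => v snd (x, t)) =
    (fun t => u (x, t) ^+ 2 * (t * (psi \o (fun t => x ^+ 2 + t ^+ 2)) t)) by [].
  apply: is_derive_eq; rewrite /GRing.scale /= /w /= /qf /=; ring.
have v1C : Cc2 Rad (v fst) by apply: (Cc2_annulus KD) => //; [exact: v0|exact: cv].
have v2C : Cc2 Rad (v snd) by apply: (Cc2_annulus KD) => //; [exact: v0|exact: cv].
have w1C : Cc2 Rad (w fst ux) by apply: (Cc2_annulus KD) => //; [exact: w0|exact: cw].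
have w2C : Cc2 Rad (w snd uy) by apply: (Cc2_annulus KD) => //; [exact: w0|exact: cw].
have I1 : Int2 (w fst ux) = 0.
  rewrite /Int2 (Cc_fubini w1C) (_ : Rintegral _ _ _ = \int[mu]_(y in setT) 0).
    by rewrite Rintegral_cst//= mul0r.
  apply: eq_Rintegral => y _.
  by apply: (Rint_deriv_Cc (Cc_col y v1C) (Cc_col y w1C).1) => x; exact: dvx.
have I2 : Int2 (w snd uy) = 0.
  rewrite /Int2 (_ : Rintegral _ _ _ = \int[mu]_(y in setT) 0).
    by rewrite Rintegral_cst//= mul0r.
  apply: eq_Rintegral => x _.
  by apply: (Rint_deriv_Cc (Cc_row x v2C) (Cc_row x w2C).1) => y; exact: dvy.
have u2C : Cc2 Rad (fun p => u p ^+ 2).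
  apply: (Cc2_annulus KD) => [p Kp|p]; first by rewrite u0// expr0n.
  by apply: cvgXn; exact: cu.
have eC : Cc2 Rad (fun p => ux p ^+ 2 + uy p ^+ 2).
  apply: (Cc2_annulus KD) => [p Kp|p]; first by rewrite ux0// uy0// expr0n addr0.
  by apply: cvgD; apply: cvgXn; [exact: cux|exact: cuy].
have -> : k2 * Int2 (fun p => u p ^+ 2) =
    Int2 (fun p => k2 * u p ^+ 2 + (w fst ux p + w snd uy p)).
  by rewrite (Int2D (Cc2_Z _ u2C) (Cc2_D w1C w2C)) (Int2D w1C w2C) (Int2Z _ u2C) I1 I2 !addr0.
apply: (le_Int2 (Cc2_D (Cc2_Z _ u2C) (Cc2_D w1C w2C)) eC) => p.
have [Kp|Kp] := pselect (K p); last first.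
  by rewrite !w0// u0// ux0// uy0// !expr0n !mulr0 !addr0.
have /qD/andP[q1 qR] := KD _ Kp.
rewrite /w; set q := qf p in q1 qR *.
have pq : p.1 ^+ 2 = q - p.2 ^+ 2 by rewrite /q /qf; ring.
have q0 : 0 < q by exact: lt_trans q1.
have q10 : 0 < q - 1 by rewrite subr_gt0.
(* The divergence of X is 2 W'(q), to which the Riccati equation applies. *)
have wq : 2 * psi q + 2 * q * psi' q = - k2 - W q ^+ 2 / (q - 1).
  rewrite /psi /psi' /W'; move: (W q) => z; field.
  by rewrite !gt_eqF.
have ps2 : psi q ^+ 2 * q = W q ^+ 2 / q by rewrite /psi; field; rewrite gt_eqF.
(* The favourable sign: |X|^2 is W^2 / q, whereas the Riccati equation supplies the larger W^2 / (q
   - 1). *)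
have wle : W q ^+ 2 / q <= W q ^+ 2 / (q - 1).
  by rewrite ler_wpM2l ?sqr_ge0// lef_pV2 ?posrE//; lra.
(* These squares add up to |grad u - u X|^2; its nonnegativity bounds |grad u|^2 below by div (u^2
   X) - u^2 (div X + |X|^2). *)
have sq1 := sqr_ge0 (ux p - u p * p.1 * psi q).
have sq2 := sqr_ge0 (uy p - u p * p.2 * psi q).
have u20 := sqr_ge0 (u p).
have {}wle := ler_wpM2l u20 wle.
have e1 : u p ^+ 2 * (psi q + 2 * p.1 ^+ 2 * psi' q) + u p ^+ 2 * (psi q + 2 * p.2 ^+ 2 * psi' q)
   = - k2 * u p ^+ 2 - u p ^+ 2 * (W q ^+ 2 / (q - 1)).
  transitivity (u p ^+ 2 * (2 * psi q + 2 * q * psi' q)); first by rewrite pq; ring.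
  by rewrite wq; ring.
have e2 : (u p * p.1 * psi q) ^+ 2 + (u p * p.2 * psi q) ^+ 2 = u p ^+ 2 * (W q ^+ 2 / q).
  rewrite -ps2 !exprMn pq; ring.
move: sq1 sq2; rewrite !sqrrB => sq1 sq2.
lra.
Qed.

End weight.

End Poincare.

(** * Passage to the limit in H^1_0 *)

Section TestInequality.
Variable R : realType.
Notation mu := (@lebesgue_measure R).
Notation lam2 := (@lam2 R).

Lemma integral_Int2 a (D : set (R * R)) f : Cc2 a f -> (forall p, ~ D p -> f p = 0) ->
  (\int[lam2]_(x in D) (f x)%:E)%E = (Int2 f)%:E.
Proof.
move=> fa f0; rewrite integral_mkcond (_ : _ \_ _ = EFin \o f).
  rewrite /Int2 -(Cc_lam2 fa) /Rintegral fineK//.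
  exact: integrable_fin_num (Cc2_integrable fa).
apply/funext => x; rewrite patchE; case: ifPn => //.
by rewrite notin_setE => /f0 /= ->.
Qed.

Lemma tf_vanish D (u ux uy : R * R -> R) : tf_data D u ux uy -> forall p, ~ D p ->
  [/\ u p = 0, ux p = 0 & uy p = 0].
Proof.
move=> [_ _ _ _ _ [K [_ KD u0 ux0 uy0]]] p Dp.
by split; [apply: u0|apply: ux0|apply: uy0] => /KD.
Qed.

Section annulus.
Variables (Rad mu0 : R).
Hypotheses (R1 : 1 < Rad) (m0 : 0 < mu0)
  (nz : forall x : R, 0 < x < mu0 -> besselJ0 x != 0).

Lemma tf_Cc2 (u ux uy : R * R -> R) : tf_data (annulus Rad) u ux uy ->
  [/\ Cc2 Rad u, Cc2 Rad ux & Cc2 Rad uy].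
Proof.
move=> [cu cux cuy _ _ [K [_ KD u0 ux0 uy0]]].
by split; apply: (Cc2_annulus KD).
Qed.

Definition C2 : R := 2 / (3 * pi) * (Rad ^+ 2 - 1) / mu0 ^+ 2.

Lemma Rad21 : 0 < Rad ^+ 2 - 1.
Proof. by rewrite subr_gt0 -(expr1n R 2) ltr_pXn2r// nnegrE// ltW// (lt_trans _ R1). Qed.

(** The first estimate is applied to the squared modulus of the pair, where Cauchy-Schwarz gives the
    energy bound on its derivatives; the Poincare inequality is additive over components and is
    applied to each. *)
Lemma test_ineq (u ux uy v vx vy : R * R -> R) :
  tf_data (annulus Rad) u ux uy -> tf_data (annulus Rad) v vx vy ->
  Int2 (fun p => (u p ^+ 2 + v p ^+ 2) ^+ 2) <=
  C2 * (Int2 (fun p => ux p ^+ 2 + uy p ^+ 2) + Int2 (fun p => vx p ^+ 2 + vy p ^+ 2)) ^+ 2.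
Proof.
move=> du dv.
have [uC uxC uyC] := tf_Cc2 du; have [vC vxC vyC] := tf_Cc2 dv.
have sqC f : Cc2 Rad f -> Cc2 Rad (fun p => f p ^+ 2).
  by move=> fC; rewrite (_ : (fun _ => _) = fun p => f p * f p)//; apply: Cc2_Ml => //; exact: fC.1.
set r := fun p => u p ^+ 2 + v p ^+ 2.
have rC : Cc2 Rad r := Cc2_D (sqC _ uC) (sqC _ vC).
pose rx p := 2 * (u p * ux p + v p * vx p); pose ry p := 2 * (u p * uy p + v p * vy p).
pose e1 p := ux p ^+ 2 + vx p ^+ 2; pose e2 p := uy p ^+ 2 + vy p ^+ 2.
have e1C : Cc2 Rad e1 := Cc2_D (sqC _ uxC) (sqC _ vxC).
have e2C : Cc2 Rad e2 := Cc2_D (sqC _ uyC) (sqC _ vyC).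
have cs (a b c d : R) : (2 * (a * b + c * d)) ^+ 2 <= 4 * (a ^+ 2 + c ^+ 2) * (b ^+ 2 + d ^+ 2).
  by have := sqr_ge0 (a * d - c * b); rewrite !sqrrD !exprMn; nra.
have crx (f g h k : R * R -> R) : Cc2 Rad f -> Cc2 Rad g -> Cc2 Rad h -> Cc2 Rad k ->
    continuous (fun p => 2 * (f p * g p + h p * k p)).
  move=> [cf _] [cg _] [ch _] [ck _] p; apply: cvgM; first exact: cvg_cst.
  by apply: cvgD; apply: cvgM; [exact: cf|exact: cg|exact: ch|exact: ck].
have GN : Int2 (fun p => r p ^+ 2) <= 2 / (3 * pi) * Int2 r * (Int2 e1 + Int2 e2).
  apply: (gagliardo_nirenberg (rx := rx) (ry := ry) rC) => //.
  - by move=> p; rewrite addr_ge0// sqr_ge0.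
  - move=> x y; have h1 := tf_dx du x y; have h2 := tf_dx dv x y.
    by rewrite /r; apply: is_derive_eq; rewrite /GRing.scale/= /rx; ring.
  - move=> x y; have h1 := tf_dy du x y; have h2 := tf_dy dv x y.
    by rewrite /r; apply: is_derive_eq; rewrite /GRing.scale/= /ry; ring.
  - exact: crx.
  - exact: crx.
  - by move=> p; rewrite addr_ge0// sqr_ge0.
  - by move=> p; rewrite addr_ge0// sqr_ge0.
  - by move=> p; exact: cs.
  - by move=> p; exact: cs.
set E := Int2 _ + Int2 _.
have EE : Int2 e1 + Int2 e2 = E.
  rewrite /E (Int2D (sqC _ uxC) (sqC _ uyC)) (Int2D (sqC _ vxC) (sqC _ vyC)).
  by rewrite (Int2D (sqC _ uxC) (sqC _ vxC)) (Int2D (sqC _ uyC) (sqC _ vyC)) addrACA.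
have E0 : 0 <= E.
  by apply: addr_ge0; apply: Int2_ge0 => p; apply: addr_ge0; exact: sqr_ge0.
have PO : mu0 ^+ 2 / (Rad ^+ 2 - 1) * Int2 r <= E.
  rewrite (Int2D (sqC _ uC) (sqC _ vC)) mulrDr.
  by apply: lerD; apply: annulus_poincare.
move: (Int2 r) GN PO E0; rewrite EE; move: (Int2 _) E {EE} => M E D GN PO E0.
have R21 := Rad21; have pi0 := pi_gt0 R.
have m20 : 0 < mu0 ^+ 2 by rewrite exprn_gt0.
have PO' : D <= (Rad ^+ 2 - 1) / mu0 ^+ 2 * E.
  rewrite mulrAC ler_pdivlMr//; move: PO; rewrite mulrAC ler_pdivrMr//.
  by rewrite mulrC [_ * E]mulrC.
apply: (le_trans GN); rewrite /C2.
have -> : 2 / (3 * pi) * (Rad ^+ 2 - 1) / mu0 ^+ 2 * E ^+ 2 =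
  2 / (3 * pi) * ((Rad ^+ 2 - 1) / mu0 ^+ 2 * E) * E by ring.
by rewrite ler_wpM2r// ler_wpM2l// divr_ge0// mulr_ge0// ltW.
Qed.

End annulus.
End TestInequality.

(** * Stability of the inequality under L^2 approximation *)

Section H10limit.
Variable R : realType.
Notation lam2 := (@lam2 R).
Variable D : set (R * R).
Hypothesis mD : measurable D.
Local Notation N f := (\int[lam2]_(x in D) (f x)%:E)%E.

Lemma le_intD (f g h : R * R -> R) (a b : R) :
  measurable_fun D f -> measurable_fun D g -> measurable_fun D h ->
  (forall p, D p -> 0 <= f p) -> (forall p, D p -> 0 <= g p) -> (forall p, D p -> 0 <= h p) ->
  0 <= a -> 0 <= b ->
  (forall p, D p -> f p <= a * g p + b * h p) -> (N f <= a%:E * N g + b%:E * N h)%E.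
Proof.
move=> mf mg mh f0 g0 h0 a0 b0 fgh.
have mag : measurable_fun D (fun p => a * g p) by apply: measurable_funM.
have mbh : measurable_fun D (fun p => b * h p) by apply: measurable_funM.
have ZE (c : R) (k : R * R -> R) : 0 <= c -> measurable_fun D k -> (forall p, D p -> 0 <= k p) ->
    (c%:E * N k = N (fun p => c * k p))%E.
  move=> c0 mk k0; rewrite -ge0_integralZl//.
  exact/measurable_EFinP.
rewrite !ZE// -ge0_integralD//=.
- apply: ge0_le_integral => //.
  + exact/measurable_EFinP.
  + by apply/measurable_EFinP; exact: measurable_funD.
- by move=> p Dp; rewrite lee_fin mulr_ge0// g0.
- exact/measurable_EFinP.
- by move=> p Dp; rewrite lee_fin mulr_ge0// h0.
- exact/measurable_EFinP.
Qed.

Lemma int_addD (f g : R * R -> R) :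
  measurable_fun D f -> measurable_fun D g ->
  (forall p, D p -> 0 <= f p) -> (forall p, D p -> 0 <= g p) ->
  N (fun p => f p + g p) = (N f + N g)%E.
Proof.
move=> mf mg f0 g0; rewrite -ge0_integralD//.
- exact/measurable_EFinP.
- exact/measurable_EFinP.
Qed.

(** The factor of [b ^+ 2] can be taken arbitrarily close to 1, which preserves the sharp constant;
    the large factor falls on the error, which tends to 0 first. *)
Lemma cauchy_eps (eps a b : R) : 0 < eps ->
  a ^+ 2 <= (1 + eps) * b ^+ 2 + (1 + eps^-1) * (a - b) ^+ 2.
Proof.
move=> e0; rewrite -subr_ge0.
have -> : (1 + eps) * b ^+ 2 + (1 + eps^-1) * (a - b) ^+ 2 - a ^+ 2 =
  eps^-1 * (eps * b - (a - b)) ^+ 2 by field; rewrite gt_eqF.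
by rewrite mulr_ge0 ?sqr_ge0// invr_ge0 ltW.
Qed.

Lemma test_fun_measurable u : test_fun D u ->
  [/\ measurable_fun D u, measurable_fun D (pd false u) & measurable_fun D (pd true u)].
Proof.
move=> /test_fun_data du; split; apply: measurable_funTS; apply: continuous_measurable2.
- exact: tf_c du.
- exact: tf_cx du.
- exact: tf_cy du.
Qed.

Lemma measurable_sq (f : R * R -> R) : measurable_fun D f -> measurable_fun D (fun p => f p ^+ 2).
Proof. by move=> mf; apply: measurable_funX. Qed.

Lemma grad_norm_le u g1 g2 (eps : R) : 0 < eps ->
  measurable_fun D g1 -> measurable_fun D g2 -> test_fun D u ->
  (grad_norm_sq D (pd false u) (pd true u) <= (1 + eps)%:E * grad_norm_sq D g1 g2 +
    (1 + eps^-1)%:E * (L2dist2 D (pd false u) g1 + L2dist2 D (pd true u) g2))%E.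
Proof.
move=> e0 mg1 mg2 /test_fun_measurable[_ m1 m2].
have md1 := measurable_sq (measurable_funB m1 mg1).
have md2 := measurable_sq (measurable_funB m2 mg2).
rewrite -int_addD//; try by move=> p _; exact: sqr_ge0.
apply: le_intD; try by move=> p _; rewrite addr_ge0// sqr_ge0.
- by apply: measurable_funD; exact: measurable_sq.
- by apply: measurable_funD; exact: measurable_sq.
- by apply: measurable_funD.
- by rewrite addr_ge0// ltW.
- by rewrite addr_ge0// invr_ge0 ltW.
move=> p _; have := cauchy_eps (pd false u p) (g1 p) e0.
have := cauchy_eps (pd true u p) (g2 p) e0.
by rewrite !mulrDr; lra.
Qed.

Lemma grad_norm_le_rev u g1 g2 :
  measurable_fun D g1 -> measurable_fun D g2 -> test_fun D u ->
  (grad_norm_sq D g1 g2 <= 2%:E * grad_norm_sq D (pd false u) (pd true u) +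
    2%:E * (L2dist2 D (pd false u) g1 + L2dist2 D (pd true u) g2))%E.
Proof.
move=> mg1 mg2 /test_fun_measurable[_ m1 m2].
have md1 := measurable_sq (measurable_funB m1 mg1).
have md2 := measurable_sq (measurable_funB m2 mg2).
rewrite -int_addD//; try by move=> p _; exact: sqr_ge0.
apply: le_intD => //; try by move=> p _; rewrite addr_ge0// sqr_ge0.
- by apply: measurable_funD; exact: measurable_sq.
- by apply: measurable_funD; exact: measurable_sq.
- by apply: measurable_funD.
move=> p _; have h (a b : R) : b ^+ 2 <= 2 * a ^+ 2 + 2 * (a - b) ^+ 2.
  by have := sqr_ge0 (2 * a - b); rewrite !sqrrB !exprMn; lra.
have := h (pd false u p) (g1 p); have := h (pd true u p) (g2 p).
by rewrite !mulrDr; lra.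
Qed.


(* Truncation makes the limit in L^2 legitimate without knowing beforehand that
   the limit is in L^4; the truncation level is removed by monotone convergence. *)
Lemma trunc_le (w1 w2 p1 p2 W V : R * R -> R) (eps m : R) :
  W = (fun p => w1 p ^+ 2 + w2 p ^+ 2) -> V = (fun p => Num.min (W p) m) ->
  measurable_fun D w1 -> measurable_fun D w2 ->
  measurable_fun D p1 -> measurable_fun D p2 -> 0 < eps -> 0 <= m ->
  (N (fun p => V p * W p) <=
   ((1 + eps) / 2)%:E * (N (fun p => V p ^+ 2) + N (fun p => (p1 p ^+ 2 + p2 p ^+ 2) ^+ 2)) +
   ((1 + eps^-1) * m)%:E * (L2dist2 D p1 w1 + L2dist2 D p2 w2))%E.
Proof.
move=> WE VE mw1 mw2 mp1 mp2 e0 m0.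
have mW : measurable_fun D W by rewrite WE; apply: measurable_funD; exact: measurable_sq.
have mV : measurable_fun D V by rewrite VE; apply: measurable_minr.
have md1 := measurable_sq (measurable_funB mp1 mw1).
have md2 := measurable_sq (measurable_funB mp2 mw2).
have mP : measurable_fun D (fun p => p1 p ^+ 2 + p2 p ^+ 2).
  by apply: measurable_funD; exact: measurable_sq.
have W0 p : 0 <= W p by rewrite WE addr_ge0// sqr_ge0.
have V0 p : 0 <= V p by rewrite VE le_min W0.
have Vm p : V p <= m by rewrite VE ge_min lexx orbT.
rewrite -!int_addD//; try by [move=> p _; exact: sqr_ge0|exact: measurable_sq].
have e20 : 0 <= (1 + eps) / 2 by rewrite divr_ge0// addr_ge0// ltW.
have e10 : 0 <= 1 + eps^-1 by rewrite addr_ge0// invr_ge0 ltW.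
apply: le_intD => //; try by move=> p _; rewrite addr_ge0// sqr_ge0.
- exact: measurable_funM.
- by apply: measurable_funD; exact: measurable_sq.
- exact: measurable_funD.
- by move=> p _; rewrite mulr_ge0.
- by rewrite mulr_ge0.
move=> p _.
have h1 := cauchy_eps (w1 p) (p1 p) e0; have h2 := cauchy_eps (w2 p) (p2 p) e0.
set P := p1 p ^+ 2 + p2 p ^+ 2; set d := (p1 p - w1 p) ^+ 2 + (p2 p - w2 p) ^+ 2.
have d0 : 0 <= d by rewrite addr_ge0// sqr_ge0.
have h : W p <= (1 + eps) * P + (1 + eps^-1) * d.
  rewrite WE /P /d -[(p1 p - w1 p) ^+ 2]sqrrN -[(p2 p - w2 p) ^+ 2]sqrrN !opprB !mulrDr.
  by move: h1 h2; rewrite !mulrDl; lra.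
apply: le_trans (ler_wpM2l (V0 p) h) _; rewrite mulrDr; apply: lerD.
  have -> : V p * ((1 + eps) * P) = (1 + eps) / 2 * (2 * V p * P) by field.
  by rewrite ler_wpM2l//; have := sqr_ge0 (V p - P); rewrite sqrrB; lra.
have -> : V p * ((1 + eps^-1) * d) = (1 + eps^-1) * d * V p by ring.
have -> : (1 + eps^-1) * m * d = (1 + eps^-1) * d * m by ring.
by rewrite ler_wpM2l// mulr_ge0.
Qed.

Lemma cvg0_small (u : nat -> \bar R) (e : R) : (u n @[n --> \oo] --> 0%E) -> 0 < e ->
  \forall n \near \oo, (u n <= e%:E)%E.
Proof.
move=> u0 e0.
have h : (u n @[n --> \oo] --> 0%:E) by [].
have /fine_cvgP[uf uc] := h.
move/cvgrPdist_le : uc => /(_ _ e0) uc.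
near=> n.
have fn : u n \is a fin_num by near: n.
rewrite -(fineK fn) lee_fin.
have : `|0 - (fine \o u) n| <= e by near: n.
by rewrite sub0r normrN; apply: le_trans; exact: ler_norm.
Unshelve. all: by end_near. Qed.

(** The approximation bounds the truncated integral [I] by half of [v + C2 * G ^+ 2], up to [eps],
    where [v] is the integral of [V ^+ 2] and hence at most [I]. As [I] is finite, half of it is
    absorbed. The inequality on test functions is taken with upper bounds [e1] and [e2], so that the
    perturbed gradient norms can be inserted directly. *)
Lemma H10_lim_real (C2 G : R) (Df : (lam2 D < +oo)%E)
    (w1 w2 g11 g12 g21 g22 W V : R * R -> R) (m : R) :
  W = (fun p => w1 p ^+ 2 + w2 p ^+ 2) -> V = (fun p => Num.min (W p) m) ->
  0 <= C2 -> 0 <= m ->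
  (forall u v, test_fun D u -> test_fun D v -> forall e1 e2 : R,
     (grad_norm_sq D (pd false u) (pd true u) <= e1%:E)%E ->
     (grad_norm_sq D (pd false v) (pd true v) <= e2%:E)%E ->
     (N (fun p => (u p ^+ 2 + v p ^+ 2) ^+ 2) <= (C2 * (e1 + e2) ^+ 2)%:E)%E) ->
  H10 D w1 g11 g12 -> H10 D w2 g21 g22 ->
  (grad_norm_sq D g11 g12 + grad_norm_sq D g21 g22 = G%:E)%E ->
  (N (fun p => V p * W p) <= (C2 * G ^+ 2)%:E)%E.
Proof.
move=> WE VE C0 m0 ti [mw1 mg11 mg12 [p1 [t1 a1 b1 c1]]] [mw2 mg21 mg22 [p2 [t2 a2 b2 c2]]] GE.
have ga0 : (0 <= grad_norm_sq D g11 g12)%E.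
  by apply: integral_ge0 => p _; rewrite lee_fin addr_ge0// sqr_ge0.
have gb0 : (0 <= grad_norm_sq D g21 g22)%E.
  by apply: integral_ge0 => p _; rewrite lee_fin addr_ge0// sqr_ge0.
have [Ga [Gb [Ea Eb GG]]] : exists Ga Gb, [/\ grad_norm_sq D g11 g12 = Ga%:E,
    grad_norm_sq D g21 g22 = Gb%:E & Ga + Gb = G].
  move: GE ga0 gb0; case: (grad_norm_sq D g11 g12) => [a||] //;
    case: (grad_norm_sq D g21 g22) => [b||]// [<-] _ _; by exists a, b.
have Ga0 : 0 <= Ga by rewrite -lee_fin -Ea.
have Gb0 : 0 <= Gb by rewrite -lee_fin -Eb.
have G0 : 0 <= G by rewrite -GG addr_ge0.
have mW : measurable_fun D W by rewrite WE; apply: measurable_funD; exact: measurable_sq.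
have mV : measurable_fun D V by rewrite VE; apply: measurable_minr.
have W0 p : 0 <= W p by rewrite WE addr_ge0// sqr_ge0.
have V0 p : 0 <= V p by rewrite VE le_min W0.
have Vm p : V p <= m by rewrite VE ge_min lexx orbT.
have VW p : V p <= W p by rewrite VE ge_min lexx.
set I := (X in (X <= _)%E).
have V2I : (N (fun p => V p ^+ 2) <= I)%E.
  apply: ge0_le_integral => //.
  - by move=> p _; rewrite lee_fin sqr_ge0.
  - by apply/measurable_EFinP; exact: measurable_sq.
  - by apply/measurable_EFinP; exact: measurable_funM.
  - by move=> p _; rewrite lee_fin expr2 ler_wpM2l.
have [v vE] : exists v, N (fun p => V p ^+ 2) = v%:E.
  have h0 : (0 <= N (fun p => V p ^+ 2))%E.
    by apply: integral_ge0 => p _; rewrite lee_fin sqr_ge0.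
  have : (N (fun p => V p ^+ 2) < +oo)%E.
    apply: (@le_lt_trans _ _ ((m ^+ 2)%:E * lam2 D)%E).
      rewrite -integral_cst//; apply: ge0_le_integral => //.
      - by move=> p _; rewrite lee_fin sqr_ge0.
      - by apply/measurable_EFinP; exact: measurable_sq.
      - by move=> p _; rewrite lee_fin ler_pXn2r// nnegrE.
    by rewrite lte_mul_pinfty// ?lee_fin ?sqr_ge0.
  by move: h0; case: (N (fun p => V p ^+ 2)) => // v; exists v.
have key (eps : R) : 0 < eps -> eps < 1 ->
   (I <= ((1 + eps) / 2 * (v + C2 * ((1 + eps) * G + eps) ^+ 2) + eps)%:E)%E.
  move=> e0 e1.
  have i0 : 0 < 1 + eps^-1 by rewrite addr_gt0// invr_gt0.
  (* Small enough for both the gradient error and the truncation error; [m + 1] appears because [m]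
     may be zero. *)
  pose d := eps / (1 + eps^-1) / (m + 1) / 4.
  have m10 : 0 < m + 1 by rewrite ltr_wpDl.
  have d0 : 0 < d by rewrite /d !divr_gt0.
  near \oo => n.
  have A1 : (L2dist2 D (p1 n) w1 <= d%:E)%E by near: n; exact: cvg0_small.
  have A2 : (L2dist2 D (p2 n) w2 <= d%:E)%E by near: n; exact: cvg0_small.
  have B1 : (L2dist2 D (pd false (p1 n)) g11 <= d%:E)%E by near: n; exact: cvg0_small.
  have B2 : (L2dist2 D (pd false (p2 n)) g21 <= d%:E)%E by near: n; exact: cvg0_small.
  have D1 : (L2dist2 D (pd true (p1 n)) g12 <= d%:E)%E by near: n; exact: cvg0_small.
  have D2 : (L2dist2 D (pd true (p2 n)) g22 <= d%:E)%E by near: n; exact: cvg0_small.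
  have dE : d * (m + 1) * (1 + eps^-1) * 4 = eps.
    by rewrite /d; move: (1 + eps^-1) i0 => k k0; field; rewrite !gt_eqF.
  have dl : (1 + eps^-1) * (d + d) <= eps / 2.
    have h2 : 0 <= d * m * (1 + eps^-1) by apply: mulr_ge0; [apply: mulr_ge0 => //|]; apply: ltW.
    by apply: (@le_trans _ _ (d * (m + 1) * (1 + eps^-1) * 4 / 2)); [lra|rewrite dE].
  have dl2 : (1 + eps^-1) * m * (d + d) <= eps.
    have h1 : 0 <= d * (1 + eps^-1) by apply: mulr_ge0; apply: ltW.
    have h2 : 0 <= d * m * (1 + eps^-1) by apply: mulr_ge0; [apply: mulr_ge0 => //|]; apply: ltW.
    by apply: (@le_trans _ _ (d * (m + 1) * (1 + eps^-1) * 4)); [lra|rewrite dE].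
  have g1 : (grad_norm_sq D (pd false (p1 n)) (pd true (p1 n)) <= ((1 + eps) * Ga + eps / 2)%:E)%E.
    apply: le_trans (grad_norm_le e0 mg11 mg12 (t1 n)) _; rewrite Ea.
    apply: (@le_trans _ _ ((1 + eps)%:E * Ga%:E + (1 + eps^-1)%:E * (d%:E + d%:E))%E).
      by apply: leeD => //; apply: lee_wpmul2l; [rewrite lee_fin ltW|exact: leeD].
    by move: dl; rewrite -(lerD2l ((1 + eps) * Ga)) -lee_fin.
  have g2 : (grad_norm_sq D (pd false (p2 n)) (pd true (p2 n)) <= ((1 + eps) * Gb + eps / 2)%:E)%E.
    apply: le_trans (grad_norm_le e0 mg21 mg22 (t2 n)) _; rewrite Eb.
    apply: (@le_trans _ _ ((1 + eps)%:E * Gb%:E + (1 + eps^-1)%:E * (d%:E + d%:E))%E).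
      by apply: leeD => //; apply: lee_wpmul2l; [rewrite lee_fin ltW|exact: leeD].
    by move: dl; rewrite -(lerD2l ((1 + eps) * Gb)) -lee_fin.
  have := ti _ _ (t1 n) (t2 n) _ _ g1 g2.
  have -> : (1 + eps) * Ga + eps / 2 + ((1 + eps) * Gb + eps / 2) = (1 + eps) * G + eps.
    by rewrite -GG; field.
  move=> tin.
  have [mp1 _ _] := test_fun_measurable (t1 n).
  have [mp2 _ _] := test_fun_measurable (t2 n).
  apply: le_trans (trunc_le WE VE mw1 mw2 mp1 mp2 e0 m0) _; rewrite vE.
  apply: (@le_trans _ _ (((1 + eps) / 2)%:E * (v%:E + (C2 * ((1 + eps) * G + eps) ^+ 2)%:E) +
     ((1 + eps^-1) * m)%:E * (d%:E + d%:E))%E).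
    apply: leeD; apply: lee_wpmul2l.
    - by rewrite lee_fin divr_ge0// addr_ge0// ltW.
    - by rewrite leeD2l.
    - by rewrite lee_fin mulr_ge0// ltW.
    - by rewrite leeD.
  by move: dl2; rewrite -(lerD2l ((1 + eps) / 2 * (v + C2 * ((1 + eps) * G + eps) ^+ 2))) -lee_fin.
have I0 : (0 <= I)%E by apply: integral_ge0 => p _; rewrite lee_fin mulr_ge0.
have [J JE] : exists J, I = J%:E.
  have h20 : 0 < 2^-1 :> R by [].
  have h21 : 2^-1 < 1 :> R by lra.
  move: (key _ h20 h21) I0; clear; clearbody I.
  by case: I => // J _ _; exists J.
move: V2I; rewrite JE vE lee_fin => vJ.
move: key; rewrite JE => key.
have v0 : 0 <= v.
  by rewrite -lee_fin -vE; apply: integral_ge0 => p _; rewrite lee_fin sqr_ge0.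
rewrite lee_fin.
suff : J <= 2^-1 * (v + C2 * G ^+ 2) by lra.
pose f (eps : R) := (1 + eps) / 2 * (v + C2 * ((1 + eps) * G + eps) ^+ 2) + eps.
have cf : continuous f.
  move=> x; rewrite /f; apply/differentiable_continuous/derivable1_diffP.
  exact: ex_derive.
have fl : f x @[x --> 0^'+] --> f 0 by apply: cvg_at_right_filter; exact: cf.
have -> : 2^-1 * (v + C2 * G ^+ 2) = f 0 by rewrite /f; field.
apply: (cvgr_to_ge fl).
near=> x; rewrite -lee_fin; apply: key; near: x.
  exact: nbhs_right_gt.
by apply: nbhs_right_lt.
Unshelve. all: by end_near. Qed.

End H10limit.

(** * The vector inequality on the annulus *)

Section AnnulusH10.
Variable R : realType.
Notation lam2 := (@lam2 R).
Variables (Rad mu0 : R).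
Hypotheses (R1 : 1 < Rad) (m0 : 0 < mu0)
  (nz : forall x : R, 0 < x < mu0 -> besselJ0 x != 0).
Let D := annulus Rad.
Local Notation N f := (\int[lam2]_(x in D) (f x)%:E)%E.

Lemma measurable_annulus : measurable (annulus Rad).
Proof. exact: open_measurable2 (open_annulus R1). Qed.

Lemma box_fin (a : R) : (lam2 (`[(- a)%R, a]%classic `*` `[(- a)%R, a]%classic) < +oo)%E.
Proof.
have E := @product_measure1E _ _ _ _ _ (@lebesgue_measure R) (@lebesgue_measure R) _ _ (measurable_itv `[- a, a]) (measurable_itv `[- a, a]).
rewrite [ltLHS]E.
have fi : @lebesgue_measure R `[- a, a]%classic \is a fin_num.
  by have := @lebesgue_measure_itv R `[- a, a] => /= ->; case: ifP => //= _; rewrite -EFinB.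
by rewrite -ge0_fin_numE ?mule_ge0// fin_numM.
Qed.

Lemma annulus_fin : (lam2 D < +oo)%E.
Proof.
apply: le_lt_trans (box_fin Rad); apply: le_measure; rewrite ?inE.
- exact: measurable_annulus.
- by apply: measurableX; exact: measurable_itv.
- by move=> p /annulus_box[h1 h2]; split; rewrite /= in_itv/= -ler_norml.
Qed.

Definition Cst : R := mu0^-1 * Num.sqrt (2 / (3 * pi) * (Rad ^+ 2 - 1)).

Lemma Cst_gt0 : 0 < Cst.
Proof.
rewrite mulr_gt0 ?invr_gt0// sqrtr_gt0 mulr_gt0 ?Rad21// divr_gt0// mulr_gt0//.
exact: pi_gt0.
Qed.

Lemma Cst_sq : Cst ^+ 2 = C2 Rad mu0.
Proof.
rewrite /Cst exprMn sqr_sqrtr; last first.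
  by rewrite mulr_ge0 ?(ltW (Rad21 R1))// divr_ge0// mulr_ge0// ltW// pi_gt0.
by rewrite /C2 exprVn mulrC.
Qed.

Lemma C2_ge0 : 0 <= C2 Rad mu0.
Proof. by rewrite -Cst_sq sqr_ge0. Qed.

Lemma test_grad u : test_fun D u -> grad_norm_sq D (pd false u) (pd true u) =
  (Int2 (fun p => pd false u p ^+ 2 + pd true u p ^+ 2))%:E.
Proof.
move=> /test_fun_data du; have [uC uxC uyC] := tf_Cc2 du.
have sqC f : Cc2 Rad f -> Cc2 Rad (fun p => f p ^+ 2).
  by move=> fC; rewrite (_ : (fun _ => _) = fun p => f p * f p)//; apply: Cc2_Ml => //; exact: fC.1.
apply: (integral_Int2 (Cc2_D (sqC _ uxC) (sqC _ uyC))) => p Dp.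
have [_ -> ->] := tf_vanish du Dp; by rewrite expr0n addr0.
Qed.

Lemma test_L4 u v : test_fun D u -> test_fun D v ->
  N (fun p => (u p ^+ 2 + v p ^+ 2) ^+ 2) = (Int2 (fun p => (u p ^+ 2 + v p ^+ 2) ^+ 2))%:E.
Proof.
move=> /test_fun_data du /test_fun_data dv.
have [uC uxC uyC] := tf_Cc2 du; have [vC vxC vyC] := tf_Cc2 dv.
have sqC f : Cc2 Rad f -> Cc2 Rad (fun p => f p ^+ 2).
  by move=> fC; rewrite (_ : (fun _ => _) = fun p => f p * f p)//; apply: Cc2_Ml => //; exact: fC.1.
apply: (integral_Int2 (sqC _ (Cc2_D (sqC _ uC) (sqC _ vC)))) => p Dp.
have [-> _ _] := tf_vanish du Dp; have [-> _ _] := tf_vanish dv Dp.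
by rewrite expr0n addr0 expr0n.
Qed.

Lemma test_ineqE u v : test_fun D u -> test_fun D v -> forall e1 e2 : R,
   (grad_norm_sq D (pd false u) (pd true u) <= e1%:E)%E ->
   (grad_norm_sq D (pd false v) (pd true v) <= e2%:E)%E ->
   (N (fun p => (u p ^+ 2 + v p ^+ 2) ^+ 2) <= (C2 Rad mu0 * (e1 + e2) ^+ 2)%:E)%E.
Proof.
move=> tu tv e1 e2.
rewrite (test_grad tu) lee_fin => h1.
rewrite (test_grad tv) lee_fin => h2.
rewrite (test_L4 tu tv).
rewrite lee_fin.
have := test_ineq R1 m0 nz (test_fun_data tu) (test_fun_data tv).
have C20 := C2_ge0.
have a0 : 0 <= Int2 (fun p => pd false u p ^+ 2 + pd true u p ^+ 2).
  by apply: Int2_ge0 => p; apply: addr_ge0; exact: sqr_ge0.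
have b0 : 0 <= Int2 (fun p => pd false v p ^+ 2 + pd true v p ^+ 2).
  by apply: Int2_ge0 => p; apply: addr_ge0; exact: sqr_ge0.
move: (Int2 _) (Int2 _) (Int2 _) h1 h2 a0 b0 => X Y Z h1 h2 a0 b0 h.
apply: (le_trans h); rewrite ler_wpM2l// ler_pXn2r// ?nnegrE ?addr_ge0//.
- exact: lerD.
- by rewrite (le_trans a0).
- by rewrite (le_trans b0).
Qed.

(** Finiteness is inherited from the approximants: it suffices to compare with one test function
    whose partial derivatives are within squared distance 1 of [g1] and [g2]. *)
Lemma H10_grad_fin w g1 g2 : H10 D w g1 g2 -> exists2 G : R, 0 <= G & grad_norm_sq D g1 g2 = G%:E.
Proof.
move=> [mw mg1 mg2 [p [t a b c]]].
near \oo => n.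
have B1 : (L2dist2 D (pd false (p n)) g1 <= 1%:E)%E by near: n; exact: cvg0_small.
have B2 : (L2dist2 D (pd true (p n)) g2 <= 1%:E)%E by near: n; exact: cvg0_small.
have := grad_norm_le_rev measurable_annulus mg1 mg2 (t n).
rewrite (test_grad (t n)); move: (Int2 _) => E h.
have g0 : (0 <= grad_norm_sq D g1 g2)%E.
  by apply: integral_ge0 => z _; rewrite lee_fin addr_ge0// sqr_ge0.
have : (grad_norm_sq D g1 g2 <= (2 * E + 2 * (1 + 1))%:E)%E.
  apply: (le_trans h).
  rewrite (_ : (2 * E + 2 * (1 + 1))%:E = (2%:E * E%:E + 2%:E * (1%:E + 1%:E))%E)//.
  by rewrite leeD2l//; apply: lee_wpmul2l; [rewrite lee_fin|rewrite leeD].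
by move: g0; case: (grad_norm_sq D g1 g2) => // G; rewrite !lee_fin => G0 _; exists G.
Unshelve. all: by end_near. Qed.

Lemma H10_L4 w1 w2 g11 g12 g21 g22 (G : R) :
  H10 D w1 g11 g12 -> H10 D w2 g21 g22 ->
  (grad_norm_sq D g11 g12 + grad_norm_sq D g21 g22 = G%:E)%E ->
  (N (fun p => (w1 p ^+ 2 + w2 p ^+ 2) ^+ 2) <= (C2 Rad mu0 * G ^+ 2)%:E)%E.
Proof.
move=> h1 h2 GE.
have mD := measurable_annulus.
have [mw1 _ _ _] := h1; have [mw2 _ _ _] := h2.
pose W p := w1 p ^+ 2 + w2 p ^+ 2.
have mW : measurable_fun D W by apply: measurable_funD; exact: measurable_sq.
have W0 p : 0 <= W p by rewrite addr_ge0// sqr_ge0.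
have C20 := C2_ge0.
pose V (n : nat) p := Num.min (W p) n%:R * W p.
have lim := @cvg_monotone_convergence _ _ _ lam2 D mD (fun n p => (V n p)%:E).
have VE n : (N (V n) <= (C2 Rad mu0 * G ^+ 2)%:E)%E.
  exact: (H10_lim_real mD annulus_fin erefl erefl C20 (ler0n _ n) test_ineqE h1 h2 GE).
have {}lim := lim _ _ _.
have lim' : (N (V n) @[n --> \oo] --> (\int[lam2]_(x in D) limn (fun n => (V n x)%:E))%E).
  apply: lim.
  - by move=> n; apply/measurable_EFinP; apply: measurable_funM => //; exact: measurable_minr.
  - by move=> n p _; rewrite lee_fin mulr_ge0// le_min W0 ler0n.
  - move=> p _ n m nm; rewrite lee_fin ler_wpM2r// le_min ge_min lexx/= ge_min.
    by apply/orP; right; rewrite ler_nat.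
have -> : N (fun p => W p ^+ 2) = (\int[lam2]_(x in D) limn (fun n => (V n x)%:E))%E.
  apply: eq_integral => p _; apply/esym/cvg_lim => //.
  apply: cvg_near_cst; near=> n; rewrite /V expr2 min_l//.
  near: n; exact: nbhs_infty_ger.
apply: (cvge_to_le lim'); apply: nearW => n; exact: VE.
Unshelve. all: by end_near. Qed.

Lemma H10_vec w1 w2 g11 g12 g21 g22 :
  H10 D w1 g11 g12 -> H10 D w2 g21 g22 ->
  (L4norm_sq_vec D w1 w2 <= Cst%:E * (grad_norm_sq D g11 g12 + grad_norm_sq D g21 g22))%E.
Proof.
move=> h1 h2.
have [G1 G10 E1] := H10_grad_fin h1; have [G2 G20 E2] := H10_grad_fin h2.
have := H10_L4 h1 h2; rewrite E1 E2 -EFinD => /(_ _ erefl).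
rewrite /L4norm_sq_vec -EFinM.
have -> : N (fun p => Num.sqrt (w1 p ^+ 2 + w2 p ^+ 2) ^+ 4) = N (fun p => (w1 p ^+ 2 + w2 p ^+ 2) ^+ 2).
  apply: eq_integral => p _; congr (_%:E).
  rewrite (_ : Num.sqrt _ ^+ 4 = (Num.sqrt (w1 p ^+ 2 + w2 p ^+ 2) ^+ 2) ^+ 2); last by ring.
  by rewrite sqr_sqrtr// addr_ge0// sqr_ge0.
have : (0 <= N (fun p => (w1 p ^+ 2 + w2 p ^+ 2) ^+ 2))%E.
  by apply: integral_ge0 => p _; rewrite lee_fin sqr_ge0.
move: (N (fun p => (w1 p ^+ 2 + w2 p ^+ 2) ^+ 2)) => [x| |]//; rewrite !lee_fin => x0 hx.
rewrite powR12_sqrt// -[leRHS]ger0_norm; last first.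
  by rewrite mulr_ge0 ?(ltW Cst_gt0)// addr_ge0.
by rewrite -sqrtr_sqr ler_wsqrtr// exprMn Cst_sq.
Qed.

End AnnulusH10.

(** * Smoothness of composite functions *)

Section Smooth.
Variable R : realType.
Implicit Types (U V : set (R * R)) (f g : R * R -> R).

(** Smoothness graded by order makes products and compositions provable by induction on [n];
    localising to [U] admits functions such as [ln] composed with a positive map. *)
Fixpoint smooth_upto (n : nat) U f : Prop :=
  (forall p, U p -> {for p, continuous f}) /\
  if n is m.+1 then
    (forall p, U p -> derivable (fun t => f (t, p.2)) p.1 1 /\
                      derivable (fun t => f (p.1, t)) p.2 1) /\
    (forall b, smooth_upto m U (pd b f))
  else True.

Lemma smooth_upto_cont n U f : smooth_upto n U f -> forall p, U p -> {for p, continuous f}.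
Proof. by case: n => [|n] []. Qed.

Lemma smooth_upto_le n U f : smooth_upto n.+1 U f -> smooth_upto n U f.
Proof.
elim: n f => [|n IH] f [cf [df pf]]; first by split.
by split=> //; split=> // b; exact: IH (pf b).
Qed.

Lemma near_eq_row U f g p : open U -> {in U, f =1 g} -> U p ->
  (\forall t \near p.1, f (t, p.2) = g (t, p.2)) /\
  (\forall t \near p.2, f (p.1, t) = g (p.1, t)).
Proof.
case: p => x y oU fg Up /=.
have nU : \forall z \near (x, y), U z by exact: open_nbhs_nbhs.
split; [have := near_row nU|have := near_col nU]; apply: filterS => t Ut;
by apply: fg; rewrite inE.
Qed.

Lemma pd_eq U f g b p : open U -> {in U, f =1 g} -> U p -> pd b f p = pd b g p.
Proof.
move=> oU fg Up; have [h1 h2] := near_eq_row oU fg Up.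
by case: b; rewrite /pd !derive1E; apply: near_eq_derive.
Qed.

Lemma smooth_upto_eq n U f g : open U -> {in U, f =1 g} -> smooth_upto n U f -> smooth_upto n U g.
Proof.
move=> oU; elim: n f g => [|n IH] f g fg.
  move=> [cf _]; split=> // p Up.
  have nU : \forall z \near p, f z = g z.
    have : \forall z \near p, U z by exact: open_nbhs_nbhs.
    by apply: filterS => z Uz; apply: fg; rewrite inE.
  have fp : f p = g p by apply: fg; rewrite inE.
  rewrite /prop_for /continuous_at -fp; apply: cvg_trans (cf p Up).
  by apply: near_eq_cvg; exact: nU.
move=> Sf; have [_ [df pf]] := Sf.
have S0 : smooth_upto 0 U g.
  split=> // p Up.
  have nU : \forall z \near p, f z = g z.
    have : \forall z \near p, U z by exact: open_nbhs_nbhs.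
    by apply: filterS => z Uz; apply: fg; rewrite inE.
  have fp : f p = g p by apply: fg; rewrite inE.
  rewrite /prop_for /continuous_at -fp; apply: cvg_trans (smooth_upto_cont Sf Up).
  by apply: near_eq_cvg; exact: nU.
split; first exact: S0.1.
split.
  move=> p Up; have [h1 h2] := near_eq_row oU fg Up; have [d1 d2] := df p Up.
  by split; [exact: near_eq_derivable h1 d1|exact: near_eq_derivable h2 d2].
move=> b; apply: IH (pf b) => p; rewrite inE => Up.
exact: pd_eq oU fg Up.
Qed.

(** Allows a function to be shown smooth by different formulas on overlapping pieces. *)
Lemma smooth_upto_setU n U V f : smooth_upto n U f -> smooth_upto n V f -> smooth_upto n (U `|` V) f.
Proof.
elim: n f => [|n IH] f; first by move=> [h1 _] [h2 _]; split=> // p [/h1|/h2].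
move=> [h1 [d1 p1]] [h2 [d2 p2]]; split; first by move=> p [/h1|/h2].
split; first by move=> p [/d1|/d2].
by move=> b; exact: (IH (pd b f) (p1 b) (p2 b)).
Qed.

Lemma smooth_upto_cst n U c : smooth_upto n U (cst c).
Proof.
elim: n c => [|n IH] c; first by split=> // p _; exact: cvg_cst.
split; first by move=> p _; exact: cvg_cst.
split=> [p _|b]; first by split; exact: derivable_cst.
rewrite (_ : pd b (cst c) = cst 0); first exact: IH.
by apply/funext => p; rewrite /pd; case: b; rewrite derive1_cst.
Qed.

Lemma smooth_upto_fst n U : smooth_upto n U fst.
Proof.
have c p : {for p, continuous (fst : R * R -> R)} by exact: cvg_fst.
case: n => [|n]; first by split.
split=> //; split=> [p _|b]; first by split; [exact: derivable_id|exact: derivable_cst].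
rewrite (_ : pd b fst = cst (~~ b)%:R); first exact: smooth_upto_cst.
by apply/funext => p; rewrite /pd; case: b => /=; [rewrite derive1_cst|rewrite derive1_id].
Qed.

Lemma smooth_upto_snd n U : smooth_upto n U snd.
Proof.
have c p : {for p, continuous (snd : R * R -> R)} by exact: cvg_snd.
case: n => [|n]; first by split.
split=> //; split=> [p _|b]; first by split; [exact: derivable_cst|exact: derivable_id].
rewrite (_ : pd b snd = cst b%:R); first exact: smooth_upto_cst.
by apply/funext => p; rewrite /pd; case: b => /=; [rewrite derive1_id|rewrite derive1_cst].
Qed.

Lemma derive1_add (F G : R -> R) (x : R) : derivable F x 1 -> derivable G x 1 ->
  derivable (fun t => F t + G t) x 1 /\
  derive1 (fun t => F t + G t) x = derive1 F x + derive1 G x.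
Proof.
by move=> dF dG; split; [exact: derivableD|rewrite !derive1E; exact: deriveD].
Qed.

Lemma derive1_mul (F G : R -> R) (x : R) : derivable F x 1 -> derivable G x 1 ->
  derivable (fun t => F t * G t) x 1 /\
  derive1 (fun t => F t * G t) x = derive1 F x * G x + F x * derive1 G x.
Proof.
move=> dF dG; split; first exact: derivableM.
rewrite !derive1E (deriveM dF dG) /GRing.scale /= addrC; congr (_ + _).
by rewrite mulrC.
Qed.

Lemma smooth_upto_D n U f g : open U -> smooth_upto n U f -> smooth_upto n U g -> smooth_upto n U (fun p => f p + g p).
Proof.
move=> oU; elim: n f g => [|n IH] f g Sf Sg.
  by split=> // p Up; apply: cvgD; [exact: Sf.1|exact: Sg.1].
have [cf [df pf]] := Sf; have [cg [dg pg]] := Sg.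
split; first by move=> p Up; apply: cvgD; [exact: cf|exact: cg].
split=> [p Up|b].
  have [f1 f2] := df p Up; have [g1 g2] := dg p Up.
  by split; [exact: (derive1_add f1 g1).1|exact: (derive1_add f2 g2).1].
apply: smooth_upto_eq oU _ (IH _ _ (pf b) (pg b)) => p; rewrite inE => Up.
have [f1 f2] := df p Up; have [g1 g2] := dg p Up.
by case: b; rewrite /pd /=; apply/esym; [exact: (derive1_add f2 g2).2|exact: (derive1_add f1 g1).2].
Qed.

Lemma smooth_upto_M n U f g : open U -> smooth_upto n U f -> smooth_upto n U g -> smooth_upto n U (fun p => f p * g p).
Proof.
move=> oU; elim: n f g => [|n IH] f g Sf Sg.
  by split=> // p Up; apply: cvgM; [exact: Sf.1|exact: Sg.1].
have [cf [df pf]] := Sf; have [cg [dg pg]] := Sg.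
split; first by move=> p Up; apply: cvgM; [exact: cf|exact: cg].
split=> [p Up|b].
  have [f1 f2] := df p Up; have [g1 g2] := dg p Up.
  by split; [exact: (derive1_mul f1 g1).1|exact: (derive1_mul f2 g2).1].
have S1 := IH _ _ (pf b) (smooth_upto_le Sg); have S2 := IH _ _ (smooth_upto_le Sf) (pg b).
apply: smooth_upto_eq oU _ (smooth_upto_D oU S1 S2) => p; rewrite inE => Up.
have [f1 f2] := df p Up; have [g1 g2] := dg p Up.
case: p Up f1 f2 g1 g2 => x y Up /= f1 f2 g1 g2.
by case: b {S1 S2}; rewrite /pd /=; apply/esym; [exact: (derive1_mul f2 g2).2|exact: (derive1_mul f1 g1).2].
Qed.

(** A class stable under differentiation on [V]: all its members are smooth there, and no formula
    for higher derivatives is needed. *)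
Definition smooth1 (V : set R) (C : set (R -> R)) :=
  forall h, C h -> exists2 k, C k & forall t : R, V t -> is_derive t (1 : R) h (k t).

Lemma smooth_upto_comp n (V : set R) C U h f : open U -> smooth1 V C -> C h -> smooth_upto n U f ->
  (forall p, U p -> V (f p)) -> smooth_upto n U (fun p => h (f p)).
Proof.
move=> oU C1 + + fV; elim: n h f fV => [|n IH] h f fV Ch Sf.
  split=> // p Up; apply: continuous_comp; first exact: Sf.1.
  have [k _ dk] := C1 h Ch; have dkp := dk _ (fV p Up).
  by apply/differentiable_continuous/derivable1_diffP; apply: ex_derive.
have [cf [df pf]] := Sf; have [k Ck dk] := C1 h Ch.
have ch p : U p -> {for f p, continuous h}.
  move=> Up; have dkp := dk _ (fV p Up).
  by apply/differentiable_continuous/derivable1_diffP; apply: ex_derive.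
split; first by move=> p Up; apply: continuous_comp; [exact: cf|exact: ch].
have E (F : R -> R) (x : R) (d : R) : is_derive (F x) (1 : R) h d -> derivable F x 1 ->
    derivable (fun t => h (F t)) x 1 /\ derive1 (fun t => h (F t)) x = d * derive1 F x.
  move=> dh dF.
  have dF' : is_derive x (1 : R) F (derive1 F x) by rewrite derive1E; exact/derivableP.
  have dc := is_derive1_comp (g := F) dh dF'.
  have [dd de] : derivable (h \o F) x 1 /\ 'D_1 (h \o F) x = d * derive1 F x.
    by split; [apply: ex_derive|apply: derive_val].
  by split; [exact: dd|rewrite derive1E; exact: de].
split=> [p Up|b].
  have [f1 f2] := df p Up; case: p Up f1 f2 => x y Up /= f1 f2.
  by split; [exact: (E (fun t => f (t, y)) _ _ (dk _ (fV _ Up)) f1).1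
            |exact: (E (fun t => f (x, t)) _ _ (dk _ (fV _ Up)) f2).1].
have S1 := IH k f fV Ck (smooth_upto_le Sf).
apply: smooth_upto_eq oU _ (smooth_upto_M oU S1 (pf b)) => p; rewrite inE => Up.
have [f1 f2] := df p Up; case: p Up f1 f2 => x y Up /= f1 f2.
by case: b {S1}; rewrite /pd /=; apply/esym; [exact: (E (fun t => f (x, t)) _ _ (dk _ (fV _ Up)) f2).2
            |exact: (E (fun t => f (t, y)) _ _ (dk _ (fV _ Up)) f1).2].
Qed.

Lemma smooth_upto_smooth2 f : (forall n, smooth_upto n setT f) -> smooth2 f.
Proof.
move=> Sf s.
have Ss : forall n, smooth_upto n setT (iter_pd s f).
  by elim: s => [//|b s IH] n; have [_ [_ h]] := IH n.+1; exact: h.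
split; first by move=> p; have [c _] := Ss 0%N; exact: c.
by move=> p; have [_ [d _]] := Ss 1%N; exact: d.
Qed.

Lemma smooth1_inv : smooth1 [set t : R | 0 < t] [set h | exists q : {poly R}, h = fun t => q.[t^-1]].
Proof.
move=> _ [q ->]; exists (fun t => (- 'X^2 * q^`()).[t^-1]); first by exists (- 'X^2 * q^`()).
move=> t /= t0; have tn : t != 0 by rewrite gt_eqF.
have d1 := is_deriveV tn (is_derive_id t 1).
have d2 : is_derive (t^-1) (1 : R) (fun z => q.[z]) (q^`()).[t^-1] by exact: is_derive_poly.
apply: is_deriveE (is_derive1_comp d2 d1) _.
by rewrite hornerM hornerN hornerXn /GRing.scale /= mulr1 exprVn mulrC.
Qed.

Lemma smooth1_ln : smooth1 [set t : R | 0 < t]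
  [set h | h = @ln R \/ exists q : {poly R}, h = fun t => q.[t^-1]].
Proof.
move=> h [->|hq].
  exists (fun t => 'X.[t^-1]); first by right; exists 'X.
  by move=> t /= t0; rewrite hornerX; exact: is_derive1_ln.
by have [k hk dk] := smooth1_inv hq; exists k => //; right.
Qed.

End Smooth.

(** * A smooth approximation of the positive part *)

Section Flat.
Variables (R : realType) (del : R).
Hypothesis del0 : 0 < del.

(* [flat q] is the germ of a C^infty function vanishing for [t <= 0]; the family is
   closed under differentiation, which makes [ramp] smooth. *)
Definition expNV (t : R) : R := if 0 < t then expR (- (del / t)) else 0.
Definition flat (q : {poly R}) (t : R) : R := expNV t * q.[t^-1].
Definition ramp (t : R) : R := t * expNV t.

Lemma expNV_ge0 t : 0 <= expNV t.
Proof. by rewrite /expNV; case: ifP => // _; exact: expR_ge0. Qed.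

Lemma expNV_le0 t : t <= 0 -> expNV t = 0.
Proof. by rewrite /expNV leNgt => /negbTE ->. Qed.

(** One term of the exponential series, exp z >= z^(n+1) / (n+1)! at z = del / t, beats n powers of
    1/t and leaves a factor t. *)
Lemma expNV_bound n : exists2 C, 0 <= C & forall t, 0 < t -> expNV t * t^-1 ^+ n <= C * t.
Proof.
exists (n.+1`!%:R / del ^+ n.+1).
  by rewrite divr_ge0// exprn_ge0// ltW.
move=> t t0; rewrite /expNV t0 expRN.
have z0 : 0 <= del / t by rewrite divr_ge0// ltW.
have d0 : 0 < (del / t) ^+ n.+1 / n.+1`!%:R.
  by rewrite divr_gt0 ?exprn_gt0 ?divr_gt0// ltr0n fact_gt0.
have h : (del / t) ^+ n.+1 / n.+1`!%:R <= expR (del / t).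
  by have := expR_ge1Dxn n z0; lra.
apply: (@le_trans _ _ (((del / t) ^+ n.+1 / n.+1`!%:R)^-1 * t^-1 ^+ n)).
  by rewrite ler_wpM2r ?exprn_ge0 ?invr_ge0 ?(ltW t0)// lef_pV2// posrE ?expR_gt0.
rewrite le_eqVlt; apply/orP; left; apply/eqP.
have f0 : n.+1`!%:R != 0 :> R by rewrite pnatr_eq0 -lt0n fact_gt0.
have dn : del ^+ n.+1 != 0 by rewrite gt_eqF// exprn_gt0.
have tn : t ^+ n != 0 by rewrite gt_eqF// exprn_gt0.
have tn0 : t != 0 by rewrite gt_eqF.
rewrite expr_div_n (exprS t) exprVn; field.
by rewrite f0 dn tn tn0.
Qed.

Lemma flat_bound q : exists2 C, 0 <= C & forall t, 0 < t -> `|flat q t| <= C * t.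
Proof.
(* The additional power of 1/t makes the induction on [q] work: multiplication by ['X] raises it by
   one. *)
suff H n : exists2 C, 0 <= C & forall t, 0 < t -> `|flat q t * t^-1 ^+ n| <= C * t.
  have [C C0 h] := H 0%N; exists C => // t t0.
  by have := h t t0; rewrite expr0 mulr1.
elim/poly_ind: q n => [|q c IH] n.
  by exists 0 => // t t0; rewrite /flat horner0 mulr0 mul0r normr0 mul0r.
have [C1 C10 h1] := IH n.+1; have [C2 C20 h2] := expNV_bound n.
exists (C1 + `|c| * C2) => [|t t0]; first by rewrite addr_ge0// mulr_ge0.
have -> : flat (q * 'X + c%:P) t * t^-1 ^+ n =
    flat q t * t^-1 ^+ n.+1 + c * (expNV t * t^-1 ^+ n).
  by rewrite /flat hornerD hornerM hornerX hornerC exprS; ring.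
rewrite (le_trans (ler_normD _ _))// mulrDl lerD ?h1// normrM -mulrA ler_wpM2l//.
by rewrite ger0_norm ?h2// mulr_ge0 ?expNV_ge0// exprn_ge0// invr_ge0 (ltW t0).
Qed.

Lemma flat_le0 q t : t <= 0 -> flat q t = 0.
Proof. by move=> t0; rewrite /flat expNV_le0// mul0r. Qed.

Lemma flat_cont0 q : {for 0, continuous (flat q)}.
Proof.
have [C C0 h] := flat_bound q.
rewrite /prop_for /continuous_at flat_le0//.
apply/cvgrPdist_le => e e0.
have C1 : 0 < C + 1 by lra.
have ec : 0 < (C + 1)^-1 * e by rewrite mulr_gt0 ?invr_gt0.
near=> t; rewrite sub0r normrN.
have [t0|t0] := leP t 0; first by rewrite flat_le0// normr0 ltW.
apply: (le_trans (h t t0)).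
apply: (@le_trans _ _ ((C + 1) * t)); first by rewrite ler_wpM2r ?(ltW t0)//; lra.
rewrite -ler_pdivlMl//; apply: (le_trans (ler_norm t)).
near: t; exists ((C + 1)^-1 * e); first exact: ec.
by move=> z; rewrite /= sub0r normrN => /ltW.
Unshelve. all: by end_near. Qed.

(** Caratheodory's criterion at the origin, with a flat function as slope: it is continuous there
    with value 0. *)
Lemma is_derive_flat0 (f : R -> R) q : f 0 = 0 -> (forall t, f t = flat q t * t) ->
  is_derive (0 : R) (1 : R) f 0.
Proof.
move=> f0 fE; apply/is_derive1_caratheodory; exists (flat q); split.
- by move=> z; rewrite f0 !subr0 fE.
- exact: flat_cont0.
- by rewrite flat_le0.
Qed.

Lemma is_derive_expNV (t : R) : 0 < t -> is_derive t (1 : R) expNV (expNV t * (del / t ^+ 2)).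
Proof.
move=> t0; have tn : t != 0 by rewrite gt_eqF.
have d1 := is_deriveV tn (is_derive_id t 1).
have d2 : is_derive t (1 : R) (fun t => - (del / t)) (del / t ^+ 2).
  by apply: is_derive_eq; rewrite /GRing.scale /=; field.
have d3 := is_derive1_comp (g := fun t => - (del / t)) (is_derive_expR (- (del / t))) d2.
have E : expNV t = expR (- (del / t)) by rewrite /expNV t0.
rewrite E; apply: near_eq_is_derive d3.
near=> z; rewrite /expNV /=; have -> : 0 < z by near: z; exact: lt_nbhsr.
by [].
Unshelve. all: by end_near. Qed.

Lemma is_derive_flat q (t : R) : is_derive t (1 : R) (flat q)
  (flat ('X^2 * (del%:P * q - q^`())) t).
Proof.
case: (ltgtP t 0) => [t0|t0|->].
- rewrite [X in is_derive _ _ _ X]flat_le0 ?ltW//; apply: is_derive_near0.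
  near=> z; apply: flat_le0; apply: ltW; near: z; exact: lt_nbhsl.
- have tn : t != 0 by rewrite gt_eqF.
  have d0 := is_derive_expNV t0.
  have d1 := is_deriveV tn (is_derive_id t 1).
  have d2 : is_derive (t^-1) (1 : R) (fun z => q.[z]) (q^`()).[t^-1] by exact: is_derive_poly.
  have d3 := is_derive1_comp (g := fun z => z^-1) d2 d1.
  have -> : flat q = expNV * ((fun z => q.[z]) \o (fun z => z^-1)) by apply/funext.
  apply: is_derive_eq; rewrite /GRing.scale /= /flat.
  rewrite hornerM hornerXn hornerD hornerN hornerM hornerC; field.
  by [].
rewrite [X in is_derive _ _ _ X]flat_le0//; apply: (is_derive_flat0 (q := 'X * q)).
  by rewrite flat_le0.
move=> t0; rewrite /flat hornerM hornerX.
have [->|tn] := eqVneq t0 0; first by rewrite expNV_le0// !mul0r.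
by field.
Unshelve. all: by end_near. Qed.

Lemma is_derive_ramp (t : R) : is_derive t (1 : R) ramp (flat (1 + del%:P * 'X) t).
Proof.
case: (ltgtP t 0) => [t0|t0|->].
- rewrite flat_le0 ?ltW//; apply: is_derive_near0.
  near=> z; rewrite /ramp expNV_le0 ?mulr0//; apply: ltW; near: z; exact: lt_nbhsl.
- have tn : t != 0 by rewrite gt_eqF.
  have d0 := is_derive_expNV t0.
  rewrite /ramp; apply: is_derive_eq; rewrite /GRing.scale /= /flat.
  by rewrite hornerD hornerM !hornerC hornerX; field.
rewrite flat_le0//; apply: (is_derive_flat0 (q := 1)).
  by rewrite /ramp mul0r.
by move=> z; rewrite /flat hornerC mulr1 mulrC.
Unshelve. all: by end_near. Qed.

Lemma smooth1_ramp : smooth1 setT [set h | h = ramp \/ exists q, h = flat q].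
Proof.
move=> h [->|[q ->]].
  by exists (flat (1 + del%:P * 'X)); [right; exists (1 + del%:P * 'X)|move=> t _; exact: is_derive_ramp].
by exists (flat ('X^2 * (del%:P * q - q^`()))); [right; exists ('X^2 * (del%:P * q - q^`()))|move=> t _; exact: is_derive_flat].
Qed.

Lemma ramp_ge0 t : 0 <= ramp t.
Proof.
rewrite /ramp; have [t0|t0] := leP t 0; first by rewrite expNV_le0// mulr0.
by rewrite mulr_ge0 ?expNV_ge0// ltW.
Qed.

Lemma ramp_le0 t : t <= 0 -> ramp t = 0.
Proof. by move=> t0; rewrite /ramp expNV_le0// mulr0. Qed.

(** By 1 + z <= exp z at z = - del / t, the smoothing lowers the positive part by at most [del]. *)
Lemma ramp_ge t : t - del <= ramp t.
Proof.
have [t0|t0] := leP t 0; first by rewrite ramp_le0//; have := del0; lra.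
rewrite /ramp /expNV t0.
have := expR_ge1Dx (- (del / t)) => h.
have -> : t - del = t * (1 + - (del / t)) by field; rewrite gt_eqF.
by rewrite ler_wpM2l// ltW.
Qed.

(** For positive [t] the derivative is (1 + z) exp (- z) with z = del / t. Composition with [ramp]
    therefore never increases a gradient. *)
Lemma ramp'_bound t : 0 <= flat (1 + del%:P * 'X) t <= 1.
Proof.
have [t0|t0] := leP t 0; first by rewrite flat_le0// lexx ler01.
rewrite /flat hornerD hornerM !hornerC hornerX.
have z0 : 0 <= del / t by rewrite divr_ge0// ltW.
rewrite mulr_ge0 ?expNV_ge0 ?addr_ge0//= /expNV t0 expRN mulrC ler_pdivrMr ?expR_gt0// mul1r.
exact: expR_ge1Dx.
Qed.

End Flat.

(** * Integration of radial functions *)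

Section DiscArea.
Variable R : realType.
Local Notation mu := (@lebesgue_measure R).
Local Notation lam2 := (@lam2 R).

Lemma derive_oo_LR (F f : R -> R) (a b : R) :
  (forall x : R, is_derive x (1 : R) F (f x)) -> derivable_oo_LRcontinuous F a b.
Proof.
move=> dF; have dd x : derivable F x 1 by have := dF x => h; apply: ex_derive.
have cF : continuous F.
  by move=> x; apply/differentiable_continuous/derivable1_diffP.
split; first by move=> x _; exact: dd.
  exact: cvg_at_right_filter (cF a).
exact: cvg_at_left_filter (cF b).
Qed.

Lemma FTC (F f : R -> R) (a b : R) : a < b ->
  (forall x : R, is_derive x (1 : R) F (f x)) -> continuous f ->
  (\int[mu]_(x in `[a, b]) (f x)%:E)%E = (F b - F a)%:E.
Proof.
move=> ab dF cf.
rewrite (@continuous_FTC2 _ f F)// ?EFinB//.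
- exact: continuous_subspaceT.
- exact: derive_oo_LR dF.
- by move=> x _; rewrite derive1E; have := dF x => h; apply: derive_val.
Qed.

Definition disc (t : R) : set (R * R) := [set p | qf p <= t].

Lemma measurable_disc t : measurable (disc t).
Proof.
have -> : disc t = ~` [set p | t < qf p].
  by apply/seteqP; split => p; rewrite /disc /= leNgt => /negP.
apply: measurableC; apply: open_measurable2.
have -> : [set p | t < qf p] = (@qf R) @^-1` [set x | t < x] by [].
by apply: open_comp => [p _|]; [exact: continuous_qf|exact: open_gt].
Qed.

Lemma disc_slice (t x : R) :
  mu (xsection (disc t) x) = (2 * Num.sqrt (t - x ^+ 2))%:E.
Proof.
have [tx|tx] := ltP t (x ^+ 2).
  rewrite ler0_sqrtr ?mulr0; last by rewrite subr_le0 ltW.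
  rewrite (_ : xsection _ _ = set0) ?measure0//; apply/seteqP; split=> y //=.
  rewrite /xsection /= inE /disc /qf /= => h.
  by have := sqr_ge0 y; move: (x ^+ 2) (y ^+ 2) tx h => a b; lra.
have -> : xsection (disc t) x = [set` `[- Num.sqrt (t - x ^+ 2), Num.sqrt (t - x ^+ 2)]].
  apply/seteqP; split=> y; rewrite /xsection /= inE /disc /qf /= in_itv /=.
    move=> h; rewrite -ler_norml -(sqrtr_sqr y) ler_wsqrtr//.
    by move: (x ^+ 2) (y ^+ 2) h => a b; lra.
  rewrite -ler_norml => h.
  have : `|y| ^+ 2 <= Num.sqrt (t - x ^+ 2) ^+ 2 by rewrite ler_sqr ?nnegrE// sqrtr_ge0.
  rewrite sqr_sqrtr ?subr_ge0// real_normK ?num_real//.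
  by move: (x ^+ 2) (y ^+ 2) => a b; lra.
rewrite lebesgue_measure_itv /= lte_fin.
have := sqrtr_ge0 (t - x ^+ 2); move: (Num.sqrt _) => s s0.
by case: ltP => h; rewrite -?EFinB ?oppr0; congr (_%:E); lra.
Qed.

Lemma continuous_sqrtf (f : R -> R) : continuous f -> continuous (fun x => Num.sqrt (f x)).
Proof. by move=> cf x; apply: continuous_comp; [exact: cf|exact: sqrt_continuous]. Qed.

(** The integrand is the full chord, so the value is the area of the whole disc; [x = s * sin]
    reduces it to an integral of cos^2. *)
Lemma half_disc (s : R) : 0 < s ->
  (\int[mu]_(x in `[(- s)%R, s]) (2 * Num.sqrt (s ^+ 2 - x ^+ 2))%:E)%E = (pi * s ^+ 2)%:E.
Proof.
move=> s0; pose F x : R := s * sin x.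
have dF (x : R) : is_derive x (1 : R) F (s * cos x).
  by rewrite /F; apply: is_derive_eq; rewrite /GRing.scale /=; ring.
have F'E : derive1 F = fun x => s * cos x.
  by apply/funext => x; rewrite derive1E; have := dF x => h; apply: derive_val.
have cF' : continuous (fun x : R => s * cos x).
  by move=> x; apply: cvgM; [exact: cvg_cst|exact: continuous_cos].
have pi0 := @pi_gt0 R.
have Fb : F (pi / 2) = s by rewrite /F sin_pihalf mulr1.
have Fa : F (- (pi / 2)) = - s by rewrite /F sinN sin_pihalf mulrN1.
have := @integration_by_substitution_increasing R F
  (fun x => 2 * Num.sqrt (s ^+ 2 - x ^+ 2)) (- (pi / 2)) (pi / 2).
rewrite Fa Fb => ->; first last.
- apply: continuous_subspaceT; move=> x; apply: cvgM; first exact: cvg_cst.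
  apply: (@continuous_sqrtf (fun y => s ^+ 2 - y ^+ 2)) => y.
  apply: cvgB; [exact: cvg_cst|exact: cvgXn].
- exact: derive_oo_LR dF.
- by rewrite F'E; apply/cvg_ex; eexists; exact: cvg_at_left_filter (cF' _).
- by rewrite F'E; apply/cvg_ex; eexists; exact: cvg_at_right_filter (cF' _).
- by rewrite F'E => x _; exact: cF'.
- by move=> x y xab yab xy; rewrite /F ltr_pM2l// ltr_sin.
- lra.
transitivity (\int[mu]_(x in `[(- (pi / 2))%R, (pi / 2)%R]) (2 * s ^+ 2 * cos x ^+ 2)%:E)%E.
  apply: eq_integral => x; rewrite inE /= in_itv /= => xab; congr (_%:E).
  rewrite fctE /= F'E /F; have -> : s ^+ 2 - (s * sin x) ^+ 2 = (s * cos x) ^+ 2.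
    by rewrite !exprMn cos2sin2; ring.
  rewrite sqrtr_sqr ger0_norm; first by ring.
  by rewrite mulr_ge0 ?(ltW s0)// cos_ge0_pihalf.
have dG (x : R) : is_derive x (1 : R) (fun x => s ^+ 2 * (x + sin x * cos x)) (2 * s ^+ 2 * cos x ^+ 2).
  apply: is_derive_eq; rewrite /GRing.scale /=.
  have -> : sin x * - sin x + cos x * cos x = 2 * cos x ^+ 2 - 1 by have := sin2cos2 x; rewrite !expr2; lra.
  by ring.
rewrite (FTC _ dG); first last.
- by move=> x; apply: cvgM; [exact: cvg_cst|apply: cvgXn; exact: continuous_cos].
- lra.
- rewrite sinN cosN sin_pihalf cos_pihalf; congr (_%:E); move: (@pi R) => q; by field.
Qed.

Lemma disc_area (t : R) : 0 <= t -> lam2 (disc t) = (pi * t)%:E.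
Proof.
move=> t0; rewrite /lam2 /product_measure1 /=.
under eq_integral do rewrite disc_slice.
have [->|tn] := eqVneq t 0.
  rewrite mulr0; apply: integral0_eq => x _.
  by rewrite ler0_sqrtr ?mulr0// sub0r oppr_le0 sqr_ge0.
have {t0 tn} t0 : 0 < t by rewrite lt_neqAle eq_sym tn.
have s0 : 0 < Num.sqrt t by rewrite sqrtr_gt0.
rewrite -[in RHS](sqr_sqrtr (ltW t0)) -half_disc// sqr_sqrtr ?(ltW t0)//.
rewrite [RHS]integral_mkcond; apply: eq_integral => x _; rewrite /patch.
case: ifPn => //; rewrite notin_setE /= in_itv /= -ler_norml => /negP; rewrite -ltNge => h.
rewrite ler0_sqrtr ?mulr0// subr_le0.
rewrite -(sqr_sqrtr (ltW t0)) -(real_normK (num_real x)) ler_sqr ?nnegrE ?(ltW h)// ltW.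
Qed.

Lemma measurable_qf : measurable_fun setT (@qf R).
Proof. exact: continuous_measurable2 (@continuous_qf R). Qed.

Lemma disc_max (t : R) : lam2 (disc t) = (pi * Num.max t 0)%:E.
Proof.
have [t0|t0] := leP 0 t; first by rewrite disc_area.
rewrite mulr0 (_ : disc t = set0) /lam2 ?measure0//; apply/seteqP; split=> p //=.
rewrite /disc /= => h; have : 0 <= qf p by rewrite /qf addr_ge0// sqr_ge0.
by move: (qf p) h => a; lra.
Qed.

(** Linearity in the endpoints is what recommends the variable q = r^2. The maxima cover intervals
    reaching below 0, which occur when a measure on the whole line is identified. *)
Lemma ring_area (a b : R) : a <= b ->
  lam2 ((@qf R) @^-1` [set` `]a, b]]) = (pi * (Num.max b 0 - Num.max a 0))%:E.
Proof.
move=> ab; have -> : (@qf R) @^-1` [set` `]a, b]] = disc b `\` disc a.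
  apply/seteqP; split => p /=; rewrite in_itv /= /disc /=.
    by move=> /andP[h1 h2]; split => //; apply/negP; rewrite -ltNge.
  by move=> [h1 /negP]; rewrite -ltNge => -> /=.
have D1 : (mu \x mu)%E (disc a) = _ := disc_max a.
have D2 : (mu \x mu)%E (disc b) = _ := disc_max b.
rewrite /lam2 measureD; [|exact: measurable_disc|exact: measurable_disc|by rewrite [X in (X < _)%E]D2 ltry].
rewrite setIidr; first by rewrite mulrBr EFinB; congr (_ - _)%E.
move=> p; rewrite /disc /= => h; exact: le_trans h ab.
Qed.

Let qR : R * R -> measurableTypeR R := @qf R.
Let mqR : measurable_fun setT qR. Proof. exact: measurable_qf. Qed.
Let push : {measure set (measurableTypeR R) -> \bar R} :=
  measure_function_pushforward__canonical__measure_function_Measure (mu \x mu)%E mqR.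

Let pi1 : {nonneg R} := NngNum (ltW (@pi_gt0 R)).
Let pi2 : {nonneg R} := NngNum (eqbRL (invr_ge0 _) (ltW (@pi_gt0 R))).

Let N0 : set (measurableTypeR R) := [set` `]-oo, (0 : R)]].
Let mN0 : measurable N0. Proof. exact: measurable_itv. Qed.

Let lower : {measure set (measurableTypeR R) -> \bar R} := mrestr mu mN0.
Let scaled : {measure set (measurableTypeR R) -> \bar R} := mscale pi2 push.
Let total : {measure set (measurableTypeR R) -> \bar R} := measure_add scaled lower.

Let totalE A : total A = ((pi^-1)%:E * lam2 (@qf R @^-1` A) + mu (A `&` N0))%E.
Proof. exact: measure_addE. Qed.

(* [lower] is Lebesgue measure on the nonpositive axis, where the pushforward
   of the plane vanishes; it is added to compare measures on the whole line. *)
Lemma total_lebesgue A : measurable A -> mu A = total A.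
Proof.
move=> mA; apply: lebesgue_measure_unique => // _ [[a b] _ <-].
rewrite totalE [LHS]lebesgue_measure_itv /= lte_fin.
have [ab|ba] := ltP a b; last first.
  have e : [set` `]a, b]] = set0.
    by apply/seteqP; split=> x //=; rewrite in_itv /= => /andP[h1 h2]; move: (lt_le_trans h1 h2); rewrite ltNge ba.
  by rewrite e preimage_set0 set0I /lam2 !measure0 mule0 adde0.
rewrite (ring_area (ltW ab)).
have -> : [set` `]a, b]] `&` N0 = [set` `]a, Num.min b 0]].
  apply/seteqP; split => x; rewrite /N0 /= !in_itv /= le_min.
    by move=> [/andP[-> ->] ->].
  by move=> /andP[-> /andP[-> ->]].
rewrite lebesgue_measure_itv /= lte_fin -EFinM mulKf ?gt_eqF ?pi_gt0//.
have [b0|b0] := leP b 0; have [a0|a0] := leP a 0; case: ltP => h;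
  rewrite ?addr0 ?adde0 -?EFinD -?EFinB; congr (_%:E); lra.
Qed.

Lemma push_pos (A : set (measurableTypeR R)) : measurable A -> A `<=` [set x : R | 0 < x] ->
  push A = mscale pi1 mu A.
Proof.
move=> mA A0; rewrite /mscale /= total_lebesgue// totalE.
have -> : A `&` N0 = set0.
  by apply/seteqP; split=> x //= [/A0 /=]; rewrite /N0 /= in_itv /= ltNge => /negP.
rewrite measure0 adde0 muleA -EFinM /= mulfV ?mul1e//.
by rewrite gt_eqF// pi_gt0.
Qed.

Lemma radial_integral (H : R -> R) (D : set R) : measurable D ->
  D `<=` [set x : R | 0 < x] -> measurable_fun D H -> (forall x, D x -> 0 <= H x) ->
  (\int[lam2]_(p in (@qf R) @^-1` D) (H (qf p))%:E)%E = (pi%:E * \int[mu]_(x in D) (H x)%:E)%E.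
Proof.
move=> mD D0 mH H0.
transitivity (\int[push]_(x in D) (H x)%:E)%E.
  have h1 : measurable_fun D (fun x => (H x)%:E) by exact/measurable_EFinP.
  have h2 : {in D, forall x, 0 <= (H x)%:E}%E by move=> x; rewrite inE => Dx; rewrite lee_fin H0.
  exact: (esym (@ge0_integral_pushforward _ _ (measurableTypeR R * measurableTypeR R)%type
    (measurableTypeR R) R qR mqR (mu \x mu)%E D _ mD h1 h2)).
rewrite -(@ge0_integral_mscale _ _ _ mu D mD pi1 (fun x => (H x)%:E)).
- apply: eq_measure_integral => A mA AD.
  by apply: push_pos => // x /AD /D0.
- exact/measurable_EFinP.
- by move=> x Dx; rewrite lee_fin H0.
Qed.

End DiscArea.

(** * The torsion function of the annulus *)

Section Torsion.
Variable R : realType.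
Local Notation mu := (@lebesgue_measure R).

Lemma FTC_pos (F f : R -> R) (a b : R) : 0 < a -> a < b ->
  (forall x : R, 0 < x -> is_derive x (1 : R) F (f x)) ->
  (forall x : R, 0 < x -> {for x, continuous f}) ->
  (\int[mu]_(x in `]a, b[) (f x)%:E)%E = (F b - F a)%:E.
Proof.
move=> a0 ab dF cf.
have cwf : {within `[a, b], continuous f}.
  apply/continuous_within_itvP => //; split=> [x| |].
  - by rewrite in_itv /= => /andP[ax _]; apply: cf; lra.
  - by apply: cvg_at_right_filter; exact: cf.
  - by apply: cvg_at_left_filter; apply: cf; lra.
have cF x : 0 < x -> {for x, continuous F}.
  move=> x0; apply/differentiable_continuous/derivable1_diffP.
  by have h := dF x x0; apply: ex_derive.
have mf : measurable_fun `]a, b[ (fun x => (f x)%:E).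
  apply/measurable_EFinP; apply: measurable_funS (subspace_continuous_measurable_fun _ cwf) => //.
  exact: subset_itv_oo_cc.
have := @integral_itv_bndoo R a b _ true false mf => <-.
rewrite (@continuous_FTC2 _ f F)// ?EFinB//.
- split=> [x|  |].
  + by rewrite in_itv /= => /andP[ax _]; have h := dF x (lt_trans a0 ax); apply: ex_derive.
  + by apply: cvg_at_right_filter; exact: cF.
  + by apply: cvg_at_left_filter; apply: cF; lra.
- move=> x; rewrite in_itv /= => /andP[ax _].
  by rewrite derive1E; have h := dF x (lt_trans a0 ax); apply: derive_val.
Qed.

(** With q = |x|^2 the first summand has Laplacian -1 and the logarithm is harmonic; both vanish on
    the inner circle. *)
Definition Vf (c q : R) : R := (1 - q) / 4 + c * ln q.
Definition Vf' (c q : R) : R := - 4^-1 + c / q.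

Lemma is_derive_Vf (c q : R) : 0 < q -> is_derive q (1 : R) (Vf c) (Vf' c q).
Proof.
move=> q0; have dl := is_derive1_ln q0.
rewrite /Vf /Vf'; apply: is_derive_eq; rewrite /GRing.scale /=; field.
by rewrite gt_eqF.
Qed.

(* [primi] is the coefficient of [ln q ^+ i] in an antiderivative of [Vf c q ^+ 4]. *)
Definition prim0 (c q : R) : R := ((1 / 256) + (-1 / 16) * c + (3 / 4) * c ^+ 2 + -6 * c ^+ 3 + 24 * c ^+ 4 + ((-1 / 128) + (3 / 64) * c + (-3 / 16) * c ^+ 2 + (3 / 8) * c ^+ 3 + ((1 / 128) + (-1 / 48) * c + (1 / 36) * c ^+ 2 + ((-1 / 256) + (1 / 256) * c + (1 / 1280) * q) * q) * q) * q) * q.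
Definition prim1 (c q : R) : R := ((1 / 16) * c + (-3 / 4) * c ^+ 2 + 6 * c ^+ 3 + -24 * c ^+ 4 + ((-3 / 32) * c + (3 / 8) * c ^+ 2 + (-3 / 4) * c ^+ 3 + ((1 / 16) * c + (-1 / 12) * c ^+ 2 + ((-1 / 64) * c) * q) * q) * q) * q.
Definition prim2 (c q : R) : R := ((3 / 8) * c ^+ 2 + -3 * c ^+ 3 + 12 * c ^+ 4 + ((-3 / 8) * c ^+ 2 + (3 / 4) * c ^+ 3 + ((1 / 8) * c ^+ 2) * q) * q) * q.
Definition prim3 (c q : R) : R := (c ^+ 3 + -4 * c ^+ 4 + ((-1 / 2) * c ^+ 3) * q) * q.
Definition prim4 (c q : R) : R := (c ^+ 4) * q.

Definition primV4 (c q : R) : R := prim0 c q + ln q * (prim1 c q + ln q *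
  (prim2 c q + ln q * (prim3 c q + ln q * prim4 c q))).

Lemma is_derive_primV4 (c q : R) : 0 < q ->
  is_derive q (1 : R) (primV4 c) (Vf c q ^+ 4).
Proof.
move=> q0; have dl := is_derive1_ln q0.
rewrite /primV4 /Vf /prim0 /prim1 /prim2 /prim3 /prim4.
apply: is_derive_eq; rewrite /GRing.scale /=.
move: (ln q) => l; have qn : q != 0 by rewrite gt_eqF.
by field.
Qed.

(** The integrand behind it, 4 q V'(q)^2, is the squared gradient of V (|x|^2). *)
Definition primG (c q : R) : R := q ^+ 2 / 8 - 2 * c * q + 4 * c ^+ 2 * ln q.

Lemma is_derive_primG (c q : R) : 0 < q ->
  is_derive q (1 : R) (primG c) (4 * q * Vf' c q ^+ 2).
Proof.
move=> q0; have dl := is_derive1_ln q0.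
rewrite /primG /Vf'; apply: is_derive_eq; rewrite /GRing.scale /=; field.
by rewrite gt_eqF.
Qed.

Lemma continuous_Vf (c q : R) : 0 < q -> {for q, continuous (Vf c)}.
Proof.
move=> q0; apply/differentiable_continuous/derivable1_diffP.
by have h := is_derive_Vf c q0; apply: ex_derive.
Qed.

Lemma continuous_Vf' (c q : R) : 0 < q -> {for q, continuous (Vf' c)}.
Proof.
move=> q0; apply: cvgD; first exact: cvg_cst.
by apply: cvgM; [exact: cvg_cst|apply: cvgV; rewrite ?gt_eqF].
Qed.

Lemma continuous_V4 (c q : R) : 0 < q -> {for q, continuous (fun q : R => Vf c q ^+ 4)}.
Proof. by move=> q0; apply: cvgXn; exact: continuous_Vf. Qed.

Lemma continuous_G (c q : R) : 0 < q -> {for q, continuous (fun q : R => 4 * q * Vf' c q ^+ 2)}.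
Proof.
move=> q0; apply: cvgM; first by apply: cvgM; [exact: cvg_cst|exact: cvg_id].
by apply: cvgXn; exact: continuous_Vf'.
Qed.

Section Rad.
Variable Rad : R.
Hypothesis Rad1 : 1 < Rad.
Let L : R := ln Rad.
(** The coefficient for which the torsion function also vanishes on the outer circle. *)
Definition cT : R := (Rad ^+ 2 - 1) / (8 * ln Rad).

Lemma L_gt0 : 0 < L. Proof. exact: ln_gt0. Qed.

Lemma lnRad2 : ln (Rad ^+ 2) = 2 * L.
Proof.
have r0 : 0 < Rad := lt_trans ltr01 Rad1.
by rewrite expr2 lnM ?posrE// -/L; ring.
Qed.

(** The origin of [kappa1]: up to this denominator it is the integral of V^4 in the variable q. The
    fourth power of [L] comes from that of [cT]. *)
Lemma primV4_Rad : primV4 cT (Rad ^+ 2) - primV4 cT 1 = kappa1 Rad / ((512 * 360) * L ^+ 4).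
Proof.
have L0 := L_gt0; have Ln : L != 0 by rewrite gt_eqF.
rewrite /primV4 /prim0 /prim1 /prim2 /prim3 /prim4 lnRad2 ln1 /cT /kappa1 -/L.
by move: L Ln => l Ln; field.
Qed.

Lemma primG_Rad : primG cT (Rad ^+ 2) - primG cT 1 =
  (Rad ^+ 2 - 1) * ((Rad ^+ 2 + 1) * L + 1 - Rad ^+ 2) / (8 * L).
Proof.
have L0 := L_gt0; have Ln : L != 0 by rewrite gt_eqF.
rewrite /primG lnRad2 ln1 /cT -/L.
by move: L Ln => l Ln; field.
Qed.

End Rad.
End Torsion.

(** * The upper bound for S_4 *)

Section Upper.
Variable R : realType.
Local Notation mu := (@lebesgue_measure R).
Local Notation lam2 := (@lam2 R).

Lemma Vf_slope (c x y : R) : 0 < x -> x < y ->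
  exists2 z, x < z < y & Vf c y - Vf c x = Vf' c z * (y - x).
Proof.
move=> x0 xy; have [z||z] := @MVT R (Vf c) (Vf' c) x y xy.
- by rewrite in_itv /= => /andP[xz _]; apply: is_derive_Vf; apply: lt_trans xz.
- apply/continuous_within_itvP => //; split=> [z| |].
  + by rewrite in_itv /= => /andP[xz _]; apply: continuous_Vf; apply: lt_trans xz.
  + by apply: cvg_at_right_filter; exact: continuous_Vf.
  + by apply: cvg_at_left_filter; apply: continuous_Vf; apply: lt_trans xy.
by rewrite in_itv /= => h e; exists z.
Qed.

(** The derivative decreases strictly. Together with the zeros at 1 and Rad^2, this fixes the sign
    of V on the positive axis. *)
Lemma Vf_concave (c x y z : R) : 0 < c -> 0 < x -> x < y -> y < z ->
  Vf c x * (z - y) + Vf c z * (y - x) < Vf c y * (z - x).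
Proof.
move=> c0 x0 xy yz; have y0 : 0 < y := lt_trans x0 xy.
have [s /andP[xs sy] es] := Vf_slope c x0 xy.
have [t /andP[yt tz] et] := Vf_slope c y0 yz.
have s0 : 0 < s := lt_trans x0 xs.
have st : s < t := lt_trans sy yt.
have ds : Vf' c t < Vf' c s.
  by rewrite /Vf' ltrD2l ltr_pM2l// ltf_pV2// posrE// (lt_trans s0).
move: (Vf' c t) (Vf' c s) es et ds => a b es et ds.
have p1 : 0 < (y - x) * (z - y) by rewrite mulr_gt0// subr_gt0.
have : 0 < (b - a) * ((y - x) * (z - y)) by rewrite mulr_gt0// subr_gt0.
have -> : (b - a) * ((y - x) * (z - y)) =
  (b * (y - x)) * (z - y) - (a * (z - y)) * (y - x) by ring.
rewrite -es -et; move: (Vf c x) (Vf c y) (Vf c z) => u v w.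
have -> : (v - u) * (z - y) - (w - v) * (y - x) = v * (z - x) - (u * (z - y) + w * (y - x)) by ring.
by rewrite subr_gt0.
Qed.

(** For [V >= 2 * e] the expansion of (V - 2 e)^4 exceeds V^4 - 8 e V^3 by a nonnegative remainder;
    for smaller [V] the error term alone suffices. *)
Lemma fourth_power_ge (V w e B : R) : 0 <= V -> V <= B -> 0 <= e -> 0 <= w -> V - 2 * e <= w ->
  V ^+ 4 <= w ^+ 4 + 8 * e * B ^+ 3.
Proof.
move=> V0 VB e0 w0 h.
have V3 : V ^+ 3 <= B ^+ 3 by rewrite lerXn2r// nnegrE (le_trans V0).
have h2 : 8 * e * V ^+ 3 <= 8 * e * B ^+ 3 by rewrite ler_wpM2l// mulr_ge0.
apply: (@le_trans _ _ (w ^+ 4 + 8 * e * V ^+ 3)); last by rewrite lerD2l.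
have [e2|e2] := leP (2 * e) V.
  have : (V - 2 * e) ^+ 4 <= w ^+ 4 by rewrite lerXn2r// nnegrE; lra.
  have : 0 <= 8 * e ^+ 2 * (V ^+ 2 + 2 * (V - e) ^+ 2).
    apply: mulr_ge0; first by apply: mulr_ge0; [by []|exact: sqr_ge0].
    by apply: addr_ge0; [exact: sqr_ge0|apply: mulr_ge0; [by []|exact: sqr_ge0]].
  have -> : 8 * e ^+ 2 * (V ^+ 2 + 2 * (V - e) ^+ 2) = (V - 2 * e) ^+ 4 - (V ^+ 4 - 8 * e * V ^+ 3) by ring.
  lra.
have : 0 <= w ^+ 4 by rewrite exprn_ge0.
have : V ^+ 4 <= 8 * e * V ^+ 3.
  by rewrite exprS ler_wpM2r ?exprn_ge0//; lra.
lra.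
Qed.

(** * Smoothed torsion functions and their Rayleigh quotients *)

Section Test.
Variables (Rad eps : R).
Hypotheses (R1 : 1 < Rad) (e0 : 0 < eps).
Let D := annulus Rad.
Let c := cT Rad.
Let b := Rad ^+ 2.
Local Notation V := (Vf c).

Lemma b_gt1 : 1 < b.
Proof. by rewrite /b -(expr1n R 2) ltr_pXn2r// nnegrE// ltW// (lt_trans _ R1). Qed.

Lemma cT_gt0 : 0 < c.
Proof.
have L0 := L_gt0 R1; have := b_gt1; rewrite /b /c /cT => h.
by rewrite divr_gt0 ?subr_gt0// mulr_gt0.
Qed.

Lemma Vf_1 : V 1 = 0.
Proof. by rewrite /Vf ln1 subrr mul0r mulr0 addr0. Qed.

Lemma Vf_b : V b = 0.
Proof.
have L0 := L_gt0 R1; have Ln : ln Rad != 0 by rewrite gt_eqF.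
by rewrite /Vf /b lnRad2// /c /cT; move: (ln Rad) Ln => l Ln; field.
Qed.

Lemma Vf_gt0 q : 1 < q -> q < b -> 0 < V q.
Proof.
move=> q1 qb; have := Vf_concave cT_gt0 ltr01 q1 qb; rewrite -/c Vf_1 Vf_b !mul0r addr0.
by rewrite pmulr_lgt0// subr_gt0 b_gt1.
Qed.

Lemma Vf_le0 q : 0 < q -> q <= 1 \/ b <= q -> V q <= 0.
Proof.
have b1 := b_gt1.
move=> q0 [|]; rewrite le_eqVlt => /predU1P[qE|h].
- by rewrite qE Vf_1.
- have := Vf_concave cT_gt0 q0 h b1; rewrite -/c Vf_1 Vf_b !mul0r addr0.
  by rewrite pmulr_llt0 ?subr_gt0// => /ltW.
- by rewrite -qE Vf_b.
have := Vf_concave cT_gt0 ltr01 b1 h; rewrite -/c Vf_1 Vf_b !mul0r add0r.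
by rewrite pmulr_llt0 ?subr_gt0 ?(lt_trans b1 h)// => /ltW.
Qed.

(** Equal to c * ln b, since V vanishes at b. *)
Definition VB : R := (b - 1) / 4.

Lemma Vf_le q : 1 <= q -> q <= b -> V q <= VB.
Proof.
move=> q1 qb; have := Vf_b; rewrite /Vf /VB => h.
have : c * ln q <= c * ln b.
  by rewrite ler_pM2l ?cT_gt0// ler_ln// posrE; lra.
lra.
Qed.

(* Smoothing of the positive part of the torsion function minus [eps]. The guard
   only avoids the junk value of [ln] at [0]. *)
Definition vT (p : R * R) : R := if 2^-1 < qf p then ramp eps (V (qf p) - eps) else 0.

Let U1 : set (R * R) := [set p | 2^-1 < qf p].
Let U2 : set (R * R) := [set p | qf p < 1].

Let oU1 : open U1.
Proof.
have -> : U1 = (@qf R) @^-1` [set x | 2^-1 < x] by [].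
by apply: open_comp => [p _|]; [exact: continuous_qf|exact: open_gt].
Qed.

Let oU2 : open U2.
Proof.
have -> : U2 = (@qf R) @^-1` [set x | x < 1] by [].
by apply: open_comp => [p _|]; [exact: continuous_qf|exact: open_lt].
Qed.

Lemma smooth_upto_qf n U : open U -> smooth_upto n U (@qf R).
Proof.
move=> oU; have := smooth_upto_D oU (smooth_upto_M oU (smooth_upto_fst n U) (smooth_upto_fst n U)) (smooth_upto_M oU (smooth_upto_snd n U) (smooth_upto_snd n U)).
by apply: smooth_upto_eq => // p _; rewrite /qf !expr2.
Qed.

Lemma smooth_vT : smooth2 vT.
Proof.
apply: smooth_upto_smooth2 => n.
(* On the overlap 1/2 < q < 1 the torsion function is nonpositive, so [ramp] already vanishes: the
   function is zero on all of [U2], and on [U1] it is a composition of smooth maps. *)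
have -> : setT = U1 `|` U2.
  apply/seteqP; split=> p // _; have [h|h] := ltP (2^-1) (qf p); first by left.
  by right; rewrite /U2 /=; lra.
apply: smooth_upto_setU; last first.
  apply: smooth_upto_eq oU2 _ (smooth_upto_cst n U2 0) => p; rewrite inE /U2 /vT /= => h.
  case: ifP => // h2; rewrite ramp_le0//.
  have := @Vf_le0 (qf p); move: (qf p) h h2 => q h h2 H.
  by have := H _ (or_introl (ltW h)); have := e0; lra.
have q0 p : U1 p -> [set t : R | 0 < t] (qf p) by rewrite /U1 /= => h; lra.
have Sl := smooth_upto_comp oU1 (@smooth1_ln R) (or_introl erefl) (smooth_upto_qf n oU1) q0.
have S1 := smooth_upto_D oU1 (smooth_upto_M oU1 (smooth_upto_cst n U1 (- 4^-1)) (smooth_upto_qf n oU1)) (smooth_upto_M oU1 (smooth_upto_cst n U1 c) Sl).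
have S2 := smooth_upto_D oU1 S1 (smooth_upto_cst n U1 (4^-1 - eps)).
have := smooth_upto_comp oU1 (smooth1_ramp e0) (or_introl erefl) S2 (fun _ _ => I).
apply: smooth_upto_eq => // p; rewrite inE /U1 /vT /= => ->; congr (ramp _ _).
by rewrite /Vf; field.
Qed.

Lemma vT_ge0 p : 0 <= vT p.
Proof. by rewrite /vT; case: ifP => // _; exact: ramp_ge0. Qed.

Lemma vT_ge p : D p -> V (qf p) - 2 * eps <= vT p.
Proof.
rewrite /D annulusE// /= => /andP[h1 h2].
rewrite /vT ifT; last by lra.
by have := ramp_ge e0 (V (qf p) - eps); lra.
Qed.

(** The superlevel set of V at [eps], which avoids both circles because V is 0 there. The maximum
    keeps the argument of V where [ln] is continuous, so that closedness is immediate. *)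
Let K : set (R * R) := [set p | [/\ 1 <= qf p, qf p <= b & eps <= V (Num.max 1 (qf p))]].

Let KD : K `<=` D.
Proof.
move=> p [h1 h2 h3]; rewrite /D annulusE//= -/b.
have [e|n1] := eqVneq (qf p) 1.
  by move: h3; rewrite e maxxx Vf_1 => h3; have := e0; lra.
have [e|nb] := eqVneq (qf p) b.
  by move: h3; rewrite max_r// e Vf_b => h3; have := e0; lra.
by rewrite !lt_neqAle h1 h2 nb eq_sym n1.
Qed.

Let K0 p : ~ K p -> vT p = 0.
Proof.
move=> nK; rewrite /vT; case: ifP => // h; apply: ramp_le0.
have q0 : 0 < qf p by lra.
have [h1|h1] := leP (qf p) 1; first by have := Vf_le0 q0 (or_introl h1); have := e0; lra.
have [h2|h2] := leP b (qf p); first by have := Vf_le0 q0 (or_intror h2); have := e0; lra.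
have [h3|h3] := leP eps (V (qf p)); last by lra.
by exfalso; apply: nK; split; [exact: ltW|exact: ltW|rewrite max_r// ltW].
Qed.

Let cK : compact K.
Proof.
have cg : continuous (fun p : R * R => V (Num.max 1 (qf p))).
  move=> p; apply: (@continuous_comp _ _ _ (fun p => Num.max 1 (qf p)) V).
    by apply: (@continuous_max R _ (cst 1) (@qf R) p); [exact: cvg_cst|exact: continuous_qf].
  by apply: continuous_Vf; rewrite lt_max ltr01.
have clK : closed K.
  have -> : K = ((@qf R) @^-1` [set x | 1 <= x] `&` (@qf R) @^-1` [set x | x <= b]) `&`
     (fun p => V (Num.max 1 (qf p))) @^-1` [set x | eps <= x].
    by apply/seteqP; split=> p /= => [[]|[[]]].
  apply: closedI; first apply: closedI.
  - by apply: closed_comp => [p _|]; [exact: continuous_qf|exact: closed_ge].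
  - by apply: closed_comp => [p _|]; [exact: continuous_qf|exact: closed_le].
  - by apply: closed_comp => [p _|]; [exact: cg|exact: closed_ge].
apply: (subclosed_compact clK (compact_setX (@segment_compact R (- Rad) Rad) (@segment_compact R (- Rad) Rad))).
move=> p /KD /annulus_box[h1 h2]; split; rewrite /= in_itv /= -ler_norml//.
Qed.

Lemma test_vT : test_fun D vT.
Proof. by split; [exact: smooth_vT|exists K; split; [exact: cK|exact: KD|exact: K0]]. Qed.

Lemma H10_test (u : R * R -> R) : test_fun D u -> H10 D u (pd false u) (pd true u).
Proof.
move=> tu; have [smu _] := tu.
have mc (f : R * R -> R) : continuous f -> measurable_fun D f.
  by move=> cf; apply: measurable_funS (continuous_measurable2 cf).
split.
- apply: mc; exact: (smu [::]).1.
- apply: mc; exact: (smu [:: false]).1.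
- apply: mc; exact: (smu [:: true]).1.
have z (f : R * R -> R) : (L2dist2 D f f @[n --> \oo] --> 0%E).
  rewrite (_ : L2dist2 D f f = 0%E); first exact: cvg_cst.
  by apply: integral0_eq => x _; rewrite subrr expr0n.
by exists (fun=> u); split => // n; exact: z.
Qed.

Lemma pd_vT p : D p ->
  pd false vT p ^+ 2 + pd true vT p ^+ 2 <= 4 * qf p * Vf' c (qf p) ^+ 2.
Proof.
move=> Dp; have /andP[h1 h2] : 1 < qf p < Rad ^+ 2 by move: Dp; rewrite /D annulusE.
pose f p := ramp eps (V (qf p) - eps).
have fE : {in U1, vT =1 f} by move=> z; rewrite inE /U1 /vT /= => ->.
have Up : U1 p by rewrite /U1 /=; lra.
rewrite !(pd_eq _ oU1 fE Up).
have q0 : 0 < qf p by lra.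
have E (F : R -> R) (x d : R) : F x = qf p -> is_derive x (1 : R) F d ->
    derive1 (fun t => ramp eps (V (F t) - eps)) x =
    flat eps (1 + eps%:P * 'X) (V (qf p) - eps) * (Vf' c (qf p) * d).
  move=> Fx dF.
  have d1 : is_derive (F x) (1 : R) (fun q => V q - eps) (Vf' c (qf p)).
    rewrite Fx; have dv := is_derive_Vf c q0.
    by apply: is_derive_eq; rewrite subr0.
  have d2 := is_derive1_comp (g := F) d1 dF.
  have d3 := is_derive_ramp e0 (V (F x) - eps).
  have d4 := is_derive1_comp (g := (fun q => V q - eps) \o F) d3 d2.
  rewrite derive1E; have := @derive_val _ _ _ _ _ _ _ d4; rewrite Fx; exact.
case: p Dp h1 h2 Up q0 E => x y Dp h1 h2 Up q0 E.
rewrite /pd /f /=.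
have dx : is_derive x (1 : R) (fun t => qf (t, y)) (2 * x).
  by rewrite /qf /=; apply: is_derive_eq; rewrite /GRing.scale /=; ring.
have dy : is_derive y (1 : R) (fun t => qf (x, t)) (2 * y).
  by rewrite /qf /=; apply: is_derive_eq; rewrite /GRing.scale /=; ring.
rewrite (E (fun t => qf (t, y)) _ _ erefl dx) (E (fun t => qf (x, t)) _ _ erefl dy).
have /andP[s0 s1] := ramp'_bound e0 (V (qf (x, y)) - eps).
move: (flat _ _ _) s0 s1 => s s0 s1.
have -> : (s * (Vf' c (qf (x, y)) * (2 * x))) ^+ 2 + (s * (Vf' c (qf (x, y)) * (2 * y))) ^+ 2 =
  s ^+ 2 * (4 * (x ^+ 2 + y ^+ 2) * Vf' c (qf (x, y)) ^+ 2) by ring.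
rewrite -[x ^+ 2 + y ^+ 2]/(qf (x, y)).
rewrite ler_piMl ?expr_le1//.
by apply: mulr_ge0; [rewrite mulr_ge0// ltW|exact: sqr_ge0].
Qed.

Lemma radial_FTC (F f : R -> R) : (forall x : R, 0 < x -> is_derive x (1 : R) F (f x)) ->
  (forall x : R, 0 < x -> {for x, continuous f}) -> (forall x, 1 < x < b -> 0 <= f x) ->
  (\int[lam2]_(p in D) (f (qf p))%:E)%E = (pi * (F b - F 1))%:E.
Proof.
move=> dF cf f0; have -> : D = (@qf R) @^-1` [set` `]1, b[].
  by rewrite /D annulusE//; apply/seteqP; split=> p /=; rewrite in_itv.
rewrite (@radial_integral _ f)//.
- by rewrite (FTC_pos ltr01 b_gt1 dF cf) EFinM.
- by move=> x /=; rewrite in_itv /= => /andP[x1 _]; exact: lt_trans x1.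
- apply: open_continuous_measurable_fun; first exact: interval_open.
  by move=> x; rewrite inE /= in_itv /= => /andP[x1 _]; apply: cf; exact: lt_trans x1.
Qed.

(** These are the squared gradient norm and the fourth power of the L^4 norm of the torsion
    function; [errT] is the first-order loss of the latter under smoothing, 8 VB^3 times the area of
    the annulus. *)
Definition gradT : R := pi * (primG c b - primG c 1).
Definition quartT : R := pi * (primV4 c b - primV4 c 1).
Definition errT : R := 8 * VB ^+ 3 * (pi * (b - 1)).

Let mc (f : R * R -> R) : continuous f -> measurable_fun D f.
Proof. by move=> cf; apply: measurable_funS (continuous_measurable2 cf). Qed.

Lemma measurable_radial (f : R -> R) : (forall x : R, 0 < x -> {for x, continuous f}) ->
  measurable_fun D (fun p => f (qf p)).
Proof.
move=> cf; have mD := measurable_annulus R1.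
apply: (@measurable_comp _ _ _ _ _ _ [set x : R | 0 < x] f D (@qf R)).
- by apply: open_measurable; exact: open_gt.
- by move=> _ [p + <-]; rewrite /D annulusE// => /andP[h _] /=; exact: lt_trans h.
- by apply: open_continuous_measurable_fun; [exact: open_gt|move=> x; rewrite inE => /cf].
- exact: mc (@continuous_qf R).
Qed.

Lemma grad_vT_le : (grad_norm_sq D (pd false vT) (pd true vT) <= gradT%:E)%E.
Proof.
rewrite /gradT -(radial_FTC (is_derive_primG c) (@continuous_G R c)); last first.
  by move=> x /andP[x1 _]; rewrite mulr_ge0 ?sqr_ge0// mulr_ge0// ltW// (lt_trans _ x1).
have sm := smooth_vT.
apply: ge0_le_integral.
- exact: measurable_annulus.
- by move=> p _; rewrite lee_fin addr_ge0// sqr_ge0.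
- apply/measurable_EFinP/measurable_funD; apply: measurable_sq.
    apply: mc; exact: (sm [:: false]).1.
  apply: mc; exact: (sm [:: true]).1.
- by apply/measurable_EFinP; exact: (measurable_radial (@continuous_G R c)).
- by move=> p Dp; rewrite lee_fin; exact: pd_vT.
Qed.

Lemma quart_vT : exists2 I : R, quartT - eps * errT <= I &
  (\int[lam2]_(p in D) (`|vT p| ^+ 4)%:E)%E = I%:E.
Proof.
have cv := (smooth_vT [::]).1.
have cv4 : continuous (fun p => `|vT p| ^+ 4).
  by move=> p; apply: cvgXn; apply: cvg_norm; exact: cv.
have E : (\int[lam2]_(p in D) (`|vT p| ^+ 4)%:E)%E = (Int2 (fun p => `|vT p| ^+ 4))%:E.
  apply: (@integral_Int2 R Rad).
    by apply: (Cc2_annulus KD) => // p /K0 ->; rewrite normr0 expr0n.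
  by move=> p Dp; rewrite K0 ?normr0 ?expr0n// => /KD.
exists (Int2 (fun p => `|vT p| ^+ 4)) => //.
rewrite -lee_fin.
have B0 : 0 <= VB by rewrite /VB divr_ge0// subr_ge0 ltW// b_gt1.
have k0 : 0 <= 8 * eps * VB ^+ 3 by apply: mulr_ge0; [rewrite mulr_ge0// ltW|exact: exprn_ge0].
have := @le_intD R D (measurable_annulus R1) (fun p => V (qf p) ^+ 4) (fun p => `|vT p| ^+ 4)
  (cst 1) 1 (8 * eps * VB ^+ 3).
rewrite E mul1e (radial_FTC (is_derive_primV4 c) (@continuous_V4 R c)); last first.
  by move=> x /andP[x1 xb]; rewrite exprn_ge0// ltW// Vf_gt0.
rewrite (_ : (fun p => (cst 1 p)%:E) = fun p => (cst 1 (qf p))%:E)//.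
rewrite (@radial_FTC id (cst 1)); first last.
- by [].
- by move=> x _; exact: cvg_cst.
rewrite -!EFinM -EFinD !lee_fin -/quartT.
move=> h; suff : quartT <= Int2 (fun p => `|vT p| ^+ 4) + 8 * eps * VB ^+ 3 * (pi * (b - 1)).
  by rewrite /errT; move: (Int2 _) quartT (pi * _) => x y z; lra.
apply: h => //.
- exact: (measurable_radial (@continuous_V4 R c)).
- exact: mc.
- move=> p; rewrite /D annulusE// => /andP[x1 xb].
  by rewrite exprn_ge0// ltW// Vf_gt0.
- move=> p Dp; have := Dp; rewrite /D annulusE// => /andP[x1 xb].
  rewrite mul1r mulr1 (ger0_norm (vT_ge0 p)).
  apply: fourth_power_ge; [exact/ltW/Vf_gt0|by apply: Vf_le; exact: ltW|exact: ltW|exact: vT_ge0|exact: vT_ge].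
Qed.

Lemma S4_le_eps : 0 < quartT - eps * errT ->
  (S4 D <= (gradT / Num.sqrt (quartT - eps * errT))%:E)%E.
Proof.
move=> P0; have [I IP IE] := quart_vT.
have I0 : 0 < I := lt_le_trans P0 IP.
have H := H10_test test_vT.
have [G G0 GE] := H10_grad_fin R1 H.
have GG : G <= gradT by rewrite -lee_fin -GE grad_vT_le.
have LE : L4norm_sq D vT = (Num.sqrt I)%:E.
  by rewrite /L4norm_sq IE poweR_EFin powR12_sqrt// ltW.
apply: (@le_trans _ _ (G / Num.sqrt I)%:E); last first.
  rewrite lee_fin; apply: ler_pM => //.
  by rewrite lef_pV2 ?posrE ?sqrtr_gt0// ler_wsqrtr.
apply: ereal_inf_lbound; exists vT, (pd false vT), (pd true vT); split => //.
  move=> ae0.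
  have cv := (smooth_vT [::]).1.
  have mD := measurable_annulus R1.
  have : (\int[lam2]_(p in D) (`|vT p| ^+ 4)%:E = \int[lam2]_(p in D) (cst 0 p))%E.
    apply: ge0_ae_eq_integral => //.
    - apply/measurable_EFinP; apply: mc => p; apply: cvgXn; apply: cvg_norm; exact: cv.
    - apply: negligibleS ae0 => p /= np h; apply: np => Dp.
      by rewrite h// normr0 expr0n.
  by rewrite IE integral0 => -[I00]; move: I0; rewrite I00 ltxx.
by rewrite GE LE.
Qed.

End Test.
(** The mean value theorem exhibits a positive value of the integrand. Positivity of [kappa1],
    invisible in its formula, is derived from this. *)
Lemma quartT_gt0 (Rad : R) : 1 < Rad -> 0 < quartT Rad.
Proof.
move=> R1; have b1 := b_gt1 R1.
have [z| |z] := @MVT R (primV4 (cT Rad)) (fun q => Vf (cT Rad) q ^+ 4) 1 (Rad ^+ 2) b1.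
- by rewrite in_itv /= => /andP[z1 _]; apply: is_derive_primV4; exact: lt_trans z1.
- have cp x : 0 < x -> {for x, continuous (primV4 (cT Rad))}.
    move=> x0; apply/differentiable_continuous/derivable1_diffP.
    by have h := is_derive_primV4 (cT Rad) x0; apply: ex_derive.
  apply/continuous_within_itvP => //; split=> [z| |].
  + by rewrite in_itv /= => /andP[z1 _]; apply: cp; exact: lt_trans z1.
  + by apply: cvg_at_right_filter; exact: cp.
  + by apply: cvg_at_left_filter; apply: cp; exact: lt_trans b1.
rewrite in_itv /= => /andP[z1 zb] e.
rewrite /quartT e mulr_gt0 ?pi_gt0// mulr_gt0 ?subr_gt0//.
by rewrite exprn_gt0// Vf_gt0.
Qed.

Lemma S4_le (Rad : R) : 1 < Rad ->
  (S4 (annulus Rad) <= (gradT Rad / Num.sqrt (quartT Rad))%:E)%E.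
Proof.
move=> R1; have Q0 := quartT_gt0 R1.
pose P e := quartT Rad - e * errT Rad.
have cP : P e @[e --> 0^'+] --> quartT Rad.
  have -> : quartT Rad = P 0 by rewrite /P mul0r subr0.
  apply: cvg_at_right_filter; apply: cvgB; first exact: cvg_cst.
  by apply: cvgM; [exact: cvg_id|exact: cvg_cst].
have cf : gradT Rad / Num.sqrt (P e) @[e --> 0^'+] --> gradT Rad / Num.sqrt (quartT Rad).
  apply: cvgM; first exact: cvg_cst.
  apply: cvgV; first by rewrite gt_eqF// sqrtr_gt0.
  by apply: continuous_cvg => //; exact: sqrt_continuous.
have near_le : \forall e \near 0^'+, (S4 (annulus Rad) <= (gradT Rad / Num.sqrt (P e))%:E)%E.
  near=> e; apply: S4_le_eps => //.
  have : 0 < P e by near: e; exact: (cvgr_gt _ cP).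
  by [].
(* The limit is taken among reals; an infinite infimum is either trivial or excluded by one finite
   bound. *)
case: (S4 (annulus Rad)) near_le => [r|h|] /=.
- move=> h; rewrite lee_fin; apply: (cvgr_to_ge cf).
  by apply: filterS h => e; rewrite lee_fin.
- exfalso; near (0 : R)^'+ => e.
  have : (+oo <= (gradT Rad / Num.sqrt (P e))%:E)%E by near: e.
  by rewrite leye_eq.
- by rewrite leNye.
Unshelve. all: by end_near. Qed.

Lemma gradT_quartT (Rad : R) : 1 < Rad -> gradT Rad / Num.sqrt (quartT Rad) =
  24 * Num.sqrt (5 * pi) *
   (((Rad ^+ 2 + 1) * ln Rad + 1 - Rad ^+ 2) * (Rad ^+ 2 - 1) * ln Rad)
   / Num.sqrt (kappa1 Rad).
Proof.
move=> R1; have Q0 := quartT_gt0 R1; have L0 := L_gt0 R1.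
have pi0 := @pi_gt0 R.
have QE : quartT Rad = pi * (kappa1 Rad / (512 * 360 * ln Rad ^+ 4)).
  by rewrite /quartT primV4_Rad.
have k0 : 0 < kappa1 Rad.
  have d0 : 0 < 512 * 360 * ln Rad ^+ 4.
    by apply: mulr_gt0; [apply: mulr_gt0; rewrite ltr0n|exact: exprn_gt0].
  move: d0 Q0; rewrite QE; move: (512 * 360 * _) (kappa1 Rad) => d k d0.
  by rewrite pmulr_rgt0// pmulr_lgt0// invr_gt0.
(* 512 * 360 = 960^2 / 5, whence the factor sqrt (5 pi); the final 24 is 960 / (8 * 5). *)
have sE : Num.sqrt (quartT Rad) =
    Num.sqrt (5 * pi) * Num.sqrt (kappa1 Rad) / (960 * ln Rad ^+ 2).
  have d0 : 0 <= 960 * ln Rad ^+ 2 by apply: mulr_ge0; [rewrite ler0n|exact: sqr_ge0].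
  rewrite -sqrtrM ?mulr_ge0 ?(ltW pi0)//.
  rewrite -[X in _ / X](ger0_norm d0) -sqrtr_sqr -sqrtrV ?sqr_ge0// -sqrtrM; last first.
    by rewrite !mulr_ge0 ?(ltW pi0) ?(ltW k0).
  congr Num.sqrt; rewrite QE; move: (@pi R) (ln Rad) (kappa1 Rad) L0 => p l k l0.
  by field; rewrite gt_eqF.
rewrite sE /gradT primG_Rad//.
have s5 : Num.sqrt (5 * pi) * Num.sqrt (5 * pi) = 5 * pi :> R.
  by rewrite -expr2 sqr_sqrtr// mulr_ge0// ltW.
have s50 : 0 < Num.sqrt (5 * pi) :> R by rewrite sqrtr_gt0 mulr_gt0.
have sk0 : 0 < Num.sqrt (kappa1 Rad) by rewrite sqrtr_gt0.
have -> : pi = 5^-1 * (Num.sqrt (5 * pi) * Num.sqrt (5 * pi)) :> R by rewrite s5; move: (@pi R) => p; field.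
move: s50 sk0 L0; rewrite -/(cT Rad).
have -> : Num.sqrt (5 * (5^-1 * (Num.sqrt (5 * pi) * Num.sqrt (5 * pi)))) = Num.sqrt (5 * pi) :> R.
  by rewrite s5; congr Num.sqrt; move: (@pi R) => p; field.
move: (Num.sqrt (5 * pi)) (Num.sqrt (kappa1 Rad)) (ln Rad) => s k l s0 k0' l0.
by field; rewrite !gt_eqF.
Qed.

End Upper.

(** * The scalar inequality and the lower bound for S_4 *)

Section Final.
Variable R : realType.
Local Notation lam2 := (@lam2 R).
Variables (Rad mu0 : R).
Hypotheses (R1 : 1 < Rad) (m0 : 0 < mu0)
  (nz : forall x : R, 0 < x < mu0 -> besselJ0 x != 0).
Let D := annulus Rad.
Local Notation C := (Cst Rad mu0).

Lemma H10_0 : H10 D (cst 0) (cst 0) (cst 0).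
Proof.
have pd0 b : pd b (cst 0) = cst 0 :> (R * R -> R).
  by apply/funext => p; rewrite /pd; case: b; rewrite derive1_cst.
have it0 s : iter_pd s (cst 0) = cst 0 :> (R * R -> R).
  by elim: s => //= b s ->.
have z : L2dist2 D (cst 0) (cst 0) @[n --> \oo] --> 0%E.
  rewrite (_ : L2dist2 _ _ _ = 0%E); first exact: cvg_cst.
  by apply: integral0_eq => x _; rewrite subrr expr0n.
split; [exact: measurable_cst..|exists (fun=> cst 0)]; split; rewrite ?pd0//.
move=> _; split; last by exists set0; split => //; exact: compact0.
move=> s; rewrite it0; split; first by move=> p; exact: cvg_cst.
by move=> p; split; exact: derivable_cst.
Qed.

Lemma H10_scalar w g1 g2 : H10 D w g1 g2 ->
  (L4norm_sq D w <= C%:E * grad_norm_sq D g1 g2)%E.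
Proof.
move=> h; have := H10_vec R1 m0 nz h H10_0.
have -> : grad_norm_sq D (cst 0) (cst 0) = 0%E.
  by apply: integral0_eq => x _; rewrite /= expr0n /= addr0.
rewrite adde0; apply: le_trans.
have -> : L4norm_sq_vec D w (cst 0) = L4norm_sq D w; last by [].
rewrite /L4norm_sq_vec /L4norm_sq; congr poweR; apply: eq_integral => x _.
by rewrite /= expr0n addr0 sqrtr_sqr.
Qed.

Lemma Cst_inv : mu0 * Num.sqrt (3 * pi / (2 * (Rad ^+ 2 - 1))) = C^-1.
Proof.
have r0 := Rad21 R1; have pi0 := @pi_gt0 R.
rewrite /Cst [RHS]invfM [in RHS]invrK -sqrtrV; last first.
  by rewrite mulr_ge0 ?(ltW r0)// divr_ge0// mulr_ge0// ltW.
congr (_ * Num.sqrt _); move: (@pi R) (Rad ^+ 2 - 1) pi0 r0 => p r p0 r0.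
by field; rewrite !gt_eqF.
Qed.

(** The scalar inequality also shows that the L^4 norm is finite, and a zero norm would make [v]
    vanish almost everywhere; so [fine] alters nothing and the division is legitimate. *)
Lemma S4_ge : ((mu0 * Num.sqrt (3 * pi / (2 * (Rad ^+ 2 - 1))))%:E <= S4 D)%E.
Proof.
rewrite Cst_inv; apply/ereal_infP => _ [v [g1 [g2 [h n0 ->]]]].
have [G G0 GE] := H10_grad_fin R1 h.
have C0 := Cst_gt0 R1 m0.
have := H10_scalar h; rewrite GE -EFinM => hL.
have I0 : (0 <= \int[lam2]_(p in D) (`|v p| ^+ 4)%:E)%E.
  by apply: integral_ge0 => p _; rewrite lee_fin exprn_ge0.
have mD := measurable_annulus R1.
have [mv _ _ _] := h.
have In0 : (\int[lam2]_(p in D) (`|v p| ^+ 4)%:E != 0)%E.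
  apply/eqP => IE; apply: n0.
  have mf : measurable_fun D (fun p => (`|v p| ^+ 4)%:E).
    by apply/measurable_EFinP/measurable_funX/measurableT_comp.
  have IE' : (\int[lam2]_(p in D) `|(`|v p| ^+ 4)%:E| = 0)%E.
    by rewrite -[RHS]IE; apply: eq_integral => p _; rewrite gee0_abs// lee_fin exprn_ge0.
  have ae0 := (ae_eq_integral_abs (lebesgue_measure \x lebesgue_measure)%E mD mf).1 IE'.
  apply: negligibleS ae0 => p /= np h0; apply: np => Dp; have [] := h0 Dp.
  by move/eqP; rewrite expf_eq0 /= normr_eq0 => /eqP.
have [s s0 sE] : exists2 s : R, 0 < s & L4norm_sq D v = s%:E.
  move: (hL) I0 In0; rewrite /L4norm_sq; case: (\int[lam2]_(p in D) _)%E => [r||//].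
    rewrite poweR_EFin !lee_fin => _ r0 rn; exists (r `^ 2^-1) => //.
    by rewrite powR_gt0// lt_neqAle r0 andbT eq_sym; apply: contra rn => /eqP ->.
  by rewrite poweRyr ?invr_eq0// leye_eq.
rewrite sE lee_fin in hL; rewrite sE /= lee_fin.
by rewrite ler_pdivlMr// mulrC ler_pdivrMr// mulrC.
Qed.

End Final.

Theorem theoremA2 (R : realType) (Rad mu0 : R) :
  1 < Rad ->
  0 < mu0 -> besselJ0 mu0 = 0 ->
  (forall x : R, 0 < x < mu0 -> besselJ0 x != 0) ->
  let C := mu0^-1 * Num.sqrt (2 / (3 * pi) * (Rad ^+ 2 - 1)) in
  [/\ (* scalar case *)
      (forall w g1 g2 : R * R -> R, H10 (annulus Rad) w g1 g2 ->
         (L4norm_sq (annulus Rad) w <= C%:E * grad_norm_sq (annulus Rad) g1 g2)%E),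
      (* vector case w = (w1, w2), gradient components (g11,g12), (g21,g22) *)
      (forall w1 w2 g11 g12 g21 g22 : R * R -> R,
         H10 (annulus Rad) w1 g11 g12 -> H10 (annulus Rad) w2 g21 g22 ->
         (L4norm_sq_vec (annulus Rad) w1 w2 <=
            C%:E * (grad_norm_sq (annulus Rad) g11 g12
                    + grad_norm_sq (annulus Rad) g21 g22))%E),
      ((mu0 * Num.sqrt (3 * pi / (2 * (Rad ^+ 2 - 1))))%:E <= S4 (annulus Rad))%E &
      (S4 (annulus Rad) <=
         (24 * Num.sqrt (5 * pi) *
          (((Rad ^+ 2 + 1) * ln Rad + 1 - Rad ^+ 2) * (Rad ^+ 2 - 1) * ln Rad)
          / Num.sqrt (kappa1 Rad))%:E)%E].
Proof.
move=> R1 m0 _ nz C; split.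
- by move=> w g1 g2; exact: H10_scalar.
- by move=> w1 w2 g11 g12 g21 g22; exact: H10_vec.
- exact: S4_ge.
- by rewrite -gradT_quartT//; exact: S4_le.
Qed.
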